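(* Let $C\subset\mathbb{A}_k^2$ be a curve defined over an algebraically closed field $k$ of characteristic $p>0$, considered at the origin $0$. Then there exists a lifting $\widetilde C\subset\mathbb{A}_{\mathbb{C}}^2$ of $C$ such that $(\widetilde C,0)$ is a complex model of $(C,0)$ in the sense of Campillo. In other words, there are (over neighbourhoods of the origins) embedded resolutions \[ \varphi:A'\to\mathbb{A}_k^2\qquad\text{and}\qquad \widetilde\varphi:\widetilde A'\to\mathbb{A}_{\mathbb{C}}^2 \] of $(C,\mathbb{A}_k^2)$ and $(\widetilde C,\mathbb{A}_{\mathbb{C}}^2)$, respectively, with the same multiplicity data of the reduced total transforms at every stage of the successive point blow-ups.
   Context: Curves are reduced plane curves. Skeletons and liftings. Let $F$ be a field of characteristic $q\ge0$ and $R$ an integral domain that is a finitely generated $F$-algebra. A skeleton of $R$ is a finitely generated $\mathbb{Z}/(q)$-subalgebra $S\subset R$ (a finitely generated $\mathbb{Z}$-subalgebra if $q=0$) with $F[S]=R$. For $R$ over a field of characteristic $p>0$ and $\widetilde R$ over a field of characteristic $0$, skeletons $S\subset R$, $\widetilde S\subset\widetilde R$ are compatible if $\widetilde S$ is $\mathbb{Z}$-flat at $p$ and $S\simeq\widetilde S\otimes_{\mathbb{Z}}\mathbb{Z}/(p)$; $\Phi_p:\widetilde S\to S$ is the canonical surjection. For polynomial rings one uses compatible skeletons $\Sigma\subset k$, $\widetilde\Sigma\subset\mathbb{C}$ and the induced compatible skeletons $\Sigma[x_1,x_2]\subset k[x_1,x_2]$, $\widetilde\Sigma[x_1,x_2]\subset\mathbb{C}[x_1,x_2]$.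 An ideal $\widetilde{\mathfrak{a}}\subset\widetilde R$ is a lifting of an ideal $\mathfrak{a}\subset R$ if $\widetilde{\mathfrak{a}}$ has a system of generators in $\widetilde S$ whose image under $\Phi_p$ generates $\mathfrak{a}$. The curve $\widetilde C$ is a lifting of $C$ if its defining ideal is a lifting of the defining ideal of $C$. Complex model and multiplicity data. Both embedded resolutions are obtained by successive blow-ups of closed points lying over the origin. Having the same multiplicity data means that the two sequences of blow-ups correspond step by step (with corresponding centers), and at each stage the multiplicities of the reduced total transforms of the curves at the corresponding points are equal, i.e. the systems of multiplicity sequences of the reduced total transforms in the two resolution processes coincide. A complex model of $(C,0)$ is a complex plane curve singularity whose equisingularity type, in this sense, is the same as that of $(C,0)$. *)

(* Defs.v *)
From HB Require Import structures.
From mathcomp Require Import all_boot all_order all_algebra.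
From mathcomp Require Import reals complex mpoly.

Set Implicit Arguments.
Unset Strict Implicit.
Unset Printing Implicit Defensive.

Import GRing.Theory.

Local Open Scope ring_scope.

(** * Ideals *)

Definition generated_ideal (A : comNzRingType) n (g : 'I_n -> A) (h : A) : Prop :=
  exists a : 'I_n -> A, h = \sum_(i < n) a i * g i.

Definition mdivides (A : comNzRingType) (f h : A) : Prop := exists a, h = a * f.

(* (g) is the radical of the ideal (f) *)
Definition radical_generator (A : comNzRingType) (f g : A) : Prop :=
  forall h, mdivides g h <-> exists n, mdivides f (h ^+ n).

(** * Skeletons and liftings *)

(* Some finite set of elements is contained in no proper subring. *)
Definition finitely_generated_ring (S : comNzRingType) : Prop :=
  exists s : seq S, forall P : S -> Prop,
    P 1 -> (forall x y, P x -> P y -> P (x - y)) ->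
    (forall x y, P x -> P y -> P (x * y)) ->
    (forall x, x \in s -> P x) -> forall x, P x.

(* A skeleton S of the F-algebra A is carried by a type together with its
   inclusion into A.  Since S is a subring of A, being finitely generated over
   the prime ring Z/(q) (over Z if q = 0) means being generated as a ring by
   finitely many elements. *)
Record skeleton (F : fieldType) (A : comAlgType F) := Skeleton {
  skel_ring :> comNzRingType;
  skel_incl : {rmorphism skel_ring -> A};
  skel_inj : injective skel_incl;
  skel_fg : finitely_generated_ring skel_ring;
  skel_span : forall x : A, exists n (a : 'I_n -> F) (s : 'I_n -> skel_ring),
    x = \sum_(i < n) a i *: skel_incl (s i)
}.

(* The isomorphism S ~ S' (x) Z/(p) is given by the surjection S' -> S with
   kernel p S'.  A module over the discrete valuation ring Z_(p) is flat iff it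
   has no p-torsion. *)
Record compatible (p : nat) (F F' : fieldType) (A : comAlgType F)
    (A' : comAlgType F') (S : skeleton A) (S' : skeleton A') := Compatible {
  reduction :> {rmorphism S' -> S};
  reduction_surj : forall x : S, exists y : S', reduction y = x;
  reduction_ker : forall y : S', reduction y = 0 <-> exists z : S', y = z *+ p;
  flat_at_p : forall y : S', y *+ p = 0 -> y = 0
}.

Definition lifting_ideal p (F F' : fieldType) (A : comAlgType F)
    (A' : comAlgType F') (S : skeleton A) (S' : skeleton A')
    (Phi : compatible p S S') (I : A -> Prop) (I' : A' -> Prop) : Prop :=
  exists n (g : 'I_n -> S'),
    (forall h, I' h <-> generated_ideal (fun i => skel_incl S' (g i)) h) /\
    (forall h, I h <-> generated_ideal (fun i => skel_incl S (Phi (g i))) h).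

Section PolySkeleton.

Lemma poly_fg n (S : comNzRingType) :
  finitely_generated_ring S -> finitely_generated_ring {mpoly S[n]}.
Proof.
move=> [s gen]; exists ([seq c%:MP | c <- s] ++ [seq 'X_i | i <- enum 'I_n]).
move=> P P1 PB PM Ps.
have P0 : P 0 by rewrite -(subrr 1); apply: PB.
have PN x : P x -> P (- x) by move=> Px; rewrite -sub0r; apply: PB.
have PD x y : P x -> P y -> P (x + y).
  by move=> Px Py; rewrite -[y]opprK; apply: PB => //; apply: PN.
have PC c : P c%:MP.
  apply: (gen (fun c => P c%:MP)) => [|x y|x y|x xs].
  - by rewrite mpolyC1.
  - by rewrite mpolyCB; apply: PB.
  - by rewrite mpolyCM; apply: PM.
  - by apply: Ps; rewrite mem_cat map_f.
have PX m : P 'X_[m].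
  rewrite mpolyXE_id; apply: big_ind => // i _.
  elim: (m i) => [|j IHj]; first by rewrite expr0.
  rewrite exprS; apply: PM => //; apply: Ps.
  by rewrite mem_cat; apply/orP; right; apply: map_f; rewrite mem_enum.
elim/mpolyind => // c m q _ _ Pq.
by rewrite -mul_mpolyC; apply: (PD _ _ (PM _ _ (PC c) (PX m))).
Qed.

Lemma map_mpoly_inj n (S A : nzRingType) (f : {rmorphism S -> A}) :
  injective f -> injective (map_mpoly f : {mpoly S[n]} -> {mpoly A[n]}).
Proof.
move=> fI x y exy; apply/mpolyP => m; apply: fI.
by rewrite -!mcoeff_map_mpoly exy.
Qed.

Lemma poly_span n (F : fieldType) (S : comNzRingType) (f : {rmorphism S -> F})
    (x : {mpoly F[n]}) :
  exists l (a : 'I_l -> F) (s : 'I_l -> {mpoly S[n]}),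
    x = \sum_(i < l) a i *: map_mpoly f (s i).
Proof.
exists (size (msupp x)), (fun i => x@_(nth 0%MM (msupp x) i)).
exists (fun i => 'X_[nth 0%MM (msupp x) i]).
rewrite [LHS]mpolyE (big_nth 0%MM) big_mkord.
by apply: eq_bigr => i _; rewrite map_mpolyX.
Qed.

Lemma map_mpoly_surj n (S' S : comNzRingType) (f : {rmorphism S' -> S}) :
  (forall x, exists y, f y = x) ->
  forall x : {mpoly S[n]}, exists y : {mpoly S'[n]}, map_mpoly f y = x.
Proof.
move=> fS; elim/mpolyind => [|c m q _ _ [y <-]]; first by exists 0; rewrite rmorph0.
have [b <-] := fS c; exists (b *: 'X_[m] + y).
by rewrite rmorphD /= map_mpolyZ map_mpolyX.
Qed.

Lemma map_mpoly_ker n p (S' S : comNzRingType) (f : {rmorphism S' -> S}) :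
  (forall y, f y = 0 <-> exists z, y = z *+ p) ->
  forall y : {mpoly S'[n]}, map_mpoly f y = 0 <-> exists z, y = z *+ p.
Proof.
move=> fK y; split=> [y0|[z ->]]; last first.
  apply/mpolyP => m; rewrite mcoeff_map_mpoly mcoeff0 mcoeffMn.
  by apply/fK; exists z@_m.
have yp m : exists z, y@_m = z *+ p.
  by apply/fK; rewrite -mcoeff_map_mpoly y0 mcoeff0.
rewrite [y]mpolyE.
apply: (big_rec (fun q => exists z, q = z *+ p)) => [|m q _ [z ->]].
  by exists 0; rewrite mul0rn.
have [c ->] := yp m; exists (c *: 'X_[m] + z).
by rewrite mulrnDl scalerMnl.
Qed.

Lemma mpoly_torsion_free n p (S' : comNzRingType) :
  (forall y : S', y *+ p = 0 -> y = 0) ->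
  forall y : {mpoly S'[n]}, y *+ p = 0 -> y = 0.
Proof.
move=> tf y y0; apply/mpolyP => m; rewrite mcoeff0; apply: tf.
by rewrite -mcoeffMn y0 mcoeff0.
Qed.

Definition poly_skeleton n (F : fieldType) (S : skeleton F^o) :
    skeleton {mpoly F[n]} :=
  let i : {rmorphism S -> F} := skel_incl S in
  @Skeleton F {mpoly F[n]} {mpoly S[n]} (map_mpoly i)
    (@map_mpoly_inj n S F i (@skel_inj _ _ S)) (poly_fg n (skel_fg S))
    (@poly_span n F S i).

Definition poly_compatible n p (F F' : fieldType) (S : skeleton F^o)
    (S' : skeleton F'^o) (Phi : compatible p S S') :
    compatible p (poly_skeleton n S) (poly_skeleton n S') :=
  @Compatible p F F' {mpoly F[n]} {mpoly F'[n]} (poly_skeleton n S)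
    (poly_skeleton n S') (map_mpoly Phi)
    (map_mpoly_surj (reduction_surj Phi)) (map_mpoly_ker (reduction_ker Phi))
    (mpoly_torsion_free (@flat_at_p _ _ _ _ _ _ _ Phi)).

End PolySkeleton.

(** * Plane curves *)

(* A reduced plane curve is given by a generator f of its defining ideal. *)
Definition plane_curve (K : fieldType) (f : {mpoly K[2]}) : Prop :=
  (1 < msize f)%N /\ radical_generator f f.

Definition lifting_curve p (K K' : fieldType) (f : {mpoly K[2]})
    (f' : {mpoly K'[2]}) : Prop :=
  exists (S : skeleton K^o) (S' : skeleton K'^o) (Phi : compatible p S S'),
    lifting_ideal (poly_compatible 2 Phi) (mdivides f) (mdivides f').

(** * Points infinitely near to the origin *)

(* A direction at a point with local coordinates (x, y): [Some a] is the line
   y = a x and [None] is the line x = 0.  Directions are the closed points of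
   the exceptional curve when the point is blown up.  An infinitely near point
   is the sequence of directions leading to it from the origin [::]; the first
   direction is taken at the origin. *)
Definition direction (K : Type) := option K.
Definition near_point (K : Type) := seq (direction K).

(* Blow-up of (0,0) in the coordinates centred at the point with direction d:
   (x, y) |-> (x, x (y + a)), respectively (x, y) |-> (x y, y). *)
Definition chart (K : fieldType) (d : direction K) : 2.-tuple {mpoly K[2]} :=
  if d is Some a then [tuple 'X_0; 'X_0 * ('X_1 + a%:MP)]
  else [tuple 'X_0 * 'X_1; 'X_1].

Definition total_transform (K : fieldType) (f : {mpoly K[2]})
    (q : near_point K) : {mpoly K[2]} :=
  foldl (fun h d => h \mPo chart d) f q.

(* g is an equation of the reduced total transform, in the coordinates at q *)
Definition reduced_total_transform (K : fieldType) (f : {mpoly K[2]})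
    (q : near_point K) (g : {mpoly K[2]}) : Prop :=
  radical_generator (total_transform f q) g.

(* multiplicity at (0,0) of g <> 0 *)
Definition mult0 (K : fieldType) (g : {mpoly K[2]}) : nat :=
  \big[minn/msize g]_(m <- msupp g) mdeg m.

Definition multiplicity_at (K : fieldType) (f : {mpoly K[2]})
    (q : near_point K) (m : nat) : Prop :=
  exists2 g, reduced_total_transform f q g & mult0 g = m.

(** * Sequences of point blow-ups over the origin *)

(* For the surface obtained by blowing up the points in c, the closed points
   over the origin are those not blown up but all of whose proper
   predecessors are. *)
Definition point_of (K : fieldType) (c : seq (near_point K))
    (q : near_point K) : bool :=
  (q \notin c) && [forall j : 'I_(size q), take j q \in c].

Definition blowup_sequence (K : fieldType) (c : seq (near_point K)) : Prop :=
  forall i, (i < size c)%N -> point_of (take i c) (nth [::] c i).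

(* {g = 0} has simple normal crossings at (0,0): g = u v^a w^b with u a unit
   and (v, w) a regular system of parameters of the local ring at (0,0). *)
Definition snc_at0 (K : fieldType) (g : {mpoly K[2]}) : Prop :=
  exists (u v w : {mpoly K[2]}) (a b : bool),
    [/\ g = u * v ^+ a * w ^+ b,
        u.@[fun=> 0] != 0, v.@[fun=> 0] = 0, w.@[fun=> 0] = 0
      & v@_U_(0) * w@_U_(1) - v@_U_(1) * w@_U_(0) != 0].

Definition embedded_resolution (K : fieldType) (f : {mpoly K[2]})
    (c : seq (near_point K)) : Prop :=
  blowup_sequence c /\
  forall q, point_of c q -> exists2 g, reduced_total_transform f q g & snc_at0 g.

(* The points [nth [::] c i] and [nth [::] c' i] are the (i+1)-st centres, and
   [take i c] is the surface after i blow-ups.  [corr] is the correspondence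
   of points: it contains the origins, the centres, and at every stage all
   singular points of the reduced total transforms; it respects stages and
   the projections between them (in particular it is one-to-one). *)
Definition same_multiplicity_data (K K' : fieldType)
    (f : {mpoly K[2]}) (c : seq (near_point K))
    (f' : {mpoly K'[2]}) (c' : seq (near_point K')) : Prop :=
  size c = size c' /\
  exists corr : near_point K -> near_point K' -> Prop,
    [/\ corr [::] [::] /\
          (forall i, (i < size c)%N -> corr (nth [::] c i) (nth [::] c' i)),
        (forall q q' r r', corr q q' -> corr r r' -> prefix q r = prefix q' r'),
        (forall q q' i, corr q q' ->
          point_of (take i c) q = point_of (take i c') q'),
        (forall q q' m, corr q q' ->
          multiplicity_at f q m <-> multiplicity_at f' q' m)
      & (forall i q m, point_of (take i c) q -> multiplicity_at f q m ->
          (1 < m)%N -> exists q', corr q q') /\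
        (forall i q' m, point_of (take i c') q' -> multiplicity_at f' q' m ->
          (1 < m)%N -> exists q, corr q q')].

Definition complex_model (K : fieldType) (R : realType) (f : {mpoly K[2]})
    (f' : {mpoly R[i][2]}) : Prop :=
  exists c c', [/\ embedded_resolution f c, embedded_resolution f' c'
    & same_multiplicity_data f c f' c'].

(* Main.v *)
Require Import Defs.
From HB Require Import structures.
From mathcomp Require Import all_boot all_order all_algebra.
From mathcomp Require Import reals complex mpoly.
From mathcomp Require Import boolp classical_sets polyXY ring lra zify.

Set Implicit Arguments.
Unset Strict Implicit.
Unset Printing Implicit Defensive.

Import GRing.Theory.

Local Open Scope ring_scope.

(** An embedded resolution of C exists because a nonzero polynomial in x in the ideal
    (f, f_x, f_y) loses a factor at every blow-up that keeps the multiplicity.  It is a tree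
    of infinitely near points, each of a multiplicity m equal to the intersection number of
    the strict transform with the exceptional curve created there.  Passing virtually through
    this cluster, i.e. having no terms of order < m at each point, is a finite system of linear
    conditions on a polynomial, and since C satisfies them with equality they are linearly
    independent.  Choose a finitely generated ring S' of complex numbers with a homomorphism
    to k of kernel pS' whose image contains the coefficients of f, the directions in the
    cluster and a dual basis of the conditions.  By independence the conditions on a lift of the
    dual basis form a matrix congruent to 1 modulo p, so an arbitrary lift of f can be corrected
    by a multiple of p so as to pass through the lifted cluster; adding a further multiple of p
    of high order makes it reduced.  The lift has the multiplicities and tangencies of C because
    they are bounded below by the conditions and above by reduction modulo p. *)

(** Lifting is one-sided: what is nonzero in [k] stays nonzero above, but what vanishes in [k] need
    not vanish there. An arbitrary lift of [f] therefore tends to have too small multiplicities at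
    the lifted points, and every vanishing condition has to be arranged over S'. This is why the
    system is first solved over [k] for all right-hand sides. Solvability over [k] rests on
    intersection numbers: the points over a centre of multiplicity m have total contact m with its
    exceptional curve, and forms of degree at least m can interpolate that much. The ring S' is an
    obstacle of its own, since the kernel of its reduction must be exactly pS'. Elements of [k] are
    adjoined one at a time. A transcendental one comes from a transcendental complex number, which
    exists because the complex numbers are uncountable; an algebraic one comes from a root of a
    lifted equation of least degree, after inverting an element of nonzero reduction. In
    characteristic p a reduced equation may have a vanishing derivative, so termination of the
    blow-ups uses both derivatives and the perfectness of [k]. *)

(** * Blow-ups of polynomials in two variables *)

(* outer variable y = 'X, inner variable x = 'X%:P: the coefficient of x^i y^j is g`_j`_i *)
Notation "'bipoly' K" := {poly {poly K}} (at level 10).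

Definition chartS (K : comNzRingType) (a : K) (g : bipoly K) : bipoly K :=
  g \Po ('X%:P * ('X + a%:P%:P)).

(** The substitution sends x^i y^j to x^(i+j) y^j, so dropping the first [m] powers of x discards
    exactly the terms of order below [m]. *)
Definition blowS (K : comNzRingType) (a : K) m (g : bipoly K) : bipoly K :=
  map_poly (drop_poly m) (g \Po ('X%:P * 'X)) \Po ('X + a%:P%:P).

Definition ordge (K : comNzRingType) m (g : bipoly K) : Prop :=
  forall i j, (i + j < m)%N -> g`_j`_i = 0.

Definition resx (K : comNzRingType) (g : bipoly K) : {poly K} :=
  map_poly (coefp 0) g.

(** The homogeneous part of degree [m] at x = 1. Its roots a are the tangent directions y = a x; the
    direction x = 0 shows as a degree below [m]. *)
Definition lform (K : comNzRingType) m (g : bipoly K) : {poly K} :=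
  \poly_(j < m.+1) g`_j`_(m - j).

Section Basic.
Variable K : comNzRingType.
Implicit Types (g h u : bipoly K) (a : K).

HB.instance Definition _ a := GRing.RMorphism.copy (chartS a)
  (comp_poly ('X%:P * ('X + a%:P%:P))).

HB.instance Definition _ := GRing.RMorphism.copy (@resx K) (map_poly (coefp 0)).

Lemma coef_compXY g j : (g \Po ('X%:P * 'X))`_j = g`_j * 'X^j.
Proof.
rewrite comp_polyE coef_sum.
under eq_bigr => i _ do rewrite exprMn -rmorphXn coefZ coefCM coefXn.
case: (ltnP j (size g)) => [jg|gj].
  rewrite (bigD1 (Ordinal jg)) //= eqxx mulr1 big1 ?addr0 // => i ij.
  by rewrite [j == i](introF eqP) ?mulr0 // => e; case/eqP: ij; apply: val_inj.
rewrite nth_default // mul0r big1 // => i _.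
by rewrite [j == i](introF eqP) ?mulr0 // => e; rewrite e leqNgt ltn_ord in gj.
Qed.

Fact blowS_linear a m : zmod_morphism (blowS a m).
Proof. by move=> u v; rewrite /blowS !raddfB. Qed.

HB.instance Definition _ a m :=
  GRing.isZmodMorphism.Build (bipoly K) (bipoly K) (blowS a m) (blowS_linear a m).

Lemma chartSE a g : chartS a g = (g \Po ('X%:P * 'X)) \Po ('X + a%:P%:P).
Proof. by rewrite /chartS -comp_polyA comp_polyM comp_polyC comp_polyX. Qed.

Lemma blowSP a m g : ordge m g -> chartS a g = 'X^m%:P * blowS a m g.
Proof.
move=> hg; rewrite chartSE /blowS.
have -> q : 'X^m%:P * (q \Po ('X + a%:P%:P)) = ('X^m%:P * q) \Po ('X + a%:P%:P).
  by rewrite comp_polyM comp_polyC.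
congr (_ \Po _).
apply/polyP => j; rewrite coefCM coef_map /= coef_compXY; apply/polyP => i.
rewrite coefXnM coef_drop_poly coefMXn.
case: (ltnP i m) => im; last by rewrite subnK // coefMXn.
by case: (ltnP i j) => ij //; apply: hg; lia.
Qed.

Lemma resxB g h : resx (g - h) = resx g - resx h. Proof. exact: rmorphB. Qed.
Lemma resxD g h : resx (g + h) = resx g + resx h. Proof. exact: rmorphD. Qed.
Lemma resxM g h : resx (g * h) = resx g * resx h. Proof. exact: rmorphM. Qed.
Lemma resx1 : resx (1 : bipoly K) = 1. Proof. exact: rmorph1. Qed.
Lemma chartSB a g h : chartS a (g - h) = chartS a g - chartS a h.
Proof. exact: rmorphB. Qed.
Lemma chartSM a g h : chartS a (g * h) = chartS a g * chartS a h.
Proof. exact: rmorphM. Qed.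
Lemma chartS1 a : chartS a 1 = 1.
Proof. exact: rmorph1. Qed.

Lemma resx_comp g h : resx (g \Po h) = resx g \Po resx h.
Proof. exact: map_comp_poly. Qed.

Lemma resx_Y : resx ('X : bipoly K) = 'X.
Proof. exact: map_polyX. Qed.

Lemma resx_C (c : {poly K}) : resx c%:P = (c`_0)%:P.
Proof. by apply/polyP => j; rewrite coef_map !coefC; case: eqP => // _; exact: coef0. Qed.

Lemma resx_compXa a g : resx (g \Po ('X + a%:P%:P)) = resx g \Po ('X + a%:P).
Proof.
by rewrite resx_comp resxD resx_Y resx_C coefC eqxx.
Qed.

(** Terms of order above [m] vanish on the exceptional curve and those below [m] have been dropped,
    so only the part of degree [m] survives. *)
Lemma resx_blowS a m g : resx (blowS a m g) = lform m g \Po ('X + a%:P).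
Proof.
rewrite resx_compXa; congr (_ \Po _).
apply/polyP => j; rewrite coef_map /= coef_map /= coef_compXY coef_drop_poly.
rewrite coefMXn coef_poly add0n ltnS; by case: ltnP.
Qed.

Lemma blowS0_coef m g i j : (blowS 0 m g)`_j`_i =
  if (i + m < j)%N then 0 else g`_j`_(i + m - j).
Proof.
rewrite /blowS !polyC0 addr0 comp_polyXr coef_map /= coef_compXY.
by rewrite coef_drop_poly coefMXn.
Qed.

Lemma ordgeD m g h : ordge m g -> ordge m h -> ordge m (g + h).
Proof. by move=> hg hh i j ij; rewrite !coefD hg ?hh ?addr0. Qed.

Lemma coef_mul2 g h i j : (g * h)`_j`_i =
  \sum_(b < j.+1) \sum_(a < i.+1) g`_b`_a * h`_(j - b)`_(i - a).
Proof. by rewrite coefM coef_sum; apply: eq_bigr => b _; rewrite coefM. Qed.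

Lemma ordgeM m n g h : ordge m g -> ordge n h -> ordge (m + n) (g * h).
Proof.
move=> hg hh i j ij; rewrite coef_mul2 big1 // => b _; rewrite big1 // => a _.
case: (ltnP (a + b) m) => abm; first by rewrite hg ?mul0r.
by rewrite [X in _ * X]hh ?mulr0 //; have := ltn_ord a; have := ltn_ord b; lia.
Qed.

Lemma ordge_le m n g : (m <= n)%N -> ordge n g -> ordge m g.
Proof. by move=> mn hg i j ij; apply: hg; apply: leq_trans mn. Qed.

Lemma ordgeMl m g h : ordge m h -> ordge m (g * h).
Proof. by move=> hh; apply: (@ordgeM 0). Qed.

Lemma ordge1P g : ordge 1 g <-> g`_0`_0 = 0.
Proof.
split=> [h|h i j]; first exact: h.
by case: i j => [|i] [|j] //.
Qed.

Lemma ordge_swap m g : ordge m g -> ordge m (swapXY g).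
Proof. by move=> hg i j ij; rewrite coef_swapXY hg // addnC. Qed.

Lemma ordge_monX m : ordge m ('X^m%:P : bipoly K).
Proof.
move=> i j ij; rewrite coefC; case: eqP ij => [->|_ _]; last by rewrite coef0.
by rewrite addn0 coefXn => im; rewrite ltn_eqF.
Qed.

Lemma mulXn_inj m : injective ( *%R ('X^m%:P : bipoly K)).
Proof.
move=> g h e; apply/polyP => j; apply/polyP => i.
have := congr1 (fun p : bipoly K => p`_j`_(i + m)) e.
by rewrite /= !coefCM !coefXnM ltnNge leq_addl /= addnK.
Qed.

Lemma blowSM a m u g : ordge m g -> blowS a m (u * g) = chartS a u * blowS a m g.
Proof.
move=> hg; apply: (@mulXn_inj m) => /=.
rewrite -blowSP; last exact: ordgeMl.
by rewrite rmorphM /= mulrCA -blowSP.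
Qed.

Lemma chartS_XP a (c : {poly K}) : chartS a c%:P = c%:P.
Proof. exact: comp_polyC. Qed.

Lemma chartS_Y a : chartS a 'X = 'X%:P * ('X + a%:P%:P).
Proof. exact: comp_polyX. Qed.

Lemma resx_chartS a g : resx (chartS a g) = (g`_0`_0)%:P.
Proof.
rewrite /chartS resx_comp resxM resx_C coefX polyC0 mul0r.
by rewrite comp_poly0r coef_map.
Qed.

Lemma resx_eq0 g : resx g = 0 -> exists h, g = 'X%:P * h.
Proof.
move=> g0; exists (map_poly (drop_poly 1) g); apply/polyP => j; apply/polyP => i.
rewrite coefCM coefXM coef_map /= coef_drop_poly.
case: i => [|i] /=; last by rewrite addn1.
by have := congr1 (fun p : {poly K} => p`_j) g0; rewrite coef_map coef0.
Qed.

Lemma resx_X : resx ('X%:P : bipoly K) = 0.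
Proof. by rewrite resx_C coefX polyC0. Qed.

Lemma coef_resx g j : (resx g)`_j = g`_j`_0.
Proof. by rewrite coef_map. Qed.

End Basic.


(* virtual transform: the terms of order < m are dropped, so that blow is linear *)
Definition blow (K : comNzRingType) (d : option K) m (g : bipoly K) : bipoly K :=
  if d is Some a then blowS a m g else swapXY (blowS 0 m (swapXY g)).

Definition chartd (K : comNzRingType) (d : option K) (g : bipoly K) : bipoly K :=
  if d is Some a then chartS a g else swapXY (chartS 0 (swapXY g)).

(* the exceptional curve of the blow-up seen in direction d, and the restriction to it *)
Definition excd (K : comNzRingType) (d : option K) : bipoly K :=
  if d is Some _ then 'X%:P else 'X.

Definition resd (K : comNzRingType) (d : option K) (g : bipoly K) : {poly K} :=
  if d is Some _ then resx g else resx (swapXY g).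

Definition lformd (K : comNzRingType) (d : option K) m (g : bipoly K) : {poly K} :=
  if d is Some a then lform m g \Po ('X + a%:P) else lform m (swapXY g).

(** * Blow-ups in an arbitrary direction *)

Section Dir.
Variable K : comNzRingType.
Implicit Types (g h u : bipoly K) (d : option K).

Lemma swapB g h : swapXY (g - h) = swapXY g - swapXY h. Proof. exact: rmorphB. Qed.
Lemma swapD g h : swapXY (g + h) = swapXY g + swapXY h. Proof. exact: rmorphD. Qed.
Lemma swapM g h : swapXY (g * h) = swapXY g * swapXY h. Proof. exact: rmorphM. Qed.
Lemma swap1 : swapXY (1 : bipoly K) = 1. Proof. exact: rmorph1. Qed.


Fact blow_linear d m : zmod_morphism (blow d m).
Proof.
by case: d => [a|] u v; rewrite /blow ?swapB blowS_linear ?swapB.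
Qed.
HB.instance Definition _ d m :=
  GRing.isZmodMorphism.Build (bipoly K) (bipoly K) (blow d m) (blow_linear d m).

Fact chartd_zmod d : zmod_morphism (chartd d).
Proof.
by case: d => [a|] u v; rewrite /chartd ?swapB chartSB ?swapB.
Qed.
Fact chartd_monoid d : monoid_morphism (chartd d).
Proof.
split=> [|u v]; first by case: d => [a|]; rewrite /chartd ?swap1 chartS1 ?swap1.
by case: d => [a|]; rewrite /chartd ?swapM chartSM ?swapM.
Qed.
HB.instance Definition _ d :=
  GRing.isZmodMorphism.Build (bipoly K) (bipoly K) (chartd d) (chartd_zmod d).
HB.instance Definition _ d :=
  GRing.isMonoidMorphism.Build (bipoly K) (bipoly K) (chartd d) (chartd_monoid d).

Fact resd_zmod d : zmod_morphism (resd d).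
Proof.
by case: d => [a|] u v; rewrite /resd ?swapB resxB.
Qed.
Fact resd_monoid d : monoid_morphism (resd d).
Proof.
split=> [|u v]; first by case: d => [a|]; rewrite /resd ?swap1 resx1.
by case: d => [a|]; rewrite /resd ?swapM resxM.
Qed.
HB.instance Definition _ d :=
  GRing.isZmodMorphism.Build (bipoly K) {poly K} (resd d) (resd_zmod d).
HB.instance Definition _ d :=
  GRing.isMonoidMorphism.Build (bipoly K) {poly K} (resd d) (resd_monoid d).

Lemma chartdM d g h : chartd d (g * h) = chartd d g * chartd d h. Proof. exact: rmorphM. Qed.
Lemma resdB d g h : resd d (g - h) = resd d g - resd d h. Proof. exact: rmorphB. Qed.
Lemma resdD d g h : resd d (g + h) = resd d g + resd d h. Proof. exact: rmorphD. Qed.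
Lemma resdM d g h : resd d (g * h) = resd d g * resd d h. Proof. exact: rmorphM. Qed.
Lemma blowD d m g h : blow d m (g + h) = blow d m g + blow d m h. Proof. exact: raddfD. Qed.
Lemma blow0 d m : blow d m 0 = 0. Proof. exact: raddf0. Qed.

Lemma swapXn m : swapXY ('X^m%:P : bipoly K) = 'X^m.
Proof. by rewrite swapXY_polyC rmorphXn /= map_polyX. Qed.

Lemma swapX : swapXY ('X%:P : bipoly K) = 'X.
Proof. by rewrite swapXY_polyC map_polyX. Qed.

Lemma excdXn d m : excd d ^+ m = if d is Some _ then 'X^m%:P else 'X^m.
Proof. by case: d => //= _; rewrite rmorphXn. Qed.

Lemma blowP d m g : ordge m g -> chartd d g = excd d ^+ m * blow d m g.
Proof.
rewrite excdXn; case: d => [a|] hg /=; first exact: blowSP.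
by rewrite (blowSP 0 (ordge_swap hg)) rmorphM /= swapXn.
Qed.

Lemma mulexc_inj d m : injective ( *%R (excd d ^+ m)).
Proof.
rewrite excdXn; case: d => [a|]; first exact: mulXn_inj.
move=> g h /= /(congr1 swapXY); rewrite !rmorphM /= -swapXn swapXYK.
by move/mulXn_inj/(can_inj (@swapXYK _)).
Qed.

Lemma blowM d m u g : ordge m g -> blow d m (u * g) = chartd d u * blow d m g.
Proof.
case: d => [a|] hg /=; first exact: blowSM.
by rewrite !rmorphM /= blowSM ?rmorphM //; apply: ordge_swap.
Qed.

Lemma resd_blow d m g : resd d (blow d m g) = lformd d m g.
Proof.
case: d => [a|] /=; first exact: resx_blowS.
by rewrite swapXYK resx_blowS polyC0 addr0 comp_polyXr.
Qed.

Lemma resd_chartd d g : resd d (chartd d g) = (g`_0`_0)%:P.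
Proof.
by case: d => [a|] /=; rewrite ?swapXYK resx_chartS // coef_swapXY.
Qed.

Lemma resd_eq0 d g : resd d g = 0 -> exists h, g = excd d * h.
Proof.
case: d => [a|] /= /resx_eq0 [h]; first by exists h.
by move/(congr1 swapXY); rewrite swapXYK rmorphM /= swapX; exists (swapXY h).
Qed.

Lemma resd_exc d : resd d (excd d) = 0.
Proof. by case: d => [a|] /=; rewrite ?swapXY_X resx_X. Qed.

Lemma resd_coef0 d g : (resd d g)`_0 = g`_0`_0.
Proof. by case: d => [a|]; rewrite coef_resx // coef_swapXY. Qed.

Lemma ordge_exc d m : ordge m (excd d ^+ m).
Proof.
rewrite excdXn; case: d => [a|]; first exact: ordge_monX.
by rewrite -swapXn; apply/ordge_swap/ordge_monX.
Qed.

Lemma coef_lform m g j : (lform m g)`_j = if (j <= m)%N then g`_j`_(m - j) else 0.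
Proof. by rewrite coef_poly ltnS. Qed.

Lemma coef_lform_swap m g j :
  (lform m (swapXY g))`_j = if (j <= m)%N then g`_(m - j)`_j else 0.
Proof. by rewrite coef_lform coef_swapXY. Qed.

Lemma lform_neq0P m g : reflect (exists2 j, (j <= m)%N & g`_j`_(m - j) != 0) (lform m g != 0).
Proof.
apply: (iffP idP) => [n0|[j jm]]; last first.
  by apply: contraNneq => e; have := congr1 (fun p : {poly K} => p`_j) e; rewrite /= coef_lform jm coef0 => ->.
exists (size (lform m g)).-1.
  by have := size_poly m.+1 (fun j => g`_j`_(m - j)); rewrite -/(lform m g); lia.
have := n0; rewrite -lead_coef_eq0 lead_coefE coef_lform.
by case: leqP => //; rewrite eqxx.
Qed.

End Dir.

(** * Clusters and their linear conditions *)

(* A cluster of infinitely near points.  [Node m ch] is a centre of multiplicity m with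
   the points of the strict transform in its first neighbourhood; at a [Leaf] the strict
   transform is smooth and transversal to the only exceptional curve. *)
Inductive tree (A : Type) := Leaf | Node of nat & seq (option A * tree A).
Arguments Leaf {A}.

HB.instance Definition _ (A : Type) := gen_eqMixin (tree A).

Section TreeInd.
Variables (A : eqType) (P : tree A -> Prop).
Hypothesis PL : P Leaf.
Hypothesis PN : forall m ch, (forall dt, dt \in ch -> P dt.2) -> P (Node m ch).

Lemma tree_induct_cons (d : option A) (t : tree A) (ch : seq (option A * tree A)) :
  P t -> (forall dt, dt \in ch -> P dt.2) ->
  forall dt, dt \in (d, t) :: ch -> P dt.2.
Proof. by move=> Pt Pch dt; rewrite inE => /predU1P [->|/Pch]. Qed.

Lemma tree_induct_nil (dt : option A * tree A) : dt \in [::] -> P dt.2.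
Proof. by []. Qed.

Fixpoint tree_induct (t : tree A) : P t :=
  match t with
  | Leaf => PL
  | Node m ch => PN m ((fix rec (ch : seq (option A * tree A)) :
        forall dt, dt \in ch -> P dt.2 :=
      match ch with
      | [::] => tree_induct_nil
      | (d, t') :: ch' => tree_induct_cons (tree_induct t') (rec ch')
      end) ch)
  end.
End TreeInd.

(* The condition (s, (i, j)) on a curve: after the virtual transforms along s the
   coefficient of x^i y^j vanishes. *)
Notation cond A := (seq (option A * nat) * (nat * nat))%type.

Definition low_monomials m : seq (nat * nat) :=
  [seq ij <- [seq (i, j) | i <- iota 0 m, j <- iota 0 m] | (ij.1 + ij.2 < m)%N].

Fixpoint conds (A : Type) (t : tree A) : seq (cond A) :=
  match t with
  | Leaf => [:: ([::], (0, 0))%N]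
  | Node m ch => [seq ([::], ij) | ij <- low_monomials m] ++
      flatten [seq [seq ((dt.1, m) :: c.1, c.2) | c <- conds dt.2] | dt <- ch]
  end.

Fixpoint tmap (A B : Type) (f : A -> B) (t : tree A) : tree B :=
  match t with
  | Leaf => Leaf
  | Node m ch => Node m [seq (omap f dt.1, tmap f dt.2) | dt <- ch]
  end.

Definition evc (K : comNzRingType) (c : cond K) (g : bipoly K) : K :=
  (foldl (fun h dm => blow dm.1 dm.2 h) g c.1)`_c.2.2`_c.2.1.

Definition vanish (K : comNzRingType) (t : tree K) (g : bipoly K) : Prop :=
  forall c, c \in conds t -> evc c g = 0.

(* intersection number with the smooth branch of direction z along which t is followed *)
Fixpoint eps (A : eqType) (z : option A) (t : tree A) : nat :=
  match t with
  | Leaf => 1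
  | Node m ch => m + sumn [seq (if dt.1 == z then eps z dt.2 else 0%N) | dt <- ch]
  end.

(* direction of the exceptional curve at the point d of the blow-up; upx and upy tell
   whether x = 0 and y = 0 are exceptional there *)
Definition edir (K : nzRingType) (d : option K) : option K :=
  if d is Some _ then None else Some 0.

Definition upx (K : Type) (b : bool) (d : option K) : bool := if d is Some _ then true else b.
Definition upy (K : nzRingType) (b : bool) (d : option K) : bool :=
  if d is Some a then b && (a == 0) else true.

(* The equation says that m is the intersection number of the strict transform with the
   exceptional curve; it does not refer to a curve and survives reduction modulo p. *)
Fixpoint valid (K : nzRingType) (bx by_ : bool) (t : tree K) : bool :=
  match t with
  | Leaf => bx (+) by_
  | Node m ch => [&& (0 < m)%N, uniq [seq dt.1 | dt <- ch],
      sumn [seq eps (edir dt.1) dt.2 | dt <- ch] == m &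
      all (fun dt => valid (upx bx dt.1) (upy by_ dt.1) dt.2) ch]
  end.

(* open conditions: together with vanish they say that t resolves the curve g *)
Fixpoint nondeg (K : comNzRingType) (bx by_ : bool) (t : tree K) (g : bipoly K) : Prop :=
  match t with
  | Leaf => (bx -> g`_1`_0 != 0) /\ (by_ -> g`_0`_1 != 0)
  | Node m ch => lform m g != 0 /\
      foldr (fun dt P => nondeg (upx bx dt.1) (upy by_ dt.1) dt.2 (blow dt.1 m g) /\ P) True ch
  end.

Section TreeBasic.
Variable K : comNzRingType.
Implicit Types (g h u : bipoly K) (d : option K) (t : tree K).

Lemma nondeg_node bx by_ m ch g : nondeg bx by_ (Node m ch) g <->
  lform m g != 0 /\ forall dt, dt \in ch ->
    nondeg (upx bx dt.1) (upy by_ dt.1) dt.2 (blow dt.1 m g).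
Proof.
rewrite /=; split=> -[-> H]; split=> //; elim: ch H => [|dt ch IH] /=.
- by [].
- by case=> Hd /IH H dt'; rewrite inE; case: eqP => [->|_ /H].
- by [].
- move=> H; split; first by apply: H; rewrite mem_head.
  by apply: IH => dt' dtch; apply: H; rewrite inE dtch orbT.
Qed.

Lemma mem_low i j m : ((i, j) \in low_monomials m) = (i + j < m)%N.
Proof.
rewrite mem_filter /=; case: ltnP => //= ijm; apply/allpairsP; exists (i, j) => /=.
by rewrite !mem_iota; split=> //; lia.
Qed.

Lemma evc_foldl dm cs ij g : evc (dm :: cs, ij) g = evc (cs, ij) (blow dm.1 dm.2 g).
Proof. by []. Qed.

Lemma condsP m ch (c : cond K) : c \in conds (Node m ch) <->
  (exists2 ij, (ij.1 + ij.2 < m)%N & c = ([::], ij)) \/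
  (exists dt, exists c', [/\ dt \in ch, c' \in conds dt.2 & c = ((dt.1, m) :: c'.1, c'.2)]).
Proof.
rewrite /= mem_cat; split.
  case/orP=> [/mapP[[i j] hij ->]|].
    by left; exists (i, j); rewrite // -mem_low.
  move/flatten_mapP => [dt dtch /mapP [c' cc ->]]; right.
  by exists dt, c'.
case=> [[[i j] hij ->]|[dt [c' [dtch cc ->]]]]; apply/orP.
  by left; apply: map_f; rewrite mem_low.
by right; apply/flatten_mapP; exists dt => //; apply/mapP; exists c'.
Qed.

Lemma vanish_node m ch g : vanish (Node m ch) g <->
  ordge m g /\ forall dt, dt \in ch -> vanish dt.2 (blow dt.1 m g).
Proof.
split=> [H|[H1 H2] c /condsP].
  split=> [i j ij|dt dtch [c1 c2] cc].
    by apply: (H ([::], (i, j))); apply/condsP; left; exists (i, j).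
  by apply: (H ((dt.1, m) :: c1, c2)); apply/condsP; right; exists dt, (c1, c2).
case=> [[[i j] hij ->]|[dt [[c1 c2] [dtch cc ->]]]]; first exact: H1.
exact: (H2 dt dtch (c1, c2)).
Qed.

Lemma vanish_leaf g : vanish Leaf g <-> g`_0`_0 = 0.
Proof.
split=> [H|H c]; first by apply: (H ([::], (0, 0))%N); rewrite inE.
by rewrite inE => /eqP ->.
Qed.

Lemma foldl_blowB s g h : foldl (fun h dm => blow dm.1 dm.2 h) (g - h) s =
  foldl (fun h dm => blow dm.1 dm.2 h) g s -
  foldl (fun h (dm : option K * nat) => blow dm.1 dm.2 h) h s.
Proof. by elim: s g h => //= dm s IH g h; rewrite blow_linear IH. Qed.

Lemma evcB g h c : evc c (g - h) = evc c g - evc c h.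
Proof. by rewrite /evc foldl_blowB !coefB. Qed.

HB.instance Definition _ c :=
  GRing.isZmodMorphism.Build (bipoly K) K (evc c) (fun g h => evcB g h c).

Lemma blow_scale d m (a : K) g : blow d m (a%:P%:P * g) = a%:P%:P * blow d m g.
Proof.
have E b n (h : bipoly K) : blowS b n (a%:P%:P * h) = a%:P%:P * blowS b n h.
  rewrite /blowS comp_polyM comp_polyC.
  rewrite -[in RHS](comp_polyC (a%:P) ('X + b%:P%:P)) -comp_polyM; congr (_ \Po _).
  apply/polyP => j; rewrite coefCM !coef_map /= coefCM; apply/polyP => i.
  by rewrite coefCM !coef_drop_poly coefCM.
case: d => [b|] /=; first exact: E.
by rewrite swapM swapXY_polyC map_polyC /= E swapM swapXY_polyC map_polyC.
Qed.

Lemma evc_scale c (a : K) g : evc c (a%:P%:P * g) = a * evc c g.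
Proof.
case: c => s [i j]; elim: s g => [|dm s IH] g; first by rewrite /evc /= !coefCM.
by rewrite !evc_foldl blow_scale IH.
Qed.

Lemma vanishB t g h : vanish t g -> vanish t h -> vanish t (g - h).
Proof. by move=> vg vh c ct; rewrite evcB vg ?vh ?subr0. Qed.

Lemma vanish0 t : vanish t 0.
Proof. by move=> c _; exact: (raddf0 (evc c)). Qed.

Lemma vanishN t g : vanish t g -> vanish t (- g).
Proof. by move=> vg; rewrite -sub0r; apply: vanishB => //; apply: vanish0. Qed.

Lemma vanishD t g h : vanish t g -> vanish t h -> vanish t (g + h).
Proof. by move=> vg vh; rewrite -[h]opprK; apply/vanishB/vanishN. Qed.

(** By [blowM] a multiplier of [g] stays a multiplier of all virtual transforms, so the conditions
    of a cluster cut out an ideal. *)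
Lemma vanishMl t u g : vanish t g -> vanish t (u * g).
Proof.
elim/tree_induct: t u g => [|m ch IH] u g.
  by move/vanish_leaf => g0; apply/vanish_leaf; rewrite coefM big_ord1 coefM big_ord1 g0 mulr0.
case/vanish_node => og vg; apply/vanish_node; split; first exact: ordgeMl.
by move=> dt dtch; rewrite blowM //; apply: IH => //; apply: vg.
Qed.

Lemma blow_exc d m k g : ordge (m + k) g -> blow d m g = excd d ^+ k * blow d (m + k) g.
Proof.
move=> og; apply: (@mulexc_inj _ d m) => /=.
by rewrite -blowP ?mulrA -?exprD -?blowP //; apply: ordge_le og; rewrite leq_addr.
Qed.

Lemma ordge_blow d m n g : ordge (m + n) g -> ordge n (blow d m g).
Proof.
move=> og; rewrite (blow_exc d og) mulrC.
by apply: ordgeMl; apply: ordge_exc.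
Qed.

(** A blow-up lowers the order by at most the multiplicity of its centre, and the tree is finite.
    The ideal of the cluster thus contains a power of the maximal ideal, so inverses of units are
    only needed modulo a high power. *)
Lemma vanish_ordge t : exists N, forall g, ordge N g -> vanish t g.
Proof.
elim/tree_induct: t => [|m ch IH].
  by exists 1%N => g /ordge1P g0; apply/vanish_leaf.
have [N HN] : exists N, forall dt, dt \in ch -> forall g, ordge N g -> vanish dt.2 g.
  elim: ch IH => [|dt ch IHc] IH; first by exists 0%N.
  have [|N1 H1] := IHc; first by move=> dt' dtch; apply: IH; rewrite inE dtch orbT.
  have [|N2 H2] := IH dt; first exact: mem_head.
  exists (maxn N1 N2) => dt'; rewrite inE; case: eqP => [-> _|_ dtch] g og.
    by apply: H2; apply: ordge_le og; rewrite leq_maxr.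
  by apply: H1 => //; apply: ordge_le og; rewrite leq_maxl.
exists (m + N)%N => g og; apply/vanish_node; split.
  by apply: ordge_le og; rewrite leq_addr.
by move=> dt dtch; apply: HN => //; apply: ordge_blow.
Qed.

(** Following an exceptional curve in its own direction amounts, on that curve, to division by the
    [m]-th power of the parameter. This is the step behind the recursion of [eps]. *)
Lemma resd_blow_edir d m g j : (resd d (blow (edir d) m g))`_j = (resd d g)`_(j + m).
Proof.
case: d => [a|] /=; rewrite !coef_resx !coef_swapXY blowS0_coef subn0 //.
by rewrite coef_swapXY.
Qed.

Lemma sumn_nodir (A : eqType) (F : tree A -> nat) (z : option A) (ch : seq (option A * tree A)) :
  z \notin [seq dt.1 | dt <- ch] ->
  sumn [seq (if dt.1 == z then F dt.2 else 0%N) | dt <- ch] = 0%N.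
Proof.
elim: ch => //= dt ch IH; rewrite inE negb_or => /andP [zd /IH ->].
by rewrite eq_sym (negbTE zd).
Qed.

Lemma sumn_dir (A : eqType) (F : tree A -> nat) (z : option A) (ch : seq (option A * tree A)) dt :
  uniq [seq dt.1 | dt <- ch] -> dt \in ch -> dt.1 = z ->
  sumn [seq (if dt.1 == z then F dt.2 else 0%N) | dt <- ch] = F dt.2.
Proof.
move=> + + dz; elim: ch => //= dt' ch IH /andP [nch uch]; rewrite inE.
case/predU1P => [e|dtch]; last first.
  rewrite IH //; case: eqP => // e; case/negP: nch; rewrite e -dz; exact: map_f.
rewrite -e dz eqxx -[RHS]addn0; congr (_ + _)%N.
by apply: sumn_nodir; rewrite -dz e.
Qed.

Lemma valid_node bx by_ m (ch : seq (option K * tree K)) : valid bx by_ (Node m ch) ->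
  [/\ (0 < m)%N, uniq [seq dt.1 | dt <- ch],
      sumn [seq eps (edir dt.1) dt.2 | dt <- ch] = m &
      forall dt, dt \in ch -> valid (upx bx dt.1) (upy by_ dt.1) dt.2].
Proof. by case/and4P => m0 u /eqP e /allP v; split. Qed.

(* Noether's inequality along a smooth branch *)
Lemma vanish_eps bx by_ d t g : valid bx by_ t -> vanish t g ->
  forall j, (j < eps (edir d) t)%N -> (resd d g)`_j = 0.
Proof.
elim/tree_induct: t bx by_ g => [|m ch IH] bx by_ g.
  by move=> _ /vanish_leaf g0 [|j] //= _; rewrite resd_coef0.
case/valid_node => m0 uch _ vch /vanish_node [og vg] j /=.
have low : (j < m)%N -> (resd d g)`_j = 0.
  move=> jm; case: (d) => [a|] /=; rewrite coef_resx ?coef_swapXY og //.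
  by rewrite addn0.
case: (boolP (edir d \in [seq dt.1 | dt <- ch])) => [/mapP [dt dtch e]|nd].
  rewrite (sumn_dir _ uch dtch) // => jl; case: (ltnP j m) => // mj.
  rewrite -(subnK mj) -resd_blow_edir e.
  by apply: (IH _ dtch _ _ _ (vch _ dtch) (vg _ dtch)); rewrite ltn_subLR.
by rewrite (sumn_nodir _ nd) addn0.
Qed.

Definition hasmult m g := ordge m g /\ lform m g != 0.

End TreeBasic.

(** * Independence of the conditions *)

Section Field.
Variable K : fieldType.
Implicit Types (g h u : bipoly K) (d : option K) (t : tree K).

Lemma comp_XaddC (p : {poly K}) (a : K) : (p \Po ('X + a%:P)) \Po ('X - a%:P) = p.
Proof. by rewrite -comp_polyA comp_polyD comp_polyX comp_polyC subrK comp_polyXr. Qed.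

Lemma comp_XsubC (p : {poly K}) (a : K) : (p \Po ('X - a%:P)) \Po ('X + a%:P) = p.
Proof. by rewrite -comp_polyA comp_polyB comp_polyX comp_polyC addrK comp_polyXr. Qed.

Lemma dvdXn_comp (p : {poly K}) (a : K) e :
  ('X^e %| p \Po ('X + a%:P)) = (('X - a%:P) ^+ e %| p).
Proof.
apply/idP/idP => /dvdpP [q e1].
  rewrite -(comp_XaddC p a) e1 comp_polyM rmorphXn /= comp_polyX.
  exact: dvdp_mull.
rewrite e1 comp_polyM rmorphXn /= comp_polyB comp_polyX comp_polyC addrK.
exact: dvdp_mull.
Qed.

Lemma dvdXnP (p : {poly K}) e : reflect (forall i, (i < e)%N -> p`_i = 0) ('X^e %| p).
Proof.
apply: (iffP idP) => [/dvdpP [q ->] i ie|H]; first by rewrite coefMXn ie.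
apply/dvdpP; exists (drop_poly e p); rewrite -[LHS](poly_take_drop e).
suff -> : take_poly e p = 0 by rewrite add0r.
by apply/polyP => i; rewrite coef_take_poly coef0; case: ltnP => // /H.
Qed.

Lemma coprime_XsubC_prod (a : K) (s : seq K) (e : K -> nat) n : a \notin s ->
  coprimep (\prod_(b <- s) ('X - b%:P) ^+ e b) (('X - a%:P) ^+ n).
Proof.
elim: s => [|b s IH]; first by rewrite big_nil coprime1p.
rewrite inE negb_or big_cons => /andP [ab /IH cs].
rewrite coprimepMl cs andbT; apply: coprimep_expl; apply: coprimep_expr.
by rewrite coprimep_XsubC root_XsubC.
Qed.

Lemma prod_XsubC_dvd (s : seq K) (e : K -> nat) (p : {poly K}) : uniq s ->
  (forall a, a \in s -> ('X - a%:P) ^+ e a %| p) ->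
  \prod_(b <- s) ('X - b%:P) ^+ e b %| p.
Proof.
elim: s => [|b s IH]; first by rewrite big_nil dvd1p.
rewrite big_cons => /andP [bs us] H.
rewrite Gauss_dvdp; last by rewrite coprimep_sym; apply: coprime_XsubC_prod.
rewrite H ?mem_head //=; apply: IH => // a as_; apply: H.
by rewrite inE as_ orbT.
Qed.

Lemma size_prod_XsubC_exp (s : seq K) (e : K -> nat) :
  size (\prod_(b <- s) ('X - b%:P) ^+ e b) = (\sum_(b <- s) e b).+1.
Proof.
elim: s => [|b s IH]; first by rewrite !big_nil size_poly1.
rewrite !big_cons size_monicM ?monic_exp ?monicXsubC //.
  by rewrite size_exp_XsubC IH; lia.
by rewrite -size_poly_eq0 IH.
Qed.

Lemma sum_direction (D : seq (option K)) (e : option K -> nat) : uniq D ->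
  (\sum_(d <- D) e d = (None \in D) * e None + \sum_(a <- pmap id D) e (Some a))%N.
Proof.
elim: D => [|[a|] D IH] /=; first by rewrite !big_nil.
  by move/andP => [_ /IH e1]; rewrite !big_cons e1 inE /=; lia.
move/andP => [nD /IH e1]; rewrite big_cons e1 (negbTE nD); lia.
Qed.

Lemma mem_pmap_id (D : seq (option K)) a : (a \in pmap id D) = (Some a \in D).
Proof. by rewrite mem_pmap map_id. Qed.

Lemma uniq_pmap_id (D : seq (option K)) : uniq D -> uniq (pmap id D).
Proof.
elim: D => [|[a|] D IH] //= /andP [aD /IH ->] //.
by rewrite mem_pmap_id aD.
Qed.

(* lform and lformd are forms on the projective line of directions; zeros are counted
   with multiplicity *)
Lemma zeros_le m g (D : seq (option K)) (e : option K -> nat) :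
  lform m g != 0 -> uniq D -> (forall d, d \in D -> 'X^(e d) %| lformd d m g) ->
  (\sum_(d <- D) e d <= m)%N.
Proof.
move=> n0 uD H; rewrite (sum_direction _ uD).
set P := \prod_(b <- pmap id D) ('X - b%:P) ^+ e (Some b).
have : P %| lform m g.
  apply: (@prod_XsubC_dvd _ (fun b => e (Some b))); first exact: uniq_pmap_id.
  by move=> a; rewrite mem_pmap_id -dvdXn_comp => /H.
move/(dvdp_leq n0); rewrite (size_prod_XsubC_exp _ (fun b => e (Some b))).
move/leq_trans => L; suff : (size (lform m g) + (None \in D) * e None <= m.+1)%N.
  have := L _ (leqnn _); move: (\sum_(b <- _) _)%N ((None \in D) * e None)%N => x y.
  by move=> xs sy; rewrite -ltnS; apply: leq_trans sy; rewrite addnC ltn_add2r.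
case: (boolP (None \in D)) => [ND|_]; last by rewrite addn0 size_poly.
have /dvdXnP Z := H _ ND; rewrite mul1n.
have em : (e None <= m)%N.
  case/lform_neq0P: n0 => j jm; apply: contraR; rewrite -ltnNge => me.
  by have /= := Z (m - j)%N; rewrite coef_lform_swap leq_subr subKn // => -> //; lia.
suff h : (size (lform m g) <= (m - e None).+1)%N.
  by apply: leq_trans (leq_add h (leqnn _)) _; lia.
apply/leq_sizeP => j jl; rewrite coef_lform; case: leqP => // jm.
have /= := Z (m - j)%N; rewrite coef_lform_swap leq_subr subKn // => ->//; lia.
Qed.

(** Homogenisation in degree [n], a section of [lform n]. *)
Definition formp n (p : {poly K}) : bipoly K := \poly_(j < n.+1) (p`_j *: 'X^(n - j)).

Lemma coef_formp n p i j : (formp n p)`_j`_i = if (j <= n)%N && (i == n - j)%N then p`_j else 0.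
Proof.
rewrite coef_poly ltnS; case: leqP => //= _; last by rewrite coef0.
by rewrite coefZ coefXn; case: eqP; rewrite ?mulr1 ?mulr0.
Qed.

Lemma ordge_formp n p : ordge n (formp n p).
Proof. by move=> i j ij; rewrite coef_formp; case: andP => // -[jn /eqP]; lia. Qed.

Lemma lform_formp n (p : {poly K}) : (size p <= n.+1)%N -> lform n (formp n p) = p.
Proof.
move=> sp; apply/polyP => j; rewrite coef_lform coef_formp eqxx andbT.
by case: leqP => // jn; rewrite nth_default //; exact: leq_trans sp jn.
Qed.

(* Hermite interpolation by forms on the projective line *)
Lemma crt_poly (s : seq K) (e : K -> nat) (r : K -> {poly K}) : uniq s ->
  exists2 p : {poly K}, (size p <= \sum_(a <- s) e a)%N &
    forall a, a \in s -> ('X - a%:P) ^+ e a %| p - r a.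
Proof.
move=> us; pose P := \prod_(b <- s) ('X - b%:P) ^+ e b.
have [p Hp] : exists p : {poly K}, forall a, a \in s -> ('X - a%:P) ^+ e a %| p - r a.
  elim: s us {P} => [|a s IH] /=; first by exists 0.
  case/andP => as_ /IH [p Hp].
  have /Bezout_eq1_coprimepP [[u v] /= uv] := coprime_XsubC_prod e (e a) as_.
  set Q := \prod_(b <- s) _ in uv.
  exists (p + u * Q * (r a - p)) => b; rewrite inE; case: eqP => [-> _|_ /= bs].
    have -> : p + u * Q * (r a - p) - r a = ('X - a%:P) ^+ e a * (v * (p - r a)).
      have -> : u * Q = 1 - v * ('X - a%:P) ^+ e a by rewrite -uv addrK.
      by ring.
    exact: dvdp_mulIl.
  rewrite addrAC; apply: dvdp_add; first exact: Hp.
  rewrite -mulrA mulrCA; apply: dvdp_mulr.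
  by rewrite /Q (big_rem b) //=; apply: dvdp_mulIl.
exists (p %% P).
  rewrite -ltnS -(size_prod_XsubC_exp s e); apply: ltn_modpN0.
  by rewrite -size_poly_eq0 size_prod_XsubC_exp.
move=> a as_; have -> : p %% P - r a = (p - r a) - p %/ P * P.
  by rewrite {2}(divp_eq p P); ring.
apply: dvdp_sub; first exact: Hp.
by apply: dvdp_mull; rewrite /P (big_rem a) //=; apply: dvdp_mulIl.
Qed.

Lemma form_interpolation n (D : seq (option K)) (e : option K -> nat)
    (r : option K -> {poly K}) : uniq D -> (\sum_(d <- D) e d <= n)%N ->
  exists2 g, ordge n g & forall d, d \in D -> 'X^(e d) %| lformd d n g - r d.
Proof.
move=> uD; rewrite (sum_direction _ uD); set s := pmap id D; set eN := (_ * e None)%N => le_n.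
(* The direction x = 0 reads coefficients from the top. [p0] fixes the top ones, and the correction
   [p1] for the finite directions has too small a degree to disturb them. *)
pose p0 : {poly K} := \sum_(i < eN) (r None)`_i *: 'X^(n - i).
have sp0 : (size p0 <= n.+1)%N.
  apply: (leq_trans (size_sum _ _ _)); apply/bigmax_leqP => i _.
  by apply: (leq_trans (size_scale_leq _ _)); rewrite size_polyXn; lia.
have [p1 sp1 Hp1] := @crt_poly s (fun a => e (Some a)) (fun a => (r (Some a) \Po ('X - a%:P)) - p0) (uniq_pmap_id uD).
have sp : (size (p0 + p1)%R <= n.+1)%N.
  by apply: (leq_trans (size_polyD _ _)); rewrite geq_max sp0; lia.
exists (formp n (p0 + p1)); first exact: ordge_formp.
case=> [a|] dD.
  have /Hp1 : a \in s by rewrite mem_pmap_id.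
  have -> : p1 - ((r (Some a) \Po ('X - a%:P)) - p0) = (p0 + p1) - (r (Some a) \Po ('X - a%:P)) by ring.
  by rewrite -dvdXn_comp comp_polyB comp_XsubC /= lform_formp.
have eNE : eN = e None by rewrite /eN dD mul1n.
apply/dvdXnP => i ie; rewrite coefB coef_lform_swap.
have -> : (i <= n)%N by lia.
rewrite coef_formp leq_subr subKn ?eqxx /=; last lia.
have p1z : p1`_(n - i) = 0 by apply: nth_default; apply: leq_trans sp1 _; lia.
rewrite coefD p1z addr0.
rewrite coef_sum (bigD1 (Ordinal (leq_trans ie (eq_leq (esym eNE))))) //=.
rewrite coefZ coefXn eqxx mulr1 big1 ?addr0 ?subrr // => j ij.
rewrite coefZ coefXn; case: eqP => // e1; last by rewrite mulr0.
by case/eqP: ij; apply: val_inj => /=; have := ltn_ord j; lia.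
Qed.


(* a root of a leading form that is not followed by the tree would exceed its degree *)
Lemma blow_unit bx by_ m (ch : seq (option K * tree K)) g d : valid bx by_ (Node m ch) ->
  vanish (Node m ch) g -> lform m g != 0 -> d \notin [seq dt.1 | dt <- ch] ->
  (blow d m g)`_0`_0 != 0.
Proof.
case/valid_node => m0 uch sch vch /vanish_node [og vg] n0 nd; apply/eqP => b0.
pose e z := if z == d then 1%N else
  sumn [seq (if dt.1 == z then eps (edir z) dt.2 else 0%N) | dt <- ch].
have : (\sum_(z <- d :: [seq dt.1 | dt <- ch]) e z <= m)%N.
  apply: (zeros_le n0) => [|z]; first by rewrite /= nd.
  rewrite inE => zD; rewrite -resd_blow; apply/dvdXnP; rewrite /e.
  case: eqP => [-> [|] // _|/eqP zd]; first by rewrite resd_coef0.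
  move: zD; rewrite (negbTE zd) => /= /mapP [dt dtch ez] i.
  rewrite (sumn_dir _ uch dtch) // ez => ie.
  by apply: (vanish_eps (vch _ dtch)) ie; apply: vg.
rewrite big_cons big_map -sch sumnE big_map {1}/e eqxx.
suff -> : (\sum_(dt <- ch) e dt.1 = \sum_(dt <- ch) eps (edir dt.1) dt.2)%N by rewrite ltnn.
apply: eq_big_seq => dt dtch; rewrite /e ifN; first by rewrite (sumn_dir _ uch dtch).
by apply: contraNneq nd => <-; apply: map_f.
Qed.

(* the inequality of vanish_eps is an equality along exceptional curves *)
Lemma nondeg_eps bx by_ d t g : valid bx by_ t -> vanish t g -> nondeg bx by_ t g ->
  (if d is Some _ then bx else by_) -> (resd d g)`_(eps (edir d) t) != 0.
Proof.
elim/tree_induct: t bx by_ g => [|m ch IH] bx by_ g.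
  move=> _ _ [hx hy]; case: d => [a|] /= b; rewrite coef_resx ?coef_swapXY; [exact: hx|exact: hy].
move=> v vg /nondeg_node [n0 ng] b /=.
case: (boolP (edir d \in [seq dt.1 | dt <- ch])) => [/mapP [dt dtch e]|nd]; last first.
  rewrite (sumn_nodir _ nd) addn0 -[X in _`_X]add0n -resd_blow_edir resd_coef0.
  exact: (blow_unit v vg n0 nd).
case/vanish_node: vg => og vg; case/valid_node: v => m0 uch _ vch.
rewrite (sumn_dir _ uch dtch) // addnC -resd_blow_edir [X in blow X]e.
apply: (IH _ dtch _ _ _ (vch _ dtch) (vg _ dtch) (ng _ dtch)).
by rewrite -e; case: (d) b => [a|] /= -> //=; rewrite eqxx.
Qed.

(** Extends a polynomial on the exceptional curve to the plane, constantly in the transversal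
    variable. *)
Definition secd d (p : {poly K}) : bipoly K :=
  if d is Some _ then map_poly polyC p else p%:P.

Lemma resd_secd d p : resd d (secd d p) = p.
Proof.
case: d => [a|] /=; apply/polyP => i; rewrite coef_resx ?coef_swapXY ?coef_map ?coefC //=.
Qed.

Lemma ordge_secdXn d N : ordge N (secd d 'X^N).
Proof.
case: d => [a|] /=; last exact: ordge_monX.
by rewrite map_polyXn -swapXn; apply/ordge_swap/ordge_monX.
Qed.

(* Modulo the conditions of t, powers of the parameter along E from y ^ (E . C) on
   are divisible by the equation of E, because the curve itself satisfies them. *)
Lemma vanish_descent bx by_ d t g : valid bx by_ t -> vanish t g -> nondeg bx by_ t g ->
  (if d is Some _ then bx else by_) ->
  forall h, 'X^(eps (edir d) t) %| resd d h -> exists h1, vanish t (h - excd d * h1).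
Proof.
move=> v vg ng b h /dvdpP [w hw].
have [N HN] := vanish_ordge t.
have /dvdpP [u gu] : 'X^(eps (edir d) t) %| resd d g.
  by apply/dvdXnP; apply: vanish_eps v vg.
have u0 : u`_0 != 0.
  by have := nondeg_eps v vg ng b; rewrite gu coefMXn ltnn subnn.
have /Bezout_eq1_coprimepP [[A B] /= AB] : coprimep u 'X^N.
  by apply: coprimep_expr; rewrite coprimepX /root horner_coef0.
(* [c1] agrees with [h] on the exceptional curve and meets the conditions: its first summand is a
   multiple of [g], its second has order at least [N]. *)
pose c1 := secd d (w * A) * g + secd d ('X^(eps (edir d) t) * w * B) * secd d 'X^N.
have [|h1 e] := @resd_eq0 _ d (h - c1).
  rewrite resdB resdD !resdM !resd_secd hw gu.
  set X := 'X^(eps _ _).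
  have -> : w * X - (w * A * (u * X) + X * w * B * 'X^N) = w * X * (1 - (A * u + B * 'X^N)) by ring.
  by rewrite AB subrr mulr0.
exists h1; rewrite -e opprB addrCA subrr addr0.
by apply: vanishD; apply: vanishMl => //; apply: HN; apply: ordge_secdXn.
Qed.

(** Descending induction on the power of the exceptional equation that multiplies the targets [H]. A
    high power meets the conditions by itself. For the power n, a form of degree m + n matches the
    targets along the exceptional curve up to the required contact, and [vanish_descent] makes the
    remainder divisible by one more exceptional factor. *)
Lemma blow_formed (bx by_ : bool) m (ch : seq (option K * tree K)) g :
  valid bx by_ (Node m ch) -> vanish (Node m ch) g -> nondeg bx by_ (Node m ch) g ->
  forall H : option K * tree K -> bipoly K, exists h, ordge m h /\
    forall dt, dt \in ch -> vanish dt.2 (H dt - blow dt.1 m h).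
Proof.
case/valid_node => m0 uch sch vch /vanish_node [og vg] /nondeg_node [n0 ng].
have [N HN] : exists N, forall dt, dt \in ch -> forall h, ordge N h -> vanish dt.2 h.
  elim: (ch) => [|dt ch' [N1 H1]]; first by exists 0%N.
  have [N2 H2] := vanish_ordge dt.2.
  exists (maxn N1 N2) => dt'; rewrite inE => /predU1P [->|/H1 H] h oh.
    by apply: H2; apply: ordge_le oh; rewrite leq_maxr.
  by apply: H; apply: ordge_le oh; rewrite leq_maxl.
suff D k : forall H : option K * tree K -> bipoly K, exists h, ordge m h /\
    forall dt, dt \in ch -> vanish dt.2 (excd dt.1 ^+ (N - k) * H dt - blow dt.1 m h).
  by move=> H; have [h [oh hh]] := D N H; exists h; split=> // dt /hh; rewrite subnn mul1r.
elim: k => [|k IH] H.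
  exists 0; split=> [i j _|dt dtch]; first by rewrite !coef0.
  rewrite blow0 subr0; apply: (HN _ dtch); rewrite subn0 mulrC.
  exact/ordgeMl/ordge_exc.
case: (leqP N k) => Nk.
  have [h [oh hh]] := IH H; exists h; split=> // dt /hh.
  by have -> : (N - k = N - k.+1)%N by lia.
set n := (N - k.+1)%N; have nE : (N - k = n.+1)%N by rewrite /n; lia.
pose e z := sumn [seq (if dt.1 == z then eps (edir z) dt.2 else 0%N) | dt <- ch].
pose Hd z := nth 0 [seq H dt | dt <- ch] (index z [seq dt.1 | dt <- ch]).
have HdE dt : dt \in ch -> Hd dt.1 = H dt.
  move=> dtch; have ii : (index dt ch < size ch)%N by rewrite index_mem.
  have E : dt.1 = nth None [seq x.1 | x <- ch] (index dt ch).
    by rewrite (nth_map dt) // nth_index.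
  have -> : Hd dt.1 = nth 0 [seq H x | x <- ch] (index dt ch).
    by rewrite /Hd {1}E index_uniq ?size_map.
  by rewrite (nth_map dt) // nth_index.
(* The contacts add up to [m] by [valid], so degree [m + n] leaves enough room for every [n]. *)
have [||f of_ Hf] := @form_interpolation (m + n)%N [seq dt.1 | dt <- ch] e (fun z => resd z (Hd z)).
- exact: uch.
- rewrite big_map (eq_big_seq (fun dt => eps (edir dt.1) dt.2)) => [|dt dtch].
    by rewrite -(big_map (fun dt => eps (edir dt.1) dt.2) xpredT id) -sumnE sch leq_addr.
  by rewrite /e (sumn_dir _ uch dtch).
have /choice [H1 HH1] : forall dt, exists h1, dt \in ch ->
    vanish dt.2 (H dt - blow dt.1 (m + n) f - excd dt.1 * h1).
  move=> dt; case: (boolP (dt \in ch)) => [dtch|_]; last by exists 0.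
  have [||h1 Hh1] := @vanish_descent _ _ dt.1 dt.2 _ (vch _ dtch) (vg _ dtch) (ng _ dtch) _ (H dt - blow dt.1 (m + n) f).
  - by case: (dt.1).
  - rewrite resdB resd_blow -opprB dvdpNr.
    by have := Hf dt.1 (map_f _ dtch); rewrite /e (sumn_dir _ uch dtch) // HdE.
  by exists h1.
have [h [oh hh]] := IH H1; exists (f + h); split.
  by apply: ordgeD => //; apply: ordge_le of_; rewrite leq_addr.
move=> dt dtch; rewrite blowD (blow_exc _ of_).
have -> : excd dt.1 ^+ n * H dt - (excd dt.1 ^+ n * blow dt.1 (m + n) f + blow dt.1 m h) =
   excd dt.1 ^+ n * (H dt - blow dt.1 (m + n) f - excd dt.1 * H1 dt) +
   (excd dt.1 ^+ (N - k) * H1 dt - blow dt.1 m h).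
  have R (X E a b c y : bipoly K) : X * a - (X * b + y) = X * (a - b - E * c) + (E * X * c - y).
    by ring.
  by rewrite nE exprS; exact: R.
by apply: vanishD; [apply/vanishMl/HH1 | apply: hh].
Qed.

(* Solutions over the points of the first neighbourhood come from one polynomial of order m,
   built by interpolating its leading form on E and by vanish_descent; terms of order < m
   do not affect them and meet the conditions at the node itself. *)
Lemma conds_independent bx by_ t g : valid bx by_ t -> vanish t g -> nondeg bx by_ t g ->
  forall v : cond K -> K, exists h, forall c, c \in conds t -> evc c h = v c.
Proof.
elim/tree_induct: t bx by_ g => [|m ch IH] bx by_ g vt vg ng v.
  by exists (v ([::], (0, 0))%N)%:P%:P => c; rewrite inE => /eqP ->; rewrite /evc /= !coefC.
have /choice [H HH] : forall dt : option K * tree K, exists h, dt \in ch ->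
    forall c, c \in conds dt.2 -> evc c h = v ((dt.1, m) :: c.1, c.2).
  move=> dt; case: (boolP (dt \in ch)) => [dtch|_]; last by exists 0.
  have /valid_node [_ _ _ vch] := vt; have /vanish_node [_ vgch] := vg.
  have /nondeg_node [_ ngch] := ng.
  have [h Hh] := IH _ dtch _ _ _ (vch _ dtch) (vgch _ dtch) (ngch _ dtch)
     (fun c => v ((dt.1, m) :: c.1, c.2)).
  by exists h.
have [h [oh hh]] := blow_formed vt vg ng H.
pose l : bipoly K := \poly_(j < m) \poly_(i < m - j) v ([::], (i, j)).
exists (h + l) => c /condsP [[[i j] /= ij ->]|[dt [[c1 c2] [dtch cc ->]]]].
  rewrite /evc /= !coefD oh // add0r coef_poly ifT; last lia.
  by rewrite coef_poly ifT //; lia.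
rewrite evc_foldl /= blowD.
have -> : blow dt.1 m l = 0.
  have E b (q : bipoly K) : (forall i j, (m <= i + j)%N -> q`_j`_i = 0) -> blowS b m q = 0.
    move=> Hq; rewrite /blowS -[RHS](comp_poly0 ('X + b%:P%:P)); congr (_ \Po _).
    apply/polyP => j; apply/polyP => i; rewrite coef_map /= coef_compXY coef_drop_poly !coef0.
    by rewrite coefMXn; case: ltnP => // ij; apply: Hq; lia.
  have Hl i j : (m <= i + j)%N -> l`_j`_i = 0.
    move=> mij; rewrite coef_poly; case: ltnP => jm; last by rewrite coef0.
    by rewrite coef_poly; case: ltnP => // im; lia.
  case: (dt.1) => [b|] /=; first exact: E.
  by rewrite E ?raddf0 // => i j ij; rewrite coef_swapXY Hl // addnC.
rewrite addr0 -(HH _ dtch _ cc); apply/eqP; rewrite eq_sym -subr_eq0 -evcB.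
by apply/eqP; apply: (hh _ dtch).
Qed.

Lemma lformd_neq0 d m g : lform m g != 0 -> lformd d m g != 0.
Proof.
case: d => [a|] n0 /=.
  by apply: contraNneq n0 => e; rewrite -(comp_XaddC (lform m g) a) e comp_poly0.
case/lform_neq0P: n0 => j jm H; apply/lform_neq0P; exists (m - j)%N; first exact: leq_subr.
by rewrite coef_swapXY subKn.
Qed.

End Field.

(** * Radicals under blow-up *)

Section Divides.
Variable A : comNzRingType.
Implicit Types f g h : A.

Lemma mdivides_refl f : mdivides f f. Proof. by exists 1; rewrite mul1r. Qed.
Lemma mdivides_mull f g h : mdivides f h -> mdivides f (g * h).
Proof. by case=> a ->; exists (g * a); rewrite mulrA. Qed.
Lemma mdivides_trans f g h : mdivides f g -> mdivides g h -> mdivides f h.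
Proof. by case=> a -> [b ->]; exists (b * a); rewrite mulrA. Qed.
Lemma mdivides_exp f h n : mdivides f h -> mdivides (f ^+ n) (h ^+ n).
Proof. by case=> a ->; exists (a ^+ n); rewrite exprMn. Qed.

Definition reduced f := radical_generator f f.

Lemma reducedP f : reduced f <-> forall h n, mdivides f (h ^+ n) -> mdivides f h.
Proof.
split=> [H h n fh|H h]; first by apply/H; exists n.
by split=> [fh|[n]]; [exists 1%N; rewrite expr1 | apply: H].
Qed.

Lemma radical_reduced f g : radical_generator f g -> reduced g.
Proof.
move=> H; apply/reducedP => h n; rewrite (H (h ^+ n)) => -[m fh].
by apply/H; exists (n * m)%N; rewrite exprM.
Qed.

Lemma radical_dvd f g : radical_generator f g -> mdivides g f.
Proof. by move=> H; apply/H; exists 1%N; rewrite expr1; apply: mdivides_refl. Qed.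

Lemma radical_exp f g : radical_generator f g -> exists n, mdivides f (g ^+ n).
Proof. by move=> H; apply/H; apply: mdivides_refl. Qed.

Lemma reducedS f : (forall h n, mdivides f (h ^+ n.+1) -> mdivides f h) -> reduced f.
Proof.
move=> H; apply/reducedP => h n fh; apply: (H _ n).
by rewrite exprS; apply: mdivides_mull.
Qed.

End Divides.

(** * Reducedness of strict and total transforms *)

Section BlowReduced.
Variable K : fieldType.
Implicit Types (g h u : bipoly K) (d : option K) (t : tree K).

Lemma dvd_excP d h : mdivides (excd d) h <-> resd d h = 0.
Proof.
split=> [[a ->]|/resd_eq0 [a ->]]; first by rewrite resdM resd_exc mulr0.
by exists a; rewrite mulrC.
Qed.

Lemma chartd_exc d : chartd d (excd d) = excd d.
Proof.
case: d => [a|] /=; first exact: chartS_XP.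
by rewrite swapXY_X chartS_XP swapX.
Qed.

Lemma chartS_inj a : injective (@chartS K a).
Proof.
move=> g h; rewrite !chartSE => /(congr1 (fun q => q \Po ('X - a%:P%:P))).
have E q : (q \Po ('X + a%:P%:P)) \Po ('X - a%:P%:P) = q :> bipoly K.
  by rewrite -comp_polyA comp_polyD comp_polyX comp_polyC subrK comp_polyXr.
rewrite !E => e; apply/polyP => j.
have := congr1 (fun q : bipoly K => q`_j) e; rewrite /= !coef_compXY.
by apply: mulIf; rewrite -size_poly_eq0 size_polyXn.
Qed.

Lemma chartd_inj d : injective (chartd d).
Proof.
case: d => [a|]; first exact: chartS_inj.
by move=> g h /(can_inj (@swapXYK _)) /chartS_inj /(can_inj (@swapXYK _)).
Qed.

(** Off x = 0 the chart is inverted by y -> y/x - a, and a power of x clears the denominators. *)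
Lemma chartS_surj_loc a h : exists N H, 'X%:P ^+ N * h = chartS a H.
Proof.
elim/poly_ind: h => [|h c [N [H e]]]; first by exists 0%N, 0; rewrite mulr0 (raddf0 (chartS a)).
exists N.+1, (H * ('X - a%:P%:P * 'X%:P) + 'X%:P ^+ N.+1 * c%:P).
have rD u v : chartS a (u + v) = chartS a u + chartS a v by exact: rmorphD.
have rX u n : chartS a (u ^+ n) = chartS a u ^+ n by exact: rmorphXn.
rewrite rD !chartSM rX chartSB chartSM chartS_Y !chartS_XP -e exprSr.
by ring.
Qed.

Lemma chartd_surj_loc d h : exists N H, excd d ^+ N * h = chartd d H.
Proof.
case: d => [a|]; first exact: chartS_surj_loc.
have [N [H e]] := chartS_surj_loc 0 (swapXY h); exists N, (swapXY H).
rewrite /chartd swapXYK -e swapM swapXYK -['X%:P ^+ N]rmorphXn swapXn.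
by rewrite [excd None]/=.
Qed.

(** The exceptional equation is prime, being the kernel of [resd d] into a domain, and it does not
    divide [g]. *)
Lemma exc_cancel d N g h : resd d g != 0 -> mdivides g (excd d ^+ N * h) -> mdivides g h.
Proof.
move=> g0; elim: N h => [|N IH] h; first by rewrite mul1r.
rewrite exprSr -mulrA => /IH [w e]; have : resd d w * resd d g = 0.
  by rewrite -resdM -e resdM resd_exc mul0r.
move/eqP; rewrite mulf_eq0 (negbTE g0) orbF => /eqP /resd_eq0 [w' e'].
exists w'; apply: (@mulexc_inj _ d 1) => /=.
by rewrite expr1 e e' mulrA.
Qed.

Lemma dvd_exc_exp d h n : mdivides (excd d) (h ^+ n) -> mdivides (excd d) h.
Proof.
move/dvd_excP; have -> : resd d (h ^+ n) = resd d h ^+ n by exact: rmorphXn.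
move/eqP; rewrite expf_eq0 => /andP [_ /eqP e]; exact/dvd_excP.
Qed.

(** The blow-up is an isomorphism off the exceptional curve. A relation h^n = w g' is multiplied by
    exceptional factors until everything is pulled back from below, where [g] is reduced;
    [exc_cancel] then removes these factors. *)
Lemma blow_reduced d m g : reduced g -> ordge m g -> resd d (blow d m g) != 0 ->
  reduced (blow d m g).
Proof.
move=> rg og n0; apply: reducedS => h n [w e].
have [N [H eH]] := chartd_surj_loc d h; have [K' [W eW]] := chartd_surj_loc d w.
have cX u i : chartd d (u ^+ i) = chartd d u ^+ i by exact: rmorphXn.
(* By [chartd_exc] the exceptional equation is its own pull-back, so [E] serves above and below the
   blow-up. *)
set E := excd d in eH eW *.
have E1 : H ^+ n.+1 * E ^+ (K' + m) = E ^+ (N * n.+1) * W * g.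
  apply: (@chartd_inj d); rewrite !chartdM !cX chartd_exc -/E -eH -eW (blowP d og) -/E.
  rewrite exprMn -exprM e exprD; move: (E ^+ _) (E ^+ _) (E ^+ _) (blow _ _ _) => *; ring.
have : mdivides g (H * E ^+ (K' + m)).
  apply: ((iffLR (reducedP g) rg) _ n.+1); rewrite exprMn [X in _ * X]exprS mulrA E1.
  by exists (E ^+ (N * n.+1) * W * E ^+ (K' + m) ^+ n); rewrite -!mulrA; congr (_ * (_ * _)); rewrite mulrC.
case=> v /(congr1 (chartd d)); rewrite !chartdM cX chartd_exc -/E -eH (blowP d og) -/E => e2.
apply: (@exc_cancel d (N + (K' + m))) => //; exists (chartd d v * E ^+ m).
by rewrite -mulrA -e2 -/E [in LHS]exprD; move: (E ^+ _) (E ^+ _) => *; ring.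
Qed.

Lemma exc_blow_reduced d m g : reduced g -> ordge m g -> resd d (blow d m g) != 0 ->
  reduced (excd d * blow d m g).
Proof.
move=> rg og n0; have /reducedP rb := blow_reduced rg og n0.
apply: reducedS => h n [w e].
have /dvd_exc_exp [h1 e1] : mdivides (excd d) (h ^+ n.+1).
  by exists (w * blow d m g); rewrite e; ring.
have [w1 e2] : mdivides (blow d m g) h.
  by apply: (rb _ n.+1); exists (w * excd d); rewrite e; ring.
have : resd d w1 * resd d (blow d m g) = 0.
  by rewrite -resdM -e2 e1 resdM resd_exc mulr0.
move/eqP; rewrite mulf_eq0 (negbTE n0) orbF => /eqP /resd_eq0 [w2 e3].
by exists w2; rewrite e2 e3; ring.
Qed.

(** Since the multiplicity [m.+1] is positive, the exceptional curve is a component of the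
    pull-back; the radical counts it once. *)
Lemma radical_blow d m F g : radical_generator F g -> ordge m.+1 g ->
  resd d (blow d m.+1 g) != 0 ->
  radical_generator (chartd d F) (excd d * blow d m.+1 g).
Proof.
move=> rF og n0 h; have rg := radical_reduced rF.
have cX u i : chartd d (u ^+ i) = chartd d u ^+ i by exact: rmorphXn.
split=> [gh|[n Fh]].
  have [n [w e]] := radical_exp rF; exists (m.+1 * n)%N; rewrite exprM.
  apply: (@mdivides_trans _ _ (chartd d (g ^+ n))).
    by exists (chartd d w); rewrite e chartdM.
  rewrite cX (blowP d og); apply: mdivides_exp.
  apply: mdivides_trans (mdivides_exp m.+1 gh); rewrite exprMn.
  by exists (blow d m.+1 g ^+ m); rewrite [X in _ * X = _]exprSr mulrCA.
have /reducedP := exc_blow_reduced rg og n0; apply.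
apply: mdivides_trans Fh; have [w ->] := radical_dvd rF.
rewrite chartdM (blowP d og); apply: mdivides_mull.
by exists (excd d ^+ m); rewrite exprSr; ring.
Qed.

End BlowReduced.

(** * Existence of a resolution *)

Definition dx (K : comNzRingType) (g : bipoly K) : bipoly K := swapXY (swapXY g)^`().

Definition jacobian (K : comNzRingType) (g r : bipoly K) : Prop :=
  exists A B C, r = A * g + B * dx g + C * g^`().

Section Deriv.
Variable K : comNzRingType.
Implicit Types (g h u q : bipoly K).

Lemma dxM g h : dx (g * h) = dx g * h + g * dx h.
Proof. by rewrite /dx swapM derivM swapD !swapM !swapXYK. Qed.

Lemma dxD g h : dx (g + h) = dx g + dx h.
Proof. by rewrite /dx swapD derivD swapD. Qed.

Lemma dx_C (c : {poly K}) : dx c%:P = c^`()%:P.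
Proof.
apply/polyP => j; apply/polyP => i.
rewrite coef_swapXY coef_deriv coefMn coef_swapXY !coefC.
by case: eqP; rewrite ?coef_deriv // !coef0 mul0rn.
Qed.

Lemma dx_Y : dx ('X : bipoly K) = 0.
Proof. by rewrite /dx swapXY_X derivC swapXY_polyC /= map_poly0. Qed.

Lemma coef_dx g i j : (dx g)`_j`_i = g`_j`_i.+1 *+ i.+1.
Proof. by rewrite coef_swapXY coef_deriv coefMn coef_swapXY. Qed.

Lemma dx_comp g q : dx (g \Po q) = (dx g \Po q) + (g^`() \Po q) * dx q.
Proof.
elim/poly_ind: g => [|g c IH].
  have d0 : (0 : bipoly K)^`() = 0 by exact: raddf0.
  by rewrite d0 !comp_poly0 mul0r addr0 /dx !raddf0 ?comp_poly0.
rewrite comp_polyD comp_polyM comp_polyX comp_polyC dxD dxM dx_C IH.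
rewrite derivMXaddC dxD dxM dx_C dx_Y mulr0 addr0 !comp_polyD !comp_polyM !comp_polyX comp_polyC.
by ring.
Qed.

Lemma dxXn m : dx ('X^m%:P : bipoly K) = ('X^(m.-1) *+ m)%:P.
Proof. by rewrite dx_C derivXn. Qed.

(** The pull-backs of g and of its derivatives are x^m times elements of the new Jacobian ideal,
    while polynomials in x are their own pull-backs. For multiplicity 1 nothing is gained, so smooth
    points need a different argument. *)
Lemma jacobian_blow a m g r : ordge m.+1 g -> jacobian g r%:P ->
  exists2 r1, jacobian (blowS a m.+1 g) r1%:P & r = 'X^m * r1.
Proof.
move=> og [A [B [C e]]]; set g1 := blowS a m.+1 g.
have cg : chartS a g = 'X^(m.+1)%:P * g1 := blowSP a og.
have cy : chartS a g^`() = 'X^m%:P * g1^`().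
  apply: (@mulXn_inj K 1) => /=; have := congr1 (@deriv _) cg.
  rewrite deriv_comp !derivM !derivC !mul0r !add0r derivD derivX derivC addr0 mulr1.
  by rewrite mulrC expr1 => ->; rewrite mulrA -polyCM -exprS.
have cx : chartS a (dx g) = 'X^m%:P * (m.+1%:R * g1 + 'X%:P * dx g1 - ('X + a%:P%:P) * g1^`()).
  have := congr1 (@dx K) cg; rewrite /chartS dx_comp -!/(chartS a _) cy.
  rewrite dxM dx_C derivX dxD dx_Y dx_C derivC polyC0 addr0 mulr0 addr0 mul1r.
  rewrite dxM dxXn /= => /(canRL (addrK _)) ->.
  have -> : ('X^m *+ m.+1)%:P = 'X^m%:P * m.+1%:R :> bipoly K.
    by rewrite mulr_natr polyCMn.
  by rewrite exprSr polyCM; move: 'X^m%:P => *; ring.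
have e1 := congr1 (chartS a) e; have rD u v : chartS a (u + v) = chartS a u + chartS a v by exact: rmorphD.
move: e1; rewrite chartS_XP !rD !chartSM cg cx cy exprSr polyCM => e1.
set s : bipoly K := ('X%:P * chartS a A + chartS a B * m.+1%:R) * g1 + (chartS a B * 'X%:P) * dx g1
  + (chartS a C - chartS a B * ('X + a%:P%:P)) * g1^`().
have e2 : r%:P = 'X^m%:P * s.
  by rewrite e1 /s; move: 'X^m%:P => *; ring.
(* Since x^m s does not involve y, neither does s. *)
have [r1 sr] : exists r1, s = r1%:P.
  exists s`_0; apply: (@mulXn_inj K m) => /=; rewrite -e2 -polyCM; congr (_%:P).
  by have := congr1 (fun q : bipoly K => q`_0) e2; rewrite coefC /= coefCM.
exists r1; last by apply: polyC_inj; rewrite polyCM -sr.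
by rewrite -sr; do 3 eexists; rewrite /s; reflexivity.
Qed.

End Deriv.

(** * Tangent directions with multiplicities *)

Section Projective.
Variable k : closedFieldType.
Implicit Types (g h u : bipoly k) (d : option k).

Lemma coef_lformd0 d m g : (lformd d m g)`_0 = (blow d m g)`_0`_0.
Proof. by rewrite -resd_blow resd_coef0. Qed.

(** Finite directions are the roots of the leading form; the direction x = 0 takes the missing
    degree, so that the multiplicities add up to [m]. *)
Lemma lformd_factor m g : lform m g != 0 ->
  exists (D : seq (option k)) (e : option k -> nat),
    [/\ uniq D, forall d, (d \in D) = ((blow d m g)`_0`_0 == 0),
        (\sum_(d <- D) e d)%N = m &
        forall d, d \in D -> exists2 u, lformd d m g = u * 'X^(e d) & u`_0 != 0].
Proof.
move=> n0; have [r er] := closed_field_poly_normal (lform m g).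
have l0 : lead_coef (lform m g) != 0 by rewrite lead_coef_eq0.
have sz : size (lform m g) = (size r).+1 by rewrite er size_scale // size_prod_XsubC.
have szm : (size r <= m)%N by rewrite -ltnS -sz size_poly.
have rootE a : (a \in r) = root (lform m g) a.
  by rewrite er rootZ // root_prod_XsubC.
have lc : (lform m g)`_(size r) != 0 by have := l0; rewrite lead_coefE sz.
pose e d := if d is Some a then count_mem a r else (m - size r)%N.
pose D := (if (size r < m)%N then [:: None] else [::]) ++ [seq Some a | a <- undup r].
have fin a : exists2 u, lform m g \Po ('X + a%:P) = u * 'X^(count_mem a r) & u`_0 != 0.
  exists ((lead_coef (lform m g) *: \prod_(z <- r | z != a) ('X - z%:P)) \Po ('X + a%:P)).
    rewrite {1}er.
    have -> : 'X^(count_mem a r) = ('X - a%:P) ^+ (count_mem a r) \Po ('X + a%:P).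
      by rewrite rmorphXn /= comp_polyB comp_polyX comp_polyC addrK.
    rewrite -comp_polyM -scalerAl; congr (_ \Po _); congr (_ *: _).
    rewrite (bigID (fun z => z == a)) /= mulrC; congr (_ * _).
    rewrite (eq_bigr (fun=> 'X - a%:P)) => [|z /eqP -> //].
    by rewrite big_const_seq iter_mulr_1.
  rewrite -horner_coef0 horner_comp !hornerE mulf_neq0 //.
  by rewrite horner_prod prodf_seq_neq0; apply/allP => z zr /=; apply/implyP => za; rewrite !hornerE subr_eq0 eq_sym.
exists D, e; split.
- rewrite cat_uniq map_inj_uniq ?undup_uniq ?andbT; last by move=> x y [].
  case: (size r < m)%N; rewrite /= ?andbT; apply/hasPn => x /mapP [a _ ->] //=.
- move=> d; rewrite mem_cat -coef_lformd0; case: d => [a|] /=.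
    rewrite mem_map; last by move=> x y [].
    rewrite mem_undup rootE -horner_coef0 horner_comp !hornerE /root.
    by case: ifP.
  rewrite coef_lform_swap subn0 /= -[g`_m`_0](_ : (lform m g)`_m = _); last first.
    by rewrite coef_lform leqnn subnn.
  have -> : (None \in [seq Some a | a <- undup r]) = false by apply/mapP => -[].
  rewrite orbF; case: ltnP => mr; first by rewrite inE eqxx nth_default ?eqxx // sz.
  have em : size r = m by apply/eqP; rewrite eqn_leq szm mr.
  by rewrite -[X in _`_X == _]em (negbTE lc).
- rewrite /D big_cat big_map /=.
  have -> : (\sum_(j <- undup r) count_mem j r)%N = size r.
    rewrite -sum1_size -[RHS]big_undup_iterop_count /=.
    by apply: eq_bigr => i _; rewrite Monoid.iteropE; elim: (count_mem i r) => //= n <-.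
  case: ltnP => mr; first by rewrite big_seq1 /e; lia.
  by rewrite big_nil; lia.
- case=> [a|] dD; first exact: fin.
  exists (drop_poly (m - size r) (lform m (swapXY g))).
    rewrite -[LHS](poly_take_drop (m - size r)) /=.
    suff -> : take_poly (m - size r) (lform m (swapXY g)) = 0 by rewrite add0r.
    apply/polyP => i; rewrite coef_take_poly coef0; case: ltnP => // ir.
    rewrite coef_lform_swap; case: leqP => // im.
    have := @coef_lform k m g (m - i); rewrite leq_subr subKn // => <-.
    by rewrite nth_default // sz; lia.
  rewrite coef_drop_poly add0n coef_lform_swap leq_subr subKn //.
  by have := @coef_lform k m g (size r); rewrite szm => <-.
Qed.

End Projective.

Lemma predD_leq1 a b : 1 = (a + b).-1 -> (0 < a)%N -> (b <= 1)%N.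
Proof. lia. Qed.

Lemma predD_leqr a b : ((a + b).-1 <= b)%N -> (0 < a)%N -> (0 < b)%N -> a == 1%N.
Proof. lia. Qed.

Lemma pred_mul_lt a b p : (1 < p)%N -> (1 < a)%N -> a.-1 = (b.-1 * p)%N -> (1 < b < a)%N.
Proof. by case: a b => [|[|a]] [|[|b]] //= *; nia. Qed.

Lemma neq1_gt1 a : (0 < a)%N -> a != 1%N -> (1 < a)%N.
Proof. lia. Qed.

(** * Polynomials in one variable in the Jacobian ideal *)

Section Jacobian.
Variables (k : closedFieldType) (p : nat) (hp : p \in [pchar k]).
Implicit Types (g h u q : bipoly k).

Lemma pth_root (c : k) : exists b, b ^+ p = c.
Proof.
have p0 : (0 < p)%N by apply: prime_gt0; apply: pcharf_prime hp.
have /closed_rootP [b] : size ('X^p - c%:P : {poly k}) != 1%N.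
  by rewrite size_XnsubC // eqSS -lt0n.
by rewrite /root !hornerE subr_eq0 => /eqP e; exists b.
Qed.

(** Vanishing derivatives leave only exponents divisible by p, the coefficients have p-th roots, and
    Frobenius is additive. *)
Lemma bipoly_pth_power g : g^`() = 0 -> dx g = 0 -> exists h, g = h ^+ p.
Proof.
move=> gy gx; have pp : prime p := pcharf_prime hp.
have hP : p \in [pchar {poly {poly k}}] by rewrite !pchar_poly.
have [rt rtE] := choice pth_root.
have n0 n : ~~ (p %| n.+1)%N -> (n.+1%:R : k) != 0 by rewrite (dvdn_pcharf hp).
have vy i j : ~~ (p %| j)%N -> g`_j`_i = 0.
  case: j => [|j /n0 nz]; first by rewrite dvdn0.
  have := congr1 (fun q : bipoly k => q`_j`_i) gy; rewrite /= coef_deriv coefMn !coef0.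
  by move/eqP; rewrite -mulr_natr mulf_eq0 (negbTE nz) orbF => /eqP.
have vx i j : ~~ (p %| i)%N -> g`_j`_i = 0.
  case: i => [|i /n0 nz]; first by rewrite dvdn0.
  have := congr1 (fun q : bipoly k => q`_j`_i) gx; rewrite /= coef_dx !coef0.
  by move/eqP; rewrite -mulr_natr mulf_eq0 (negbTE nz) orbF => /eqP.
pose n := (size g + size (swapXY g))%N.
have big i j : (n <= i)%N || (n <= j)%N -> g`_j`_i = 0.
  case/orP => H; last by rewrite (@nth_default _ _ g) ?coef0 //; apply: leq_trans H; apply: leq_addr.
  rewrite -coef_swapXY (@nth_default _ _ (swapXY g)) ?coef0 //.
  by apply: leq_trans H; apply: leq_addl.
pose h : bipoly k := \sum_(j < n) \sum_(i < n) (rt g`_(p * j)`_(p * i))%:P%:P * ('X%:P ^+ i * 'X ^+ j).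
exists h; rewrite -(pFrobenius_autE hP) rmorph_sum /=.
have E (j : nat) : Frobenius_aut hP (\sum_(i < n) (rt g`_(p * j)`_(p * i))%:P%:P * ('X%:P ^+ i * 'X ^+ j)) =
    (\sum_(i < n) g`_(p * j)`_(p * i) *: 'X^(p * i)) *: 'X^(p * j).
  rewrite rmorph_sum /= -mul_polyC rmorph_sum mulr_suml; apply: eq_bigr => i _ /=.
  rewrite pFrobenius_autE !exprMn -!exprM ![(_ * p)%N]mulnC -rmorphXn -rmorphXn rtE -rmorphXn /=.
  by rewrite -[_ *: 'X^_]mul_polyC polyCM mulrA.
under eq_bigr do rewrite E.
have p0 := prime_gt0 pp.
apply/polyP => j; apply/polyP => i; rewrite !coef_sum.
under eq_bigr do rewrite coefZ coefXn.
case: (boolP (p %| j)%N) => [/dvdnP [j' ->]|pj]; last first.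
  rewrite vy // big1 // => b _; case: eqP => [e|_]; last by rewrite mulr0 coef0.
  by rewrite e dvdn_mulr in pj.
case: (ltnP j' n) => [j'n|nj']; last first.
  rewrite big ?(leq_trans nj' (leq_pmulr _ p0)) ?orbT // big1 // => b _.
  case: eqP => [/eqP|_]; last by rewrite mulr0 coef0.
  by rewrite mulnC eqn_pmul2l // => /eqP e; rewrite e leqNgt ltn_ord in nj'.
rewrite (bigD1 (Ordinal j'n)) //= [X in X == _]mulnC eqxx mulr1 [X in _ + X]big1 ?addr0; last first.
  move=> b bj; rewrite [(j' * p)%N]mulnC eqn_pmul2l // [_ == _](introF eqP) ?mulr0 ?coef0 // => e.
  by case/eqP: bj; apply: val_inj.
rewrite coef_sum; under eq_bigr do rewrite coefZ coefXn.
case: (boolP (p %| i)%N) => [/dvdnP [i' ->]|pi]; last first.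
  rewrite vx // big1 // => b _; case: eqP => [e|_]; last by rewrite mulr0.
  by rewrite e dvdn_mulr in pi.
case: (ltnP i' n) => [i'n|ni']; last first.
  rewrite big ?(leq_trans ni' (leq_pmulr _ p0)) // big1 // => b _.
  case: eqP => [/eqP|_]; last by rewrite mulr0.
  by rewrite mulnC eqn_pmul2l // => /eqP e; rewrite e leqNgt ltn_ord in ni'.
rewrite (bigD1 (Ordinal i'n)) //= [X in X == _]mulnC eqxx mulr1 [X in _ + X]big1 ?addr0; last first.
  move=> b bj; rewrite [(i' * p)%N]mulnC eqn_pmul2l // [_ == _](introF eqP) ?mulr0 // => e.
  by case/eqP: bj; apply: val_inj.
by rewrite ![(p * _)%N]mulnC.
Qed.

(* divisibility %| in {poly {poly k}} is divisibility over the field k(x) *)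
Lemma reduced_sqr_free g q : reduced g -> g != 0 -> q ^+ 2 %| g -> (size q <= 1)%N.
Proof.
move=> /reducedP rg g0 /Pdiv.Idomain.dvdpP [[c w] /= c0 e].
have [v ev] : mdivides g (w * q).
  apply: (rg _ 2); exists (w * c%:P).
  have -> : (w * q) ^+ 2 = w * (w * q ^+ 2) by ring.
  by rewrite -e -mul_polyC mulrA.
have : c%:P = v * q.
  by apply: (mulIf g0); rewrite mul_polyC e mulrAC -ev; ring.
move/(congr1 (fun q : bipoly k => size q)); rewrite size_polyC c0 => e1.
have vq0 : v * q != 0 by rewrite -size_poly_eq0 -e1.
have := vq0; rewrite mulf_eq0 negb_or => /andP [v0 q0].
by move: e1; rewrite size_mul // => /predD_leq1; apply; rewrite size_poly_gt0.
Qed.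

(* Otherwise g and its derivatives have a common prime factor q over k(x). Its derivatives
   vanish after scaling by a power of its leading coefficient, so over the perfect field k
   it would be a p-th power up to a factor from k[x]. *)
Lemma jacobian_poly g : reduced g -> g != 0 -> exists2 r : {poly k}, r != 0 & jacobian g r%:P.
Proof.
move=> rg g0.
have [c Ic cE] : exists2 c, jacobian g c & c %= gcdp g (gcdp (dx g) g^`()).
  have [[u v] /= e1] := Bezoutp (dx g) g^`().
  have /eqpP [[a b] /= /andP [a0 b0] eab] := e1.
  have [[u2 v2] /= e2] := Bezoutp g (u * dx g + v * g^`()).
  exists (u2 * g + v2 * (u * dx g + v * g^`())).
    by exists u2, (v2 * u), (v2 * v); ring.
  apply: eqp_trans e2 _; exact: eqp_gcdr.
case: (eqVneq (size (gcdp g (gcdp (dx g) g^`()))) 1%N) => [s1|s1].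
  have sc : size c = 1%N by rewrite (eqp_size cE).
  have /size_poly1P [r r0 e] : size c == 1%N by rewrite sc.
  by exists r => //; rewrite -e.
(* A common factor of least positive degree in y is irreducible over k(x). *)
pose Q n := `[< exists q, [/\ size q = n, (1 < n)%N, q %| g, q %| dx g & q %| g^`()] >].
have : exists n, Q n.
  exists (size (gcdp g (gcdp (dx g) g^`()))); apply/asboolP; exists (gcdp g (gcdp (dx g) g^`())).
  split=> //.
  - have : gcdp g (gcdp (dx g) g^`()) != 0 by rewrite gcdp_eq0 negb_and g0.
    by rewrite -size_poly_gt0 => s0; apply: neq1_gt1.
  - exact: dvdp_gcdl.
  - exact: dvdp_trans (dvdp_gcdr _ _) (dvdp_gcdl _ _).
  - exact: dvdp_trans (dvdp_gcdr _ _) (dvdp_gcdr _ _).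
case/ex_minnP => n /asboolP [q [qn n1 qg qx qy]] minq.
have q0 : q != 0 by rewrite -size_poly_gt0 qn; lia.
have irr u : u %| q -> (1 < size u)%N -> q %| u.
  move=> uq su; have : Q (size u).
    by apply/asboolP; exists u; split=> //; apply: dvdp_trans uq _.
  move/minq => nu; have : size u == size q.
    by rewrite eqn_leq dvdp_leq // qn.
  by rewrite (dvdp_size_eqp uq) => /andP [].
have pr u v : q %| u * v -> q %| u \/ q %| v.
  move=> quv; case: (eqVneq (size (gcdp q u)) 1%N) => [|s].
    by move/eqP; rewrite -coprimep_def => cop; right; rewrite -(Gauss_dvdpr v cop).
  left; apply: dvdp_trans (dvdp_gcdr q u); apply: irr (dvdp_gcdl _ _) _.
  have : gcdp q u != 0 by rewrite gcdp_eq0 negb_and q0.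
  by rewrite -size_poly_gt0 => s0; apply: neq1_gt1.
have /Pdiv.Idomain.dvdpP [[b w] /= b0 e] := qg.
have nw : ~ q %| w.
  move=> /Pdiv.Idomain.dvdpP [[b' w'] /= b'0 e'].
  have : (size q <= 1)%N; last by rewrite qn; lia.
  apply: (reduced_sqr_free rg g0); apply/Pdiv.Idomain.dvdpP.
  exists (b' * b, w'); rewrite ?mulf_neq0 //= -scalerA e -!mul_polyC.
  by rewrite mulrA mul_polyC e'; ring.
(* Applying the derivation to b g = w q shows that q divides w D(q); q is prime over k(x) and does
   not divide w because g is reduced. *)
have dq_of (D : bipoly k -> bipoly k) : (forall u v, D (u * v) = D u * v + u * D v) ->
    q %| D g -> q %| D q.
  move=> DM qD; have := congr1 D e; rewrite -mul_polyC !DM => eD.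
  have : q %| w * D q.
    have -> : w * D q = D b%:P * g + b%:P * D g - D w * q by rewrite eD; ring.
    by apply: dvdp_sub; [apply: dvdp_add; apply: dvdp_mull | apply: dvdp_mull; apply: dvdpp].
  by case/pr.
have qy0 : q^`() = 0.
  apply/eqP; case: eqVneq => // nz.
  have := dvdp_leq nz (dq_of _ (@derivM _) qy).
  by rewrite leqNgt lt_size_deriv.
(* The derivative in x does not raise the degree in y, so it is proportional to q over k(x). *)
have [c1 [c2 [c10 e1]]] : exists c1 c2, c1 != 0 /\ c1 *: dx q = c2 *: q.
  have /Pdiv.Idomain.dvdpP [[c1 v] /= c10 e1] := dq_of _ (@dxM _) qx.
  exists c1; case: (eqVneq v 0) => [v0|v0].
    by exists 0; rewrite scale0r e1 v0 mul0r.
  have : (size (v * q)%R <= size q)%N.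
    rewrite -e1; apply: leq_trans (size_scale_leq _ _) _.
    apply/leq_sizeP => j jq; apply/polyP => i; rewrite coef_dx (@nth_default _ _ q) // !coef0.
    by rewrite mul0rn.
  rewrite size_mul // => sv; have : size v == 1%N.
    by apply: (predD_leqr sv); rewrite size_poly_gt0.
  by case/size_poly1P => c2 _ ev; exists c2; rewrite e1 ev mul_polyC.
pose l := lead_coef q.
have l0 : l != 0 by rewrite lead_coef_eq0.
have pp : prime p := pcharf_prime hp.
have cf (j : nat) : c1 * (q`_j)^`() = c2 * q`_j.
  have := congr1 (fun u : bipoly k => u`_j) e1; rewrite /= !coefZ => <-; congr (_ * _).
  by apply/polyP => i; rewrite coef_dx coef_deriv.
(* All nonzero coefficients of q, in particular l, have the same logarithmic derivative c2/c1. Hence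
   q/l, and with it l^p (q/l), has derivative 0 in x. *)
have [h eh] : exists h, l ^+ p.-1 *: q = h ^+ p.
  apply: bipoly_pth_power; first by rewrite derivZ qy0 scaler0.
  rewrite -mul_polyC dxM dx_C; apply/polyP => j; rewrite coefD !coefCM coef0.
  have -> : (dx q)`_j = (q`_j)^`() by apply/polyP => i; rewrite coef_dx coef_deriv.
  have p2 : p.-1 = p.-2.+1 by case: (p) (prime_gt1 pp) => [|[]].
  have c1l : c1 * l^`() = c2 * l by rewrite /l lead_coefE cf.
  have -> : (l ^+ p.-1)^`() = - (l ^+ p.-2 * l^`()).
    rewrite deriv_exp -mulr_natr; have -> : (p.-1%:R : {poly k}) = -1.
      apply/eqP; rewrite -addr_eq0 natr1 prednK ?prime_gt0 //.
      by rewrite -polyC_natr (pcharf0 hp).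
    by rewrite mulrN1 mulrC.
  apply: (mulfI c10); rewrite mulr0.
  have -> : l ^+ p.-1 = l ^+ p.-2 * l by rewrite -exprSr -p2.
  have -> : c1 * (- (l ^+ p.-2 * l^`()) * q`_j + l ^+ p.-2 * l * (q`_j)^`()) =
     l ^+ p.-2 * (l * (c1 * (q`_j)^`()) - c1 * l^`() * q`_j) by ring.
  by rewrite cf c1l; ring.
have hq : h %| q.
  rewrite -(@dvdpZr _ (l ^+ p.-1)) ?expf_neq0 // eh -(prednK (prime_gt0 pp)) exprS.
  exact: dvdp_mulIl.
have sh := size_exp h p; rewrite -eh size_scale ?expf_neq0 // in sh.
(* [h] is a factor of q over k(x) of positive but smaller degree in y, against irreducibility. *)
have /andP [h1 hlt] : (1 < size h < size q)%N.
  by apply: pred_mul_lt sh; [exact: prime_gt1 | rewrite qn].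
have : (size q <= size h)%N by apply: dvdp_leq (irr _ hq h1); apply: dvdpN0 hq q0.
by rewrite leqNgt hlt.
Qed.

End Jacobian.

(** * Termination of the blow-ups *)

Section Resolution.
Variables (k : closedFieldType) (p : nat) (hp : p \in [pchar k]).
Implicit Types (g h u : bipoly k) (d : option k).

Definition resolvable (bx by_ : bool) g := exists t,
  [/\ valid bx by_ t, vanish t g & nondeg bx by_ t g].

(** By [vanish_eps] and [nondeg_eps] the contact of each subtree with the new exceptional curve is
    the multiplicity of its tangent direction, and these multiplicities add up to [m], as [valid]
    demands. *)
Lemma resolvable_node bx by_ m g : (0 < m)%N -> ordge m g -> lform m g != 0 ->
  (forall d, (blow d m g)`_0`_0 = 0 ->
    resolvable (upx bx d) (upy by_ d) (blow d m g)) ->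
  resolvable bx by_ g.
Proof.
move=> m0 og n0 H; have [D [e [uD DE se De]]] := lformd_factor n0.
have /choice [T HT] : forall d, exists t, d \in D ->
    [/\ valid (upx bx d) (upy by_ d) t, vanish t (blow d m g) &
        nondeg (upx bx d) (upy by_ d) t (blow d m g)].
  move=> d; case: (boolP (d \in D)) => [|_]; last by exists Leaf.
  by rewrite DE => /eqP /H [t Ht]; exists t.
have mapD : [seq dt.1 | dt <- [seq (d, T d) | d <- D]] = D.
  by rewrite -map_comp map_id.
have epsE d : d \in D -> eps (edir d) (T d) = e d.
  move=> dD; have [vt gt nt] := HT _ dD; have [u eu u0] := De _ dD.
  have fl : is_true (if d is Some _ then upx bx d else upy by_ d) by case: (d).
  have nz := nondeg_eps vt gt nt fl; have z := vanish_eps vt gt.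
  apply/eqP; rewrite eqn_leq; apply/andP; split; rewrite leqNgt; apply/negP => lt.
    by have := z d _ lt; rewrite resd_blow eu coefMXn ltnn subnn; apply/eqP.
  by move: nz; rewrite resd_blow eu coefMXn lt eqxx.
exists (Node m [seq (d, T d) | d <- D]); split.
- apply/and4P; split=> //; first by rewrite mapD.
    rewrite -map_comp sumnE big_map -[X in _ == X]se; apply/eqP/eq_big_seq => d dD; exact: epsE.
  by rewrite all_map; apply/allP => d dD /=; have [] := HT _ dD.
- apply/vanish_node; split=> // dt /mapP [d dD ->] /=; by have [] := HT _ dD.
apply/nondeg_node; split=> // dt /mapP [d dD ->] /=; by have [] := HT _ dD.
Qed.

Lemma resd_coef1 g d : ordge 1 g -> (resd d (blow d 1 g))`_1 = (if d is Some _ then g`_1`_0 else g`_0`_1).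
Proof.
move=> og; rewrite resd_blow; case: d => [a|] /=; last by rewrite coef_lform_swap.
have -> : lform 1 g = (g`_0`_1)%:P + g`_1`_0 *: 'X.
  by apply/polyP => -[|[|j]]; rewrite coef_lform coefD coefC coefZ coefX /= ?(mulr0, mulr1, addr0, add0r).
by rewrite comp_polyD comp_polyC comp_polyZ comp_polyX coefD coefC add0r coefZ coefD coefX coefC addr0 mulr1.
Qed.

Lemma coef0_blow1 g d : (blow d 1 g)`_0`_0 = (if d is Some a then g`_0`_1 + g`_1`_0 * a else g`_1`_0).
Proof.
rewrite -coef_lformd0; case: d => [a|] /=; last by rewrite coef_lform_swap.
have -> : lform 1 g = (g`_0`_1)%:P + g`_1`_0 *: 'X.
  by apply/polyP => -[|[|j]]; rewrite coef_lform coefD coefC coefZ coefX /= ?(mulr0, mulr1, addr0, add0r).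
by rewrite comp_polyD comp_polyC comp_polyZ comp_polyX coefD coefC coefZ coefD coefX coefC add0r.
Qed.

Lemma lform1_neq0 g : g`_1`_0 != 0 \/ g`_0`_1 != 0 -> lform 1 g != 0.
Proof. by case=> H; apply/lform_neq0P; [exists 1%N | exists 0%N]. Qed.

(** [N] is the contact with y = 0. While both axes are exceptional the point is blown up: the next
    point is off y = 0, or the contact has dropped by one. *)
Lemma resolvable_smooth_x N (by_ : bool) g : ordge 1 g -> g`_1`_0 != 0 ->
  (by_ -> g`_0`_N != 0) -> resolvable true by_ g.
Proof.
elim: N by_ g => [|N IH] [] g og g1 gN.
- by have := gN isT; rewrite og ?eqxx.
- by exists Leaf; split=> //; apply/vanish_leaf/og.
- apply: (@resolvable_node _ _ 1) => //; first by apply: lform1_neq0; left.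
  move=> d; have := resd_coef1 d og; have := coef0_blow1 g d; case: d => [a|] /= e0 e1 z.
    apply: IH; first by apply/ordge1P.
      by rewrite -coef_resx e1.
    move/eqP => a0; rewrite a0.
    have := @resd_blow_edir _ None 1 g N; rewrite /= !coef_resx !coef_swapXY => ->.
    by rewrite addn1; apply: gN.
  by move: g1; rewrite -e0 z eqxx.
- by exists Leaf; split=> //; apply/vanish_leaf/og.
Qed.

Lemma resolvable_smooth_y N (bx : bool) g : ordge 1 g -> g`_0`_1 != 0 ->
  (bx -> g`_N`_0 != 0) -> resolvable bx true g.
Proof.
elim: N bx g => [|N IH] [] g og g1 gN.
- by have := gN isT; rewrite og ?eqxx.
- by exists Leaf; split=> //; apply/vanish_leaf/og.
- apply: (@resolvable_node _ _ 1) => //; first by apply: lform1_neq0; right.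
  move=> d; have := resd_coef1 d og; have := coef0_blow1 g d; case: d => [a|] /= e0 e1 z.
    have a0 : a != 0 by apply: contraNneq g1 => a0; move: e0; rewrite z a0 mulr0 addr0 => <-.
    rewrite (negbTE a0); apply: (@resolvable_smooth_x 0) => //; first exact/ordge1P.
    rewrite -coef_resx e1; apply: contraNneq g1 => g10.
    by move: e0; rewrite z g10 mul0r addr0 => <-.
  apply: IH; first by apply/ordge1P.
    by rewrite -coef_swapXY -coef_resx e1.
  have := @resd_blow_edir _ (Some 0) 1 g N; rewrite /= !coef_resx => -> _.
  by rewrite addn1; apply: gN.
- by exists Leaf; split=> //; apply/vanish_leaf/og.
Qed.

(** A leaf has exactly one exceptional curve through it, so a smooth point is first blown up once,
    whatever [bx] and [by_] are. The branch is then transversal to the new exceptional curve. *)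
Lemma resolvable_smooth (bx : bool) (by_ : bool) g : ordge 1 g -> lform 1 g != 0 ->
  (bx -> resx g != 0) -> (by_ -> resx (swapXY g) != 0) -> resolvable bx by_ g.
Proof.
move=> og n0 hx hy; apply: (@resolvable_node _ _ 1) => // d.
have nz (q : {poly k}) : q != 0 -> q`_0 = 0 -> exists N, q`_N.+1 != 0.
  move=> q0 z; have := q0; rewrite -lead_coef_eq0 lead_coefE; case: (size q).-1 => [|N]; last by exists N.
  by rewrite z eqxx.
have n1 : g`_0`_1 != 0 \/ g`_1`_0 != 0.
  by case/lform_neq0P: n0 => -[|[|j]] // _ H; [left | right].
have := resd_coef1 d og; have := coef0_blow1 g d; case: d => [a|] /= e0 e1 z.
  have g10 : g`_1`_0 != 0.
    case: n1 => // g01; apply: contraNneq g01 => g10.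
    by move: e0; rewrite z g10 mul0r addr0 => <-.
  have [N HN] : exists N, by_ -> g`_0`_N.+1 != 0.
    case: (by_) hy => [/(_ isT) /nz []|_]; last by exists 0%N.
      by rewrite coef_resx coef_swapXY og.
    by move=> N; rewrite coef_resx coef_swapXY; exists N.
  apply: (@resolvable_smooth_x N); first exact/ordge1P.
    by rewrite -coef_resx e1.
  case/andP => b /eqP ->.
  have := @resd_blow_edir _ None 1 g N; rewrite /= !coef_resx !coef_swapXY => ->.
  by rewrite addn1; apply: HN.
have g01 : g`_0`_1 != 0 by case: n1 => //; rewrite -e0 z eqxx.
have [N HN] : exists N, bx -> g`_N.+1`_0 != 0.
  case: (bx) hx => [/(_ isT) /nz []|_]; last by exists 0%N.
    by rewrite coef_resx og.
  by move=> N; rewrite coef_resx; exists N.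
apply: (@resolvable_smooth_y N); first exact/ordge1P.
  by rewrite -coef_swapXY -coef_resx e1.
have := @resd_blow_edir _ (Some 0) 1 g N; rewrite /= !coef_resx => -> b.
by rewrite addn1; apply: HN.
Qed.


Definition good (bx by_ : bool) g :=
  [/\ reduced g, g`_0`_0 = 0, bx -> resx g != 0 & by_ -> resx (swapXY g) != 0].

Lemma hasmult_exists g : g != 0 -> exists m, hasmult m g.
Proof.
move=> g0; have : exists n, `[< ~ ordge n.+1 g >].
  exists ((size (lead_coef g)).-1 + (size g).-1)%N; apply/asboolP => H.
  have := H (size (lead_coef g)).-1 (size g).-1 (leqnn _).
  by rewrite -lead_coefE -lead_coefE => /eqP; rewrite !lead_coef_eq0 (negbTE g0).
case/ex_minnP => n /asboolP nn minn; exists n.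
have og : ordge n g.
  case: n {nn} minn => [|n] // minn; apply: contrapT => H.
  by have := minn n (introT (asboolP _) H); rewrite ltnn.
split=> //; apply: contra_not_neq nn => l0 i j; rewrite ltnS leq_eqVlt => /predU1P [e|]; last exact: og.
have := coef_lform n g j; rewrite l0 coef0 -e leq_addl addnK; exact: esym.
Qed.

Lemma size_lformd d m g : (size (lformd d m g) <= m.+1)%N.
Proof.
case: d => [a|] /=; last exact: size_poly.
rewrite size_comp_poly2 ?size_poly //.
by rewrite -[a]opprK polyCN size_XsubC.
Qed.

Lemma resd_shift_neq0 d m g : ordge m g -> resd d g != 0 -> resd d (blow (edir d) m g) != 0.
Proof.
move=> og n0; have : (resd d g)`_(size (resd d g)).-1 != 0 by rewrite -lead_coefE lead_coef_eq0.
case: (ltnP (size (resd d g)).-1 m) => [lt|le].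
  by case: d {n0} lt => [a|] /= lt; rewrite coef_resx ?coef_swapXY og ?eqxx // addn0.
rewrite -(subnK le) -resd_blow_edir; apply: contra_neq => ->; exact: coef0.
Qed.

Lemma resd_low d m g j : ordge m g -> (j < m)%N -> (resd d g)`_j = 0.
Proof. by move=> og jm; case: d => [a|]; rewrite /= coef_resx ?coef_swapXY og ?addn0. Qed.

(** On the exceptional curve the transform has degree at most [m.+1] and order at least [m']. If
    these agree, it is a monomial of degree [m.+1]: the new tangent cone does not contain the
    exceptional curve. *)
Lemma good_child bx by_ m g d : good bx by_ g -> hasmult m.+1 g ->
  (blow d m.+1 g)`_0`_0 = 0 ->
  good (upx bx d) (upy by_ d) (blow d m.+1 g) /\
  exists m', [/\ (0 < m')%N, (m' <= m.+1)%N, hasmult m' (blow d m.+1 g) &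
     m' = m.+1 -> (resd d (blow d m.+1 g))`_m.+1 != 0].
Proof.
case=> rg g0 hx hy [og n0] z; have l0 := lformd_neq0 d n0.
have r0 : resd d (blow d m.+1 g) != 0 by rewrite resd_blow.
have [m' [om' nm']] : exists m', hasmult m' (blow d m.+1 g).
  by apply: hasmult_exists; apply: contra_neq r0 => ->; exact: raddf0.
split.
  split=> //; first exact: blow_reduced.
    case: d {z l0 om' nm'} r0 => [a|] //= r0 /hx b.
    exact: (@resd_shift_neq0 (Some 0)).
  case: d {z l0 om' nm'} r0 => [a|] //= r0 /andP [/hy b /eqP ->].
  exact: (@resd_shift_neq0 None).
have ord j := @resd_low d m' _ j om'.
have [j jm jn] : exists2 j, (j <= m.+1)%N & (resd d (blow d m.+1 g))`_j != 0.
  exists (size (resd d (blow d m.+1 g))).-1; last by rewrite -lead_coefE lead_coef_eq0.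
  by rewrite resd_blow; have := size_lformd d m.+1 g; case: (size _).
have mj : (m' <= j)%N by rewrite leqNgt; apply/negP => /ord; apply/eqP.
exists m'; split=> //.
- by rewrite lt0n; apply: contraNneq nm' => e; rewrite e; apply/eqP/polyP => -[|i]; rewrite coef_lform coef0 ?subn0 /= ?z.
- exact: leq_trans mj jm.
by move=> e; have e2 : j = m.+1; [apply/eqP; rewrite eqn_leq jm -e | rewrite e2 in jn].
Qed.

Lemma reduced_swap g : reduced g -> reduced (swapXY g).
Proof.
move/reducedP => rg; apply/reducedP => h n [w e].
have [v ev] : mdivides g (swapXY h).
  apply: (rg _ n); exists (swapXY w); rewrite -[g]swapXYK -swapM -e.
  by apply: esym; exact: rmorphXn.
by exists (swapXY v); rewrite -swapM -ev swapXYK.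
Qed.

Section Phases.
Variable m : nat.
Hypothesis IHm : forall m' (bx by_ : bool) g, (0 < m')%N -> (m' < m.+2)%N -> good bx by_ g ->
  hasmult m' g -> resolvable bx by_ g.

(** The tangent cone avoids x = 0, so a next point of the same multiplicity lies in a chart that
    keeps x, where [jacobian_blow] strips x^(m+1) from [r]. The index [N] of a nonzero coefficient
    of [r] cannot decrease forever. *)
Lemma resolvable_xphase N (by_ : bool) g (r : {poly k}) : good true by_ g -> hasmult m.+2 g ->
  g`_m.+2`_0 != 0 -> jacobian g r%:P -> r`_N != 0 -> resolvable true by_ g.
Proof.
elim/ltn_ind: N by_ g r => N IH by_ g r gg hm gm jr rN.
apply: (resolvable_node (m := m.+2)) => //; [by case: hm | by case: hm | move=> d z].
have [gc [m' [m'0 m'm hm' em']]] := good_child gg hm z.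
case: (ltngtP m' m.+2) m'm => // [lt|e] _; first exact: (IHm m'0 lt gc hm').
case: d z gc hm' em' => [a|] z gc hm' /(_ e) em'; last first.
  by have := coef_lformd0 None m.+2 g; rewrite z /= coef_lform_swap subn0 => /eqP; rewrite (negbTE gm).
have [r1 jr1 er] := jacobian_blow a (proj1 hm) jr.
rewrite e in hm'; have Nm : (m.+1 <= N)%N.
  by rewrite leqNgt; apply: contra rN => lt; rewrite er coefXnM lt.
apply: (IH (N - m.+1)%N _ _ _ r1 gc hm' _ jr1); first by rewrite -subn_gt0 subKn.
  by move: em'; rewrite /= coef_resx.
by move: rN; rewrite er coefXnM ltnNge Nm.
Qed.

Lemma resolvable_x (by_ : bool) g : good true by_ g -> hasmult m.+2 g ->
  g`_m.+2`_0 != 0 -> resolvable true by_ g.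
Proof.
move=> gg hm gm; have g0 : g != 0 by apply: contraNneq gm => ->; rewrite !coef0.
have [rg _ _ _] := gg; have [r r0 jr] := jacobian_poly hp rg g0.
by apply: (resolvable_xphase gg hm gm jr (N := (size r).-1)); rewrite -lead_coefE lead_coef_eq0.
Qed.

(** The direction [None] keeps y, and [r] is followed as a polynomial in y. Any other direction of
    the same multiplicity enters the x-phase, which is never left at constant multiplicity. *)
Lemma resolvable_yphase N (bx : bool) g (r : {poly k}) : good bx true g -> hasmult m.+2 g ->
  g`_0`_m.+2 != 0 -> jacobian (swapXY g) r%:P -> r`_N != 0 -> resolvable bx true g.
Proof.
elim/ltn_ind: N bx g r => N IH bx g r gg hm gm jr rN.
apply: (resolvable_node (m := m.+2)) => //; [by case: hm | by case: hm | move=> d z].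
have [gc [m' [m'0 m'm hm' em']]] := good_child gg hm z.
case: (ltngtP m' m.+2) m'm => // [lt|e] _; first exact: (IHm m'0 lt gc hm').
case: d z gc hm' em' => [a|] z gc hm' /(_ e) em'; rewrite e in hm'.
  by apply: resolvable_x => //; move: em'; rewrite /= coef_resx.
have [r1 jr1 er] := jacobian_blow 0 (ordge_swap (proj1 hm)) jr.
have Nm : (m.+1 <= N)%N.
  by rewrite leqNgt; apply: contra rN => lt; rewrite er coefXnM lt.
apply: (IH (N - m.+1)%N _ _ _ r1 gc hm'); first by rewrite -subn_gt0 subKn.
- by move: em'; rewrite /= coef_resx coef_swapXY.
- by rewrite /= swapXYK.
by move: rN; rewrite er coefXnM ltnNge Nm.
Qed.

Lemma resolvable_y (bx : bool) g : good bx true g -> hasmult m.+2 g ->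
  g`_0`_m.+2 != 0 -> resolvable bx true g.
Proof.
move=> gg hm gm; have g0 : swapXY g != 0.
  by rewrite swapXY_eq0; apply: contraNneq gm => ->; rewrite !coef0.
have [rg _ _ _] := gg; have [r r0 jr] := jacobian_poly hp (reduced_swap rg) g0.
by apply: (resolvable_yphase gg hm gm jr (N := (size r).-1)); rewrite -lead_coefE lead_coef_eq0.
Qed.

End Phases.

(* The multiplicity drops after finitely many blow-ups: as long as it stays equal to m,
   a polynomial in one variable lying in the Jacobian ideal loses a factor of degree m - 1. *)
Theorem resolution bx by_ g m : (0 < m)%N -> good bx by_ g -> hasmult m g -> resolvable bx by_ g.
Proof.
elim/ltn_ind: m bx by_ g => -[|[|m]] IH bx by_ g // _ gg hm.
  by case: gg hm => _ _ hx hy [og n0]; apply: resolvable_smooth.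
have IHm m' (b c : bool) u : (0 < m')%N -> (m' < m.+2)%N -> good b c u ->
  hasmult m' u -> resolvable b c u by move=> m0 lt; apply: IH.
apply: (resolvable_node (m := m.+2)) => //; [by case: hm | by case: hm | move=> d z].
have [gc [m' [m'0 m'm hm' em']]] := good_child gg hm z.
case: (ltngtP m' m.+2) m'm => // [lt|e] _; first exact: (IHm _ _ _ _ m'0 lt gc hm').
case: d z gc hm' em' => [a|] z gc hm' /(_ e) em'; rewrite e in hm'.
  by apply: (resolvable_x IHm) => //; move: em'; rewrite /= coef_resx.
by apply: (resolvable_y IHm) => //; move: em'; rewrite /= coef_resx coef_swapXY.
Qed.

End Resolution.

(** * Naturality of virtual transforms under ring homomorphisms *)

Notation bimap f := (map_poly (map_poly f)).

Section Natural.
Variables (S K : comNzRingType) (f : {rmorphism S -> K}).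
Implicit Types (g : bipoly S) (d : option S) (t : tree S).

Lemma coef_bimap g i j : (bimap f g)`_j`_i = f g`_j`_i.
Proof. by rewrite coef_map coef_map. Qed.

Lemma bimap_swap g : bimap f (swapXY g) = swapXY (bimap f g).
Proof. by apply/polyP => j; apply/polyP => i; rewrite coef_swapXY !coef_bimap coef_swapXY. Qed.

Lemma bimap_blow d m g : bimap f (blow d m g) = blow (omap f d) m (bimap f g).
Proof.
have E a h : bimap f (blowS a m h) = blowS (f a) m (bimap f h).
  rewrite /blowS map_comp_poly rmorphD /= map_polyX map_polyC /= map_polyC; congr (_ \Po _).
  apply/polyP => j; apply/polyP => i.
  rewrite coef_bimap !coef_map /= !coef_compXY !coef_drop_poly !coefMXn.
  by case: ifP; rewrite ?rmorph0 // coef_bimap.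
case: d => [a|] /=; first exact: E.
by rewrite bimap_swap E rmorph0 bimap_swap.
Qed.

Definition cmap (A B : Type) (s : A -> B) (c : cond A) : cond B :=
  ([seq (omap s dm.1, dm.2) | dm <- c.1], c.2).

Lemma evc_bimap c g : evc (cmap f c) (bimap f g) = f (evc c g).
Proof.
case: c => cs ij; elim: cs g => [|dm cs IH] g; first exact: coef_bimap.
by rewrite evc_foldl -IH -bimap_blow.
Qed.

End Natural.

(** * Clusters under a map of directions *)

Section Directions.
Variable A : eqType.

Fixpoint dirs (t : tree A) : seq A :=
  match t with
  | Leaf => [::]
  | Node m ch => pmap fst ch ++ flatten [seq dirs dt.2 | dt <- ch]
  end.

Lemma dirs_head m (ch : seq (option A * tree A)) dt a : dt \in ch -> dt.1 = Some a -> a \in dirs (Node m ch).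
Proof.
by move=> dtch e; rewrite mem_cat; apply/orP; left; rewrite mem_pmap -e; apply: map_f.
Qed.

Lemma dirs_child m (ch : seq (option A * tree A)) dt a : dt \in ch -> a \in dirs dt.2 -> a \in dirs (Node m ch).
Proof.
move=> dtch ad; rewrite mem_cat; apply/orP; right.
by apply/flatten_mapP; exists dt.
Qed.

Variables (B : eqType) (s : A -> B).

Lemma conds_tmap (t : tree A) : conds (tmap s t) = [seq cmap s c | c <- conds t].
Proof.
elim/tree_induct: t => [|m ch IH] //=.
rewrite map_cat -!map_comp; congr (_ ++ _).
rewrite map_flatten -!map_comp; congr flatten; apply/eq_in_map => dt dtch /=.
by rewrite IH // -!map_comp.
Qed.

Lemma eq_tmap (s' : A -> B) (t : tree A) : {in dirs t, s =1 s'} -> tmap s t = tmap s' t.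
Proof.
elim/tree_induct: t => [|m ch IH] //= e; congr Node; apply/eq_in_map => dt dtch.
rewrite (IH _ dtch) => [|a ad]; last by apply: e; apply: dirs_child dtch ad.
congr (_, _); case e1: dt.1 => [a|] //=; congr Some; apply: e.
exact: dirs_head dtch e1.
Qed.

Lemma tmap_comp (D : eqType) (s' : B -> D) (t : tree A) : tmap s' (tmap s t) = tmap (s' \o s) t.
Proof.
elim/tree_induct: t => [|m ch IH] //=; rewrite -map_comp; congr Node.
by apply/eq_in_map => dt dtch /=; rewrite IH //; case: dt.1.
Qed.

End Directions.

Lemma tmap_id (A : eqType) (t : tree A) : tmap id t = t.
Proof.
elim/tree_induct: t => [|m ch IH] //=; congr Node; rewrite -[RHS]map_id.
by apply/eq_in_map => -[[a|] t] dtch /=; rewrite (IH _ dtch).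
Qed.

Section Transfer.
Variables (k C : fieldType) (tau : k -> C).
Hypothesis tau0 : tau 0 = 0.

(** The element 0 is included because [edir] and [upy] compare directions with it. *)
Definition tau_inj (t : tree k) := {in 0 :: dirs t &, injective tau}.

Lemma tau_inj_child m (ch : seq (option k * tree k)) dt : dt \in ch -> tau_inj (Node m ch) -> tau_inj dt.2.
Proof.
move=> dtch ti a b ha hb; apply: ti.
  by move: ha; rewrite !inE => /predU1P [->|/(dirs_child m dtch)->]; rewrite ?eqxx ?orbT.
by move: hb; rewrite !inE => /predU1P [->|/(dirs_child m dtch)->]; rewrite ?eqxx ?orbT.
Qed.

Definition dir_ok (l : seq k) (d : option k) := if d is Some a then a \in l else true.

Lemma dir_ok_head m (ch : seq (option k * tree k)) dt : dt \in ch -> dir_ok (0 :: dirs (Node m ch)) dt.1.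
Proof.
move=> dtch; case e: dt.1 => [a|] //=; rewrite inE; apply/orP; right.
exact: dirs_head dtch e.
Qed.

Lemma omap_tau_inj l : {in l &, injective tau} ->
  forall d d', dir_ok l d -> dir_ok l d' -> omap tau d = omap tau d' -> d = d'.
Proof. by move=> ti [a|] [b|] //= ha hb [] /(ti _ _ ha hb) ->. Qed.

Lemma eps_tmap z t : tau_inj t -> dir_ok [:: 0] z -> eps (omap tau z) (tmap tau t) = eps z t.
Proof.
move=> + zok; elim/tree_induct: t => [|m ch IH] ti //=.
congr (_ + _)%N; rewrite -map_comp; congr sumn; apply/eq_in_map => dt dtch /=.
have -> : (omap tau dt.1 == omap tau z) = (dt.1 == z).
  apply/eqP/eqP => [|-> //]; apply: (omap_tau_inj ti); first exact: dir_ok_head.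
  by case: (z) zok => //= a; rewrite inE => /eqP ->; rewrite mem_head.
by case: ifP => // _; apply: IH => //; apply: tau_inj_child ti.
Qed.

Lemma upx_tau bx d : upx bx (omap tau d) = upx bx d.
Proof. by case: d. Qed.

Lemma upy_tau l by_ d : {in 0 :: l &, injective tau} -> dir_ok (0 :: l) d ->
  upy by_ (omap tau d) = upy by_ d.
Proof.
move=> ti; case: d => [a|] //= al; congr (_ && _); apply/eqP/eqP => [|->] //.
by rewrite -tau0; apply: ti => //; rewrite mem_head.
Qed.

Lemma valid_tmap bx by_ t : tau_inj t -> valid bx by_ (tmap tau t) = valid bx by_ t.
Proof.
elim/tree_induct: t bx by_ => [|m ch IH] bx by_ ti //=.
rewrite -!map_comp; congr [&& _, _, _ & _].
- rewrite -[[seq (_ \o _) x | x <- ch]]/(map (omap tau \o fst) ch) map_comp.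
  apply: map_inj_in_uniq => d d' /mapP [dt dtch ->] /mapP [dt' dtch' ->].
  by apply: (omap_tau_inj ti); apply: dir_ok_head.
- congr (_ == _); congr sumn; apply/eq_in_map => dt dtch /=.
  have -> : edir (omap tau dt.1) = omap tau (edir dt.1) by case: dt.1 => //=; rewrite tau0.
  apply: eps_tmap; first exact: tau_inj_child ti.
  by case: dt.1 => //=; rewrite mem_head.
rewrite all_map; apply: eq_in_all => dt dtch /=; rewrite upx_tau.
by rewrite (upy_tau _ ti) ?dir_ok_head // IH //; apply: tau_inj_child ti.
Qed.

End Transfer.

Section Specialise.
Variables (S : comNzRingType) (k C : fieldType) (f : {rmorphism S -> k}) (i : {rmorphism S -> C}).
Hypothesis i_inj : injective i.
Variable s : k -> S.
Hypothesis s0 : s 0 = 0.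
Let tau := i \o s.
Let tau0 : tau 0 = 0. Proof. by rewrite /tau /= s0 rmorph0. Qed.

Lemma vanish_bimap (K : comNzRingType) (h : {rmorphism S -> K}) (t : tree S) g :
  vanish t g -> vanish (tmap h t) (bimap h g).
Proof.
move=> vg c; rewrite conds_tmap => /mapP [c' ct ->]; rewrite evc_bimap vg //.
exact: rmorph0.
Qed.

(** This one-way implication is why [nondeg] lifts at once, whereas [vanish] has to be arranged. *)
Lemma emb_neq0 z : f z != 0 -> i z != 0.
Proof.
apply: contraNneq => e; have -> : z = 0 by apply: i_inj; rewrite e rmorph0.
by rewrite rmorph0.
Qed.

Lemma nondeg_lift bx by_ (t : tree k) g : tau_inj tau t -> {in dirs t, cancel s f} ->
  nondeg bx by_ t (bimap f g) -> nondeg bx by_ (tmap tau t) (bimap i g).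
Proof.
elim/tree_induct: t bx by_ g => [|m ch IH] bx by_ g ti sf.
  by case=> hx hy; split=> b; rewrite coef_bimap emb_neq0 // -coef_bimap; [exact: hx | exact: hy].
case/nondeg_node => n0 ng; apply/nondeg_node; split.
  case/lform_neq0P: n0 => j jm nz; apply/lform_neq0P; exists j => //.
  by rewrite coef_bimap emb_neq0 // -coef_bimap.
move=> dt /mapP [[d u] dtch ->] /=; rewrite upx_tau (upy_tau tau0 _ ti); last exact: (dir_ok_head m dtch).
have -> : omap tau d = omap i (omap s d) by case: (d).
rewrite -bimap_blow; apply: (IH _ dtch); first exact: tau_inj_child dtch ti.
  by move=> a au; apply: sf; apply: dirs_child dtch au.
rewrite bimap_blow; have -> : omap f (omap s d) = d; last exact: (ng _ dtch).
case: (d) dtch => [a|] //= dtch; congr Some; apply: sf; exact: dirs_head dtch _.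
Qed.

End Specialise.

Lemma pred_add_lt a b c n : c = (a + b).-1 -> (1 < b)%N -> (c < n.+1)%N -> (a < n)%N.
Proof. lia. Qed.

(** * Reduced members of a pencil in characteristic 0 *)

Section GenericReduced.
Variable C : fieldType.
Hypothesis C0 : [pchar C] =i pred0.
Implicit Types (q r : bipoly C).

(** Two members of the pencil differ by a nonzero polynomial in x, so they share no factor of
    positive degree in y. The induction divides [r] by its common factor with one bad member; larger
    constants are then coprime to that factor. *)
Lemma coprime_pencil q (u : {poly C}) r : u != 0 -> r != 0 ->
  exists c0, forall c : nat, (c0 <= c)%N -> coprimep (q + (c%:R * u)%:P) r.
Proof.
move=> u0; have [n] := ubnP (size r); elim: n r => // n IH r sr r0.
case: (pselect (exists c1 : nat, ~~ coprimep (q + (c1%:R * u)%:P) r)) => [[c1 nc]|H]; last first.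
  by exists 0%N => c _; apply: contrapT => /negP nc; apply: H; exists c.
set d := gcdp (q + (c1%:R * u)%:P) r.
have d0 : d != 0 by rewrite gcdp_eq0 negb_and r0 orbT.
have sd : (1 < size d)%N.
  by move: nc d0; rewrite coprimep_def -/d -size_poly_gt0; case: (size d) => [|[]].
have /Pdiv.Idomain.dvdpP [[b r1] /= b0 e] : d %| r by exact: dvdp_gcdr.
have br0 : b *: r != 0 by rewrite -mul_polyC mulf_neq0 // polyC_eq0.
have r10 : r1 != 0 by apply: contraNneq br0 => r10; rewrite e r10 mul0r.
have [|c0 Hc0] := IH r1 _ r10.
  have : size r = (size r1 + size d).-1 by rewrite -size_mul // -e size_scale.
  by move=> er; apply: (pred_add_lt er sd sr).
exists (maxn c0 c1.+1) => c; rewrite geq_max => /andP [h0 h1].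
rewrite -(coprimepZr _ _ b0) e coprimepMr Hc0 //=.
apply/coprimepP => x xq xd; have xq1 : x %| q + (c1%:R * u)%:P by apply: dvdp_trans xd (dvdp_gcdl _ _).
have : x %| ((c - c1)%:R * u)%:P.
  have -> : ((c - c1)%:R * u)%:P = (q + (c%:R * u)%:P) - (q + (c1%:R * u)%:P) :> bipoly C.
    by rewrite natrB ?(ltnW h1) // mulrBl polyCB; ring.
  exact: dvdp_sub.
have v0 : (c - c1)%:R * u != 0.
  by rewrite mulf_neq0 // -polyC_natr polyC_eq0 (proj1 (pcharf0P C) C0) subn_eq0 -ltnNge.
move/dvdp_leq; rewrite polyC_eq0 => /(_ v0); rewrite size_polyC v0 /= => sx.
have x0 : x != 0 by apply: dvdpN0 xd d0.
by rewrite -size_poly_eq1 eqn_leq sx size_poly_gt0.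
Qed.

(** A separable polynomial is squarefree over C(x); the unit leading coefficient brings divisibility
    back to C[x]. *)
Lemma separable_reduced (F : bipoly C) : lead_coef F \in GRing.unit -> coprimep F F^`() -> reduced F.
Proof.
move=> uF cF; have F0 : F != 0.
  by apply: contraTneq uF => ->; rewrite lead_coef0 unitr0.
apply/reducedP => h n [w0 eh].
have Fh : F %| h ^+ n by rewrite eh dvdp_mull.
set g := gcdp F h; have /Pdiv.Idomain.dvdpP [[b w] /= b0 e] : g %| F by exact: dvdp_gcdl.
have bF0 : b *: F != 0 by rewrite -mul_polyC mulf_neq0 // polyC_eq0.
have wF : w %| F by rewrite -(dvdpZr _ _ b0) e dvdp_mulIl.
have cwg : coprimep w g.
  apply/coprimepP => x xw xg; have xF : x %| F by apply: dvdp_trans xw wF.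
  have xF' : x %| F^`().
    rewrite -(dvdpZr _ _ b0) -derivZ e derivM.
    by apply: dvdp_add; [apply: dvdp_mull | apply: dvdp_mulr].
  by move/coprimepP: cF; apply.
have cwh : coprimep w h.
  apply/coprimepP => x xw xh; move/coprimepP: cwg; apply=> //.
  by rewrite dvdp_gcd xh (dvdp_trans xw wF).
have sw : size w == 1%N.
  rewrite size_poly_eq1; have /coprimepP := coprimep_expr n cwh.
  by apply=> //; apply: dvdp_trans wF Fh.
have Fh1 : F %| h.
  apply: dvdp_trans (dvdp_gcdr F h); rewrite -/g.
  case/size_poly1P: sw => x x0 ex; rewrite -(dvdpZr _ _ x0) -mul_polyC -ex -e.
  by rewrite dvdpZr ?dvdpp.
by have [A eA] := Pdiv.IdomainUnit.dvdpP uF _ Fh1; exists A.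
Qed.

(** As [u] does not involve y, all members have the derivative of [q], and some member is coprime to
    it. *)
Lemma reduced_pencil q (u : {poly C}) : lead_coef q \in GRing.unit -> (1 < size q)%N -> u != 0 ->
  exists c : nat, reduced (q + (c%:R * u)%:P).
Proof.
move=> uq sq u0; have q'0 : q^`() != 0.
  have : q^`()`_(size q).-2 != 0; last by apply: contraNneq => ->; rewrite coef0.
  rewrite coef_deriv prednK -?subn1 ?subn_gt0 // subn1 -lead_coefE -mulr_natr mulf_neq0 //.
    by apply: contraTneq uq => ->; rewrite unitr0.
  by rewrite -!polyC_natr !polyC_eq0 (proj1 (pcharf0P C) C0) -lt0n -subn1 subn_gt0.
have [c0 H] := coprime_pencil q u0 q'0; exists c0; apply: separable_reduced.
  rewrite lead_coefDl // size_polyC; apply: leq_ltn_trans sq; exact: leq_b1.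
by rewrite derivD derivC addr0; apply: H.
Qed.

End GenericReduced.

(** * Compatible subrings of k and of the complex numbers *)

Section Uncountable.
Import Order.TTheory Num.Theory.
Variable R : realType.

(* Cantor's argument: a n is avoided by one outer third of the n-th nested interval. *)
Lemma real_avoid (a : nat -> R) : exists r, forall n, r != a n.
Proof.
pose w n : R := 3%:R ^- n.
pose fix l n : R := if n is m.+1 then
  (if a m < l m + w m / 2%:R then l m + w m * (2%:R / 3%:R) else l m) else 0.
have wS n : w n = w n.+1 * 3%:R by rewrite /w exprS invfM mulrAC mulVf ?mul1r // pnatr_eq0.
have w0 n : 0 < w n by rewrite invr_gt0 exprn_gt0 ?ltr0n.
have lS n : l n <= l n.+1 /\ l n.+1 + w n.+1 <= l n + w n.
  by have := w0 n.+1; rewrite /= [w n]wS; case: ifP => _ h; split; lra.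
have mono n d : l n <= l (n + d)%N /\ l (n + d)%N + w (n + d)%N <= l n + w n.
  elim: d => [|d [IH1 IH2]]; first by rewrite addn0.
  by have [h1 h2] := lS (n + d)%N; rewrite addnS; split; [apply: le_trans h1 | apply: le_trans IH2].
have ubl n m : l m <= l n + w n.
  case: (leqP m n) => [mn|/ltnW nm].
    have [h _] := mono m (n - m)%N; rewrite subnKC // in h.
    by apply: le_trans h _; rewrite lerDl ltW.
  have [_ h] := mono n (m - n)%N; rewrite subnKC // in h.
  by apply: le_trans h; rewrite lerDl ltW.
pose E : set R := [set x | exists n, x = l n]%classic.
have hub : has_ubound E by exists (l 0%N + w 0%N) => x [m ->]; apply: ubl.
have low n : l n <= sup E by apply: ub_le_sup => //; exists n.
have up n : sup E <= l n + w n by apply: ge_sup; [exists (l 0%N), 0%N | move=> x [m ->]].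
exists (sup E) => n; have := low n.+1; have := up n.+1; have := w0 n.+1.
move=> w1 h1 h2; apply/eqP => e; rewrite e in h1 h2; have := wS n.
by move: h1 h2; rewrite /=; case: ltP => h3 h1 h2 h4; rewrite h4 in h1 h2 h3; lra.
Qed.

End Uncountable.

(** * Subrings given by propositional predicates *)

Section SubringType.
Variable A : comNzRingType.

Record subring := Subring {
  subring_mem :> A -> Prop;
  subring1 : subring_mem 1;
  subringB : forall x y, subring_mem x -> subring_mem y -> subring_mem (x - y);
  subringM : forall x y, subring_mem x -> subring_mem y -> subring_mem (x * y)
}.

Definition subring_pred (P : subring) : pred A := fun x => `[< P x >].

Fact subring_pred_closed P : subring_closed (subring_pred P).
Proof.
split=> [|x y|x y]; rewrite ?unfold_in /subring_pred.
- by apply/asboolP/subring1.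
- by move=> /asboolP Px /asboolP Py; apply/asboolP/subringB.
- by move=> /asboolP Px /asboolP Py; apply/asboolP/subringM.
Qed.

HB.instance Definition _ P := GRing.isSubringClosed.Build A (subring_pred P)
  (subring_pred_closed P).

Record subring_type (P : subring) := SubringElt {
  subring_val : A; _ : subring_val \in subring_pred P }.

HB.instance Definition _ P := [isSub for @subring_val P].
HB.instance Definition _ P := [Choice of subring_type P by <:].
HB.instance Definition _ P := [SubChoice_isSubComNzRing of subring_type P by <:].

Lemma subring_valP P (x : subring_type P) : P (val x).
Proof. by case: x => x px; apply/asboolP. Qed.

Definition subring_elt (P : subring) x (Px : P x) : subring_type P :=
  SubringElt (introT (asboolP (P x)) Px).

End SubringType.

(** * Places and the adjunction of elements *)

Section Places.
Variables (k : fieldType) (C : closedFieldType) (p : nat) (hp : p \in [pchar k]).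
Hypothesis C0 : [pchar C] =i pred0.

(* A finitely generated subring of C with a reduction modulo p onto a subring of k. *)
Record place := Place {
  pl_ring : comNzRingType;
  pl_emb : {rmorphism pl_ring -> C};
  pl_red : {rmorphism pl_ring -> k};
  pl_inj : injective pl_emb;
  pl_fg : finitely_generated_ring pl_ring;
  pl_sep : forall z : pl_ring, z != 0 -> exists e w, z = p%:R ^+ e * w /\ pl_red w != 0;
  pl_enum : exists u : nat -> pl_ring, forall z, exists n, u n = z
}.

Lemma pC_neq0 : (p%:R : C) != 0.
Proof. by rewrite (proj1 (pcharf0P C) C0) -lt0n prime_gt0 // (pcharf_prime hp). Qed.

Section Adjoin.
Variable P : place.
Let S := pl_ring P.
Let i := pl_emb P.
Let f := pl_red P.

Lemma emb_eq0 z : (i z == 0) = (z == 0).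
Proof. by rewrite -(rmorph0 i) (inj_eq (@pl_inj P)). Qed.

Lemma red_p : f p%:R = 0. Proof. by rewrite rmorph_nat (pcharf0 hp). Qed.

Lemma red_ker z : f z = 0 -> exists w, z = p%:R * w.
Proof.
move=> fz; case: (eqVneq z 0) => [->|/pl_sep [[|e] [w [ez fw]]]]; first by exists 0; rewrite mulr0.
  by move: fw; rewrite expr0 mul1r in ez; rewrite -ez fz eqxx.
by exists (p%:R ^+ e * w); rewrite mulrA -exprS.
Qed.

Lemma mul_pX_inj e : injective ( *%R (p%:R ^+ e : S)).
Proof.
move=> x y /(congr1 i); rewrite !rmorphM rmorphXn rmorph_nat.
by move/(mulfI (expf_neq0 e pC_neq0))/pl_inj.
Qed.

(** The content at p. The exponent is bounded by that of the leading coefficient, which is finite by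
    [pl_sep]; at the maximal exponent [red_ker] forbids a cofactor that reduces to 0. *)
Lemma poly_content (Q : {poly S}) : Q != 0 ->
  exists e R, Q = (p%:R ^+ e)%:P * R /\ map_poly f R != 0.
Proof.
move=> Q0; have lQ : lead_coef Q != 0 by rewrite lead_coef_eq0.
have [e0 [w [ew fw]]] := pl_sep lQ.
pose D e := `[< exists R, Q = (p%:R ^+ e)%:P * R >].
have bd e : D e -> (e <= e0)%N.
  move/asboolP => [R eQ]; rewrite leqNgt; apply/negP => lt; case/eqP: fw.
  have : p%:R ^+ e0 * w = p%:R ^+ e0 * (p%:R ^+ (e - e0) * R`_(size Q).-1).
    by rewrite mulrA -exprD subnKC ?(ltnW lt) // -ew lead_coefE {1}eQ coefCM.
  move/mul_pX_inj => ->; rewrite rmorphM rmorphXn /= red_p expr0n subn_eq0 leqNgt lt mul0r //.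
have exD : exists e, D e by exists 0%N; apply/asboolP; exists Q; rewrite expr0 mul1r.
case: (ex_maxnP exD bd) => e /asboolP [R eQ] maxe; exists e, R; split=> //.
apply/eqP => R0; have /choice [v vE] : forall j, exists w, R`_j = p%:R * w.
  move=> j; apply: red_ker; have := congr1 (fun q : {poly k} => q`_j) R0.
  by rewrite coef_map coef0.
have : D e.+1.
  apply/asboolP; exists (\poly_(j < size R) v j); rewrite eQ exprSr polyCM -mulrA; congr (_ * _).
  apply/polyP => j; rewrite coefCM coef_poly; case: ltnP => [_|jR]; first exact: vE.
  by rewrite nth_default // mulr0.
by move/maxe; rewrite ltnn.
Qed.

Variables (t : C) (th : k) (c : S).
Hypothesis fc : f c != 0.
Notation ev Q := (map_poly i Q).[t].
Notation evr Q := (map_poly f Q).[th].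
(* up to powers of c, Q(t) and Q(th) are divisible by p to the same order, so that t |-> th
   defines a place on S[t, 1/c] *)
Hypothesis adj : forall Q : {poly S}, (ev Q = 0 /\ evr Q = 0) \/
  exists N e R, [/\ i c ^+ N * ev Q = p%:R ^+ e * ev R,
                    f c ^+ N * evr Q = p%:R ^+ e * evr R, evr R != 0 & ev R != 0].

Let ic : i c != 0.
Proof. by rewrite emb_eq0; apply: contraNneq fc => ->; rewrite rmorph0. Qed.

(** The graph of the extended place on S[t, 1/c], sending Q(t)/c^N to Q(th)/c^N. As a relation it
    needs no choice of [Q] and [N]; [adj_val0] makes it single-valued. *)
Definition adj_val (z : C) (w : k) := exists N Q, z * i c ^+ N = ev Q /\ w * f c ^+ N = evr Q.
Definition adj_mem z := exists w, adj_val z w.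

Lemma adj_val1 : adj_val 1 1.
Proof. by exists 0%N, 1; rewrite !rmorph1 !hornerE. Qed.

Lemma adj_valB z w z' w' : adj_val z w -> adj_val z' w' -> adj_val (z - z') (w - w').
Proof.
move=> [N [Q [e1 e2]]] [N' [Q' [e1' e2']]].
exists (N + N')%N, ((c ^+ N')%:P * Q - (c ^+ N)%:P * Q').
rewrite !rmorphB !rmorphM /= !map_polyC /= !hornerE !rmorphXn /= -e1 -e2 -e1' -e2' !exprD.
by split; ring.
Qed.

Lemma adj_valM z w z' w' : adj_val z w -> adj_val z' w' -> adj_val (z * z') (w * w').
Proof.
move=> [N [Q [e1 e2]]] [N' [Q' [e1' e2']]]; exists (N + N')%N, (Q * Q').
by rewrite !rmorphM /= !hornerE -e1 -e2 -e1' -e2' !exprD; split; ring.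
Qed.

(** If Q(t) = 0, the second alternative of [adj] would make a power of p times a nonzero number
    vanish in [C]. *)
Lemma adj_val0 w : adj_val 0 w -> w = 0.
Proof.
move=> [N [Q [e1 e2]]]; rewrite mul0r in e1.
apply: (mulIf (expf_neq0 N fc)); rewrite mul0r e2.
case: (adj Q) => [[_ ->]|[N' [e [R [h _ _ nz]]]]] //.
move: h; rewrite -e1 mulr0 => /eqP; rewrite eq_sym mulf_eq0 (negbTE nz) orbF.
by rewrite (negbTE (expf_neq0 _ pC_neq0)).
Qed.

Lemma adj_val_inj z w w' : adj_val z w -> adj_val z w' -> w = w'.
Proof.
move=> h1 h2; apply/eqP; rewrite -subr_eq0; apply/eqP/adj_val0.
by rewrite -(subrr z); apply: adj_valB.
Qed.

Definition adj_subring : subring C.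
Proof.
apply: (@Subring _ adj_mem) => [|x y [w xw] [w' yw']|x y [w xw] [w' yw']].
- by exists 1; apply: adj_val1.
- by exists (w - w'); apply: adj_valB.
- by exists (w * w'); apply: adj_valM.
Defined.

Let S1 := subring_type adj_subring.

Definition adj_red (z : S1) : k := projT1 (cid (subring_valP z)).

Lemma adj_redP (z : S1) : adj_val (val z) (adj_red z).
Proof. by rewrite /adj_red; case: cid. Qed.

Fact adj_red_zmod : zmod_morphism adj_red.
Proof.
move=> x y; apply: (@adj_val_inj (val (x - y))); first exact: adj_redP.
by rewrite rmorphB; apply: adj_valB; apply: adj_redP.
Qed.
Fact adj_red_monoid : monoid_morphism adj_red.
Proof.
split=> [|x y].
  by apply: (@adj_val_inj (val (1 : S1))); [exact: adj_redP | rewrite rmorph1; apply: adj_val1].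
apply: (@adj_val_inj (val (x * y))); first exact: adj_redP.
by rewrite rmorphM; apply: adj_valM; apply: adj_redP.
Qed.
HB.instance Definition _ := GRing.isZmodMorphism.Build S1 k adj_red adj_red_zmod.
HB.instance Definition _ := GRing.isMonoidMorphism.Build S1 k adj_red adj_red_monoid.

Lemma adj_val_base z : adj_val (i z) (f z).
Proof. by exists 0%N, z%:P; rewrite !map_polyC !hornerE. Qed.
Lemma adj_val_t : adj_val t th.
Proof. by exists 0%N, 'X; rewrite !map_polyX !hornerE. Qed.
Lemma adj_val_inv : adj_val (i c)^-1 (f c)^-1.
Proof. by exists 1%N, 1; rewrite !expr1 !mulVf // !rmorph1 !hornerE. Qed.

Definition adj_elt z w (h : adj_val z w) : S1 := @subring_elt _ adj_subring z (ex_intro _ w h).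

Lemma adj_elt_red z w (h : adj_val z w) : adj_red (adj_elt h) = w.
Proof. by apply: (adj_val_inj (adj_redP _)). Qed.

Lemma adj_fg : finitely_generated_ring S1.
Proof.
have [s gen] := pl_fg P.
exists (adj_elt adj_val_t :: adj_elt adj_val_inv :: [seq adj_elt (adj_val_base z) | z <- s]).
move=> Q Q1 QB QM Qs x.
have Q0 : Q 0 by rewrite -(subrr 1); apply: QB.
have QN y : Q y -> Q (- y) by move=> ?; rewrite -sub0r; apply: QB.
have QD y z : Q y -> Q z -> Q (y + z) by move=> ? ?; rewrite -[z]opprK; apply/QB/QN.
have QX y n : Q y -> Q (y ^+ n) by move=> Qy; elim: n => [|n IH]; rewrite ?expr0 // exprS; apply: QM.
have Qt : Q (adj_elt adj_val_t) by apply: Qs; rewrite mem_head.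
have Qi : Q (adj_elt adj_val_inv) by apply: Qs; rewrite !inE eqxx orbT.
have Qb z : Q (adj_elt (adj_val_base z)).
  apply: (gen (fun z => Q (adj_elt (adj_val_base z)))) => [|y y'|y y'|y ys].
  - have -> : adj_elt (adj_val_base 1) = 1 by apply: val_inj; rewrite /= rmorph1.
    exact: Q1.
  - have -> : adj_elt (adj_val_base (y - y')) = adj_elt (adj_val_base y) - adj_elt (adj_val_base y').
      by apply: val_inj; rewrite [RHS]rmorphB /= rmorphB.
    exact: QB.
  - have -> : adj_elt (adj_val_base (y * y')) = adj_elt (adj_val_base y) * adj_elt (adj_val_base y').
      by apply: val_inj; rewrite [RHS]rmorphM /= rmorphM.
    exact: QM.
  by apply: Qs; rewrite !inE map_f ?orbT.
have [w [N [R [e1 _]]]] := subring_valP x.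
have -> : x = (\sum_(j < size R) adj_elt (adj_val_base R`_j) * adj_elt adj_val_t ^+ j)
     * adj_elt adj_val_inv ^+ N.
  apply: val_inj; apply: (mulIf (expf_neq0 N ic)); rewrite e1 rmorphM rmorphXn /=.
  rewrite exprVn -mulrA mulVf ?expf_neq0 // mulr1 -[subring_val _]/(val _) rmorph_sum.
  rewrite (@horner_coef_wide _ (size R)); last exact: size_poly.
  by apply: eq_bigr => j _; rewrite coef_map rmorphM rmorphXn.
apply: (@QM _ _ _ (QX _ _ Qi)).
by apply: (big_ind Q) => // j _; apply: (@QM _ _ (Qb _) (QX _ _ Qt)).
Qed.

Lemma adj_sep (z : S1) : z != 0 -> exists e w, z = p%:R ^+ e * w /\ adj_red w != 0.
Proof.
move=> z0; have vz : val z != 0 by rewrite -(rmorph0 (val : S1 -> C)) (inj_eq val_inj).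
have [w [N [Q [e1 e2]]]] := subring_valP z.
case: (adj Q) => [[h _]|[M [e [R [h1 h2 nr nz]]]]].
  by move/eqP: e1; rewrite h mulf_eq0 (negbTE vz) (negbTE (expf_neq0 _ ic)).
have av : adj_val (ev R / i c ^+ (N + M)) (evr R / f c ^+ (N + M)).
  by exists (N + M)%N, R; rewrite !divfK ?expf_neq0.
exists e, (adj_elt av); split; last by rewrite adj_elt_red mulf_neq0 ?invr_neq0 ?expf_neq0.
apply: val_inj; rewrite rmorphM rmorphXn rmorph_nat /= mulrA -h1 -e1.
rewrite mulrCA [_ ^+ M * _]mulrC.
by rewrite -exprD mulfK ?expf_neq0.
Qed.

Lemma adj_enum : exists u : nat -> S1, forall z, exists n, u n = z.
Proof.
have [u uP] := pl_enum P.
have base N Q : adj_val (ev Q / i c ^+ N) (evr Q / f c ^+ N).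
  by exists N, Q; rewrite !divfK ?expf_neq0.
exists (fun n => if unpickle n is Some (s, N) then adj_elt (base N (Poly [seq u j | j <- s])) else 0).
move=> z; have [w [N [Q [e1 _]]]] := subring_valP z.
have [v vP] := choice uP.
exists (pickle ([seq v a | a <- (Q : seq S)], N)); rewrite pickleK; apply: val_inj => /=.
rewrite -map_comp (eq_map (g := id)) ?map_id => [|a /=]; last exact: vP.
by rewrite polyseqK -e1 mulfK ?expf_neq0.
Qed.

Definition adj_place : place :=
  @Place S1 (val : {rmorphism S1 -> C}) adj_red val_inj adj_fg adj_sep adj_enum.

Lemma adjoin : exists P' : place, (forall x, exists y, pl_red P' y = f x) /\
  exists y, pl_red P' y = th.
Proof.
exists adj_place; split=> [x|]; first by exists (adj_elt (adj_val_base x)); apply: adj_elt_red.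
by exists (adj_elt adj_val_t); apply: adj_elt_red.
Qed.

End Adjoin.

Hypothesis Cunc : forall a : nat -> C, exists t, forall n, t != a n.

Section AdjoinAny.
Variable P : place.
Let S := pl_ring P.
Let i := pl_emb P.
Let f := pl_red P.
Notation ev Q t := (map_poly i Q).[t].
Notation evr Q th := (map_poly f Q).[th].

Lemma map_emb_eq0 (Q : {poly S}) : (map_poly i Q == 0) = (Q == 0).
Proof.
apply/eqP/eqP => [e|->]; last exact: rmorph0.
apply/polyP => j; apply/(@pl_inj P); rewrite coef0 rmorph0.
by have := congr1 (fun q : {poly C} => q`_j) e; rewrite coef_map coef0.
Qed.

(** The countably many polynomials over [S] have finitely many roots each. A natural number encodes
    a list of coefficients together with the index of a root, and [Cunc] gives a number off the
    resulting sequence. *)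
Lemma transcendental : exists t, forall Q : {poly S}, Q != 0 -> ev Q t != 0.
Proof.
have [u uP] := pl_enum P; have [v vP] := choice uP.
pose rts (q : {poly C}) := sval (closed_field_poly_normal q).
have [t tn] := Cunc (fun n => if unpickle n is Some (s, j) then
  nth 0 (rts (map_poly i (Poly [seq u a | a <- s]))) j else 0).
exists t => Q Q0; apply/eqP => e.
set q := map_poly i Q; have q0 : q != 0 by rewrite map_emb_eq0.
have tr : t \in rts q.
  move/rootP: e; rewrite -/q /rts; case: closed_field_poly_normal => r /= ->.
  by rewrite rootZ ?lead_coef_eq0 // root_prod_XsubC.
have := tn (pickle ([seq v a | a <- (Q : seq S)], index t (rts q))); rewrite pickleK.
rewrite -map_comp (eq_map (g := id)) ?map_id => [|a /=]; last exact: vP.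
by rewrite polyseqK nth_index ?eqxx.
Qed.

(** Taking the content out of [Q] leaves a polynomial that vanishes neither at [t] nor at [th], so
    [adj] holds with c = 1 and N = 0. *)
Lemma adjoin_transcendental th : (forall Q : {poly S}, map_poly f Q != 0 -> evr Q th != 0) ->
  exists P' : place, (forall x, exists y, pl_red P' y = f x) /\
  exists y, pl_red P' y = th.
Proof.
move=> trans; have [t tP] := transcendental.
apply: (@adjoin P t th 1); first by rewrite rmorph1 oner_neq0.
move=> Q; case: (eqVneq Q 0) => [->|Q0]; first by left; rewrite !rmorph0 !horner0.
right; have [e [R [eQ fR]]] := poly_content Q0.
have R0 : R != 0 by apply: contraNneq fR => ->; rewrite rmorph0.
exists 0%N, e, R; split; last exact: tP.
- by rewrite mul1r eQ rmorphM /= map_polyC /= rmorphXn /= rmorph_nat !hornerE.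
- by rewrite mul1r eQ rmorphM /= map_polyC /= rmorphXn /= rmorph_nat !hornerE.
exact: trans.
Qed.

Lemma size_map_emb (Q : {poly S}) : size (map_poly i Q) = size Q.
Proof. by apply: size_map_inj_poly; [exact: pl_inj | exact: rmorph0]. Qed.

Lemma polyM_eq0 (Q R : {poly S}) : Q * R = 0 -> Q = 0 \/ R = 0.
Proof.
move/(congr1 (map_poly i)); rewrite rmorphM rmorph0 /= => /eqP.
by rewrite mulf_eq0 !map_emb_eq0 => /orP [/eqP|/eqP]; [left|right].
Qed.

Lemma content_unique e1 e2 (Q1 Q2 : {poly S}) : map_poly f Q1 != 0 -> map_poly f Q2 != 0 ->
  (p%:R ^+ e1)%:P * Q1 = (p%:R ^+ e2)%:P * Q2 -> Q1 = Q2.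
Proof.
have inj e : injective ( *%R (p%:R ^+ e)%:P : {poly S} -> {poly S}).
  move=> x y h; apply/polyP => j; apply: (@mul_pX_inj P e) => /=.
  by have := congr1 (fun q : {poly S} => q`_j) h; rewrite /= !coefCM.
have aux a d (x y : {poly S}) : map_poly f x != 0 ->
    (p%:R ^+ a)%:P * x = (p%:R ^+ (a + d.+1))%:P * y -> False.
  move=> fx; rewrite exprD polyCM -mulrA => /inj ex; case/eqP: fx.
  by rewrite ex rmorphM /= map_polyC /= rmorphXn /= red_p expr0n /= mul0r.
move=> n1 n2 h; case: (ltngtP e1 e2) => [lt|lt|e]; last by apply: (inj e1); rewrite h e.
  by case: (@aux e1 (e2 - e1).-1 Q1 Q2 n1); rewrite h prednK ?subn_gt0 // subnKC // ltnW.
by case: (@aux e2 (e1 - e2).-1 Q2 Q1 n2); rewrite -h prednK ?subn_gt0 // subnKC // ltnW.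
Qed.

(** Among the polynomials over [S] with nonzero reduction and root [th], one of least degree, [G],
    provides [t] as a root in [C]. Gauss's lemma at p shows that [G] has least degree for [t] as
    well, and inverting its leading coefficient allows division by [G]. *)
Lemma adjoin_algebraic th (F : {poly S}) : map_poly f F != 0 -> evr F th = 0 ->
  exists P' : place, (forall x, exists y, pl_red P' y = f x) /\
  exists y, pl_red P' y = th.
Proof.
move=> F1 F2.
pose D n := `[< exists F : {poly S}, [/\ size F = n, map_poly f F != 0 & evr F th = 0] >].
have exD : exists n, D n by exists (size F); apply/asboolP; exists F.
case: (ex_minnP exD) => n /asboolP [G [Gn fG rG]] minn {F F1 F2 exD}.
have small (Q : {poly S}) : (size Q < n)%N -> map_poly f Q != 0 -> evr Q th != 0.
  move=> sQ fQ; apply/eqP => e; have : D (size Q) by apply/asboolP; exists Q.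
  by move/minn; rewrite leqNgt sQ.
have G0 : G != 0 by apply: contraNneq fG => ->; rewrite rmorph0.
have n0 : (0 < n)%N by rewrite -Gn size_poly_gt0.
pose c := lead_coef G.
have fc : f c != 0.
  (* Otherwise dropping the leading term of [G] leaves a shorter polynomial with the same
     reduction. *)
  apply/eqP => fc; pose G' := \poly_(j < n.-1) G`_j.
  have eG : map_poly f G' = map_poly f G.
    apply/polyP => j; rewrite !coef_map coef_poly; case: ltnP => // jn.
    transitivity (0 : k); first exact: rmorph0.
    case: (ltnP j n) => [jn'|nj]; last by rewrite nth_default ?Gn //; apply: esym; exact: rmorph0.
    have -> : j = (size G).-1 by rewrite Gn; apply/eqP; rewrite eqn_leq jn -ltnS prednK // jn'.
    by rewrite -lead_coefE; exact: esym fc.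
  have := small G'; rewrite eG => /(_ _ fG); rewrite rG eqxx => h.
  suff : false by []. 
  by apply: h; apply: leq_ltn_trans (size_poly _ _) _; rewrite prednK.
have n1 : (1 < n)%N.
  rewrite ltn_neqAle n0 andbT; apply: contra_neq fG => e1; have : size G == 1%N by rewrite Gn -e1.
  case/size_poly1P => a a0 eG; rewrite eG map_polyC /= in rG *.
  by rewrite hornerC in rG; rewrite rG.
have [t /rootP tG] : exists t, root (map_poly i G) t.
  by apply/closed_rootP; rewrite size_map_emb Gn neq_ltn n1 orbT.
have pdiv (U Q : {poly S}) : U != 0 -> exists N A R, (lead_coef U ^+ N)%:P * Q = A * U + R /\ (size R < size U)%N.
  move=> U0; exists (Pdiv.Ring.rscalp Q U), (Pdiv.Ring.rdivp Q U), (Pdiv.Ring.rmodp Q U).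
  by rewrite mul_polyC Pdiv.ComRing.rdivp_eq Pdiv.Ring.ltn_rmodp.
have evM Q R x : ev (Q * R) x = ev Q x * ev R x by rewrite rmorphM hornerM.
have evD Q R x : ev (Q + R) x = ev Q x + ev R x by rewrite rmorphD hornerD.
have evC a x : ev a%:P x = i a by rewrite map_polyC hornerC.
have erM Q R : evr (Q * R) th = evr Q th * evr R th by rewrite rmorphM hornerM.
have erD Q R : evr (Q + R) th = evr Q th + evr R th by rewrite rmorphD hornerD.
have erC a : evr a%:P th = f a by rewrite map_polyC hornerC.
(* G is also the minimal polynomial of t *)
have tmin (Q : {poly S}) : Q != 0 -> (size Q < n)%N -> ev Q t != 0.
  move=> Q0 sQ; apply/eqP => tQ.
  pose D' m := `[< exists Q : {poly S}, [/\ size Q = m, Q != 0 & ev Q t = 0] >].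
  have exD : exists m, D' m by exists (size Q); apply/asboolP; exists Q.
  case: (ex_minnP exD) => m /asboolP [U [Um U0 tU]] minm.
  have mn : (m < n)%N by apply: leq_ltn_trans sQ; apply: minm; apply/asboolP; exists Q.
  have [N [A [R [e1 sR]]]] := pdiv U G U0.
  have R0 : R = 0.
    apply/eqP; case: eqVneq => // R0; have : D' (size R).
      apply/asboolP; exists R; split=> //.
      have := congr1 (fun q => ev q t) e1; rewrite evM evD evM tG tU !mulr0 add0r => <- //.
    by move/minm; rewrite leqNgt -Um sR.
  rewrite R0 addr0 in e1.
  pose l := lead_coef U ^+ N.
  have l0 : (l%:P : {poly S}) != 0.
    have il : i l = i (lead_coef U) ^+ N by exact: rmorphXn.
    have il0 : i l != 0 by rewrite il expf_neq0 // (emb_eq0 (P := P)) lead_coef_eq0.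
    by rewrite -map_emb_eq0 map_polyC polyC_eq0; exact: il0.
  have A0 : A != 0.
    apply: contraNneq l0 => A0; rewrite A0 mul0r in e1.
    by case: (polyM_eq0 e1) => [->//|/eqP]; rewrite (negbTE G0).
  (* Without powers of p the relation reads [l1 * G = U1 * A1]. At [th] the left side vanishes, yet
     both factors on the right have lower degree than [G] and nonzero reduction. *)
  have [a [A1 [eA fA]]] := poly_content A0.
  have [b [U1 [eU fU]]] := poly_content U0.
  have [d [l1 [el fl]]] := poly_content l0.
  have e2 : l1 * G = U1 * A1.
    apply: (@content_unique d (a + b)).
    - by rewrite rmorphM mulf_neq0.
    - by rewrite rmorphM mulf_neq0.
    by rewrite mulrA -el -/l e1 {1}eA {1}eU exprD polyCM; ring.
  have sizep x (X Y : {poly S}) : X = (p%:R ^+ x)%:P * Y -> size X = size Y.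
    move=> eX; rewrite -!size_map_emb eX rmorphM /= map_polyC /= mul_polyC size_scale //.
    by rewrite rmorphXn expf_neq0 //= rmorph_nat pC_neq0.
  have sA : (size A1 < n)%N.
    have := congr1 (fun q => size (map_poly i q)) e1.
    rewrite /= !rmorphM /= map_polyC /= mul_polyC size_scale; last first.
      by rewrite (emb_eq0 (P := P)) -polyC_eq0.
    rewrite size_mul ?map_emb_eq0 // !size_map_emb Gn -(sizep _ _ _ eA) => eS.
    have U1n : (1 < size U)%N.
      rewrite ltn_neqAle size_poly_gt0 U0 andbT; apply: contra_eq_neq tU => e3.
      have : size U == 1%N by rewrite -e3.
      by case/size_poly1P => x x0 ->; rewrite evC (emb_eq0 (P := P)).
    by move: eS U1n n0; case: (size U) => [|[|u]] // -> _ _; rewrite addnS addnS /= ltnS leq_addr.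
  have := congr1 (fun q => evr q th) e2; rewrite !erM rG mulr0 => /esym /eqP.
  rewrite mulf_eq0 (negbTE (small _ sA fA)) orbF; apply/negP; apply: small => //.
  by rewrite -(sizep _ _ _ eU) Um.
apply: (@adjoin P t th c fc) => Q.
(* Pseudo-division replaces [Q] by a remainder of lower degree than [G]; without its content, that
   remainder vanishes neither at [t] nor at [th]. *)
have [N [A [R [e1 sR]]]] := pdiv G Q G0; rewrite Gn in sR.
have h1 : i c ^+ N * ev Q t = ev R t.
  have := congr1 (fun q => ev q t) e1; rewrite evM evD evM tG mulr0 add0r => <-.
  by rewrite evC rmorphXn.
have h2 : f c ^+ N * evr Q th = evr R th.
  have := congr1 (fun q => evr q th) e1; rewrite erM erD erM rG mulr0 add0r => <-.
  by rewrite erC rmorphXn.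
case: (eqVneq R 0) => [R0|R0].
  left; rewrite R0 !rmorph0 !horner0 in h1 h2; split.
    have ic0 : i c != 0.
      rewrite (emb_eq0 (P := P)); apply: contraNneq fc => ->; apply/eqP; exact: rmorph0.
    by move/eqP: h1; rewrite mulf_eq0 (negbTE (expf_neq0 N ic0)) => /eqP.
  by move/eqP: h2; rewrite mulf_eq0 (negbTE (expf_neq0 N fc)) => /eqP.
right; have [e [R1 [eR fR]]] := poly_content R0.
have sR1 : (size R1 < n)%N.
  apply: leq_ltn_trans sR; rewrite -(size_map_emb R) eR rmorphM /= map_polyC /= mul_polyC.
  by rewrite size_scale ?size_map_emb // rmorphXn expf_neq0 //= rmorph_nat pC_neq0.
exists N, e, R1; split.
- by rewrite h1 eR evM evC rmorphXn rmorph_nat.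
- by rewrite h2 eR erM erC rmorphXn rmorph_nat.
- exact: small.
by apply: tmin => //; apply: contraNneq fR => ->; rewrite rmorph0.
Qed.

Lemma adjoin_any th : exists P' : place, (forall x, exists y, pl_red P' y = f x) /\
  exists y, pl_red P' y = th.
Proof.
have [[F [F1 F2]]|H] := pselect (exists F : {poly S}, map_poly f F != 0 /\ evr F th = 0).
  exact: adjoin_algebraic F1 F2.
apply: adjoin_transcendental => Q fQ; apply/eqP => e; apply: H; by exists Q.
Qed.

End AdjoinAny.

Lemma int_fg : finitely_generated_ring int.
Proof.
exists [::] => P P1 PB _ _ x.
have P0 : P 0 by rewrite -(subrr 1); apply: PB.
have PN y : P y -> P (- y) by move=> ?; rewrite -sub0r; apply: PB.
have Pn n : P n%:Z.
  by elim: n => // n IH; rewrite intS addrC -[1]opprK; apply: PB => //; apply: PN.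
by case: x => n; [exact: Pn | rewrite NegzE; apply/PN/Pn].
Qed.

Lemma int_sep (z : int) : z != 0 -> exists e w, z = p%:R ^+ e * w /\ (intr w : k) != 0.
Proof.
move=> z0; have pp := pcharf_prime hp.
have z1 : (0 < `|z|)%N by rewrite lt0n absz_eq0.
have [m pm] := pfactor_coprime pp z1; set e := logn p _ => em.
exists e, (sgz z * m%:Z); split.
  have E : ((p ^ e)%N : int) = p%:R ^+ e by rewrite -[LHS]natz natrX.
  by rewrite {1}[z]intEsg em PoszM E; ring.
rewrite -(dvdz_pcharf hp) dvdzE abszM absz_nat /=.
have -> : `|sgz z|%N = 1%N by case: sgzP z0.
by rewrite mul1n -prime_coprime.
Qed.

Lemma int_enum : exists u : nat -> int, forall z, exists n, u n = z.
Proof. by exists (fun n => odflt 0 (unpickle n)) => z; exists (pickle z); rewrite pickleK. Qed.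

Definition int_place : place.
Proof.
apply: (@Place int (intr : {rmorphism int -> C}) (intr : {rmorphism int -> k})).
- move=> x y /eqP; rewrite -subr_eq0 -rmorphB => /eqP e; apply/eqP; rewrite -subr_eq0.
  have nz n : (n%:R == 0 :> C) = (n == 0%N) := proj1 (pcharf0P C) C0 n.
  case: (x - y) e => n; first by move/eqP; rewrite [_ == 0]nz.
  by rewrite NegzE rmorphN /= => /eqP; rewrite oppr_eq0 [_ == 0]nz.
- exact: int_fg.
- exact: int_sep.
- exact: int_enum.
Defined.

Lemma place_exists (xs : seq k) : exists P : place, forall x, x \in xs -> exists y, pl_red P y = x.
Proof.
elim: xs => [|x xs [P IH]]; first by exists int_place.
have [P' [H1 H2]] := adjoin_any P x; exists P' => y; rewrite inE => /predU1P [->//|/IH [z <-]].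
exact: H1.
Qed.

End Places.

(** * Lifting the curve *)

Section Lift.
Variables (k C : closedFieldType) (p : nat) (hp : p \in [pchar k]).
Hypothesis C0 : [pchar C] =i pred0.
Hypothesis Cunc : forall a : nat -> C, exists t, forall n, t != a n.
Notation red P := (@pl_red k C p P).
Notation emb P := (@pl_emb k C p P).

(** The perturbation is p y^D + c p x^N. The first term dominates in y and gives the leading
    coefficient p, a unit of [C]; the second moves in a pencil with fixed y-derivative, as
    [reduced_pencil] requires. *)
Lemma reduced_perturbation (P : place k C p) (F1 : bipoly (pl_ring P)) N :
  exists h, [/\ ordge N h, bimap (red P) h = 0 & reduced (bimap (emb P) (F1 + h))].
Proof.
set i := emb P; have pn : (p%:R : C) != 0 := pC_neq0 hp C0.
pose D := (N + size F1).+1; pose X : bipoly (pl_ring P) := p%:R%:P%:P * 'X^D.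
have sF : (size (bimap i F1) < D.+1)%N.
  by apply: leq_ltn_trans (size_poly _ _) _; rewrite /D ltnS leqW // leq_addl.
have eX : bimap i X = p%:R%:P *: 'X^D.
  by rewrite rmorphM /= map_polyXn !map_polyC /= map_polyC /= rmorph_nat mul_polyC.
have pu : (p%:R%:P : {poly C}) != 0 by rewrite polyC_eq0.
have sX : size (bimap i X) = D.+1 by rewrite eX size_scale // size_polyXn.
have sq : (size (bimap i F1) < size (bimap i X))%N by rewrite sX.
have [|||c rc] := @reduced_pencil C C0 (bimap i (F1 + X)) (p%:R%:P * 'X^N).
- rewrite rmorphD addrC lead_coefDl //= eX lead_coefZ lead_coefXn mulr1.
  by rewrite poly_unitE size_polyC pn coefC /= unitfE.
- by rewrite rmorphD addrC size_polyDl // sX.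
- by rewrite mulf_neq0 // -size_poly_eq0 size_polyXn.
exists (X + (c%:R * (p%:R%:P * 'X^N))%:P); split.
- apply: ordgeD.
    apply/ordgeMl/(@ordge_le _ _ D); first by rewrite /D leqW // leq_addr.
    by rewrite -(@excdXn _ None D); apply: ordge_exc.
  by rewrite polyCM polyCM mulrA; apply/ordgeMl/ordge_monX.
- have rp : red P p%:R = 0 by rewrite rmorph_nat (pcharf0 hp).
  have eY : map_poly (red P) (c%:R * (p%:R%:P * 'X^N)) = 0.
    by rewrite rmorphM rmorphM /= map_polyC /= rp polyC0 mul0r mulr0.
  by rewrite rmorphD rmorphM /= !map_polyC /= !map_polyC /= rp !polyC0 mul0r add0r eY.
have eY : map_poly i (c%:R * (p%:R%:P * 'X^N)) = c%:R * (p%:R%:P * 'X^N).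
  by rewrite rmorphM rmorphM rmorph_nat /= map_polyC map_polyXn /= rmorph_nat.
by rewrite addrA rmorphD /= map_polyC /= eY.
Qed.

Definition bicoefs (R : nzRingType) (q : {poly {poly R}}) : seq R :=
  flatten [seq polyseq c | c <- polyseq q].

Lemma bicoefsP (R : nzRingType) (q : {poly {poly R}}) i j : q`_j`_i != 0 -> q`_j`_i \in bicoefs q.
Proof.
move=> nz; have jq : (j < size q)%N.
  by rewrite ltnNge; apply: contra nz => h; rewrite (nth_default _ h) coef0.
have iq : (i < size (q`_j)%R)%N.
  by rewrite ltnNge; apply: contra nz => h; rewrite (nth_default _ h).
by apply/flattenP; exists (polyseq q`_j); [apply/map_f/mem_nth | apply: mem_nth].
Qed.

Section LiftPolynomials.
Variables (P : place k C p) (xs : seq k) (s : k -> pl_ring P).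
Hypothesis s0 : s 0 = 0.
Hypothesis sK : {in xs, cancel s (red P)}.

Lemma bimap_lift (q : bipoly k) : {subset bicoefs q <= xs} -> bimap (red P) (bimap s q) = q.
Proof.
move=> sub; apply/polyP => j; apply/polyP => i; rewrite coef_bimap.
have m0 : map_poly s 0 = 0 by exact: map_poly0.
rewrite coef_map_id0 // coef_map_id0 //.
case: (eqVneq q`_j`_i 0) => [->|nz]; first by rewrite s0 rmorph0.
by apply: sK; apply: sub; apply: bicoefsP.
Qed.

Lemma cmap_lift (t : tree k) c : {subset dirs t <= xs} -> c \in conds t ->
  cmap (red P) (cmap s c) = c.
Proof.
move=> sub; have : [seq cmap (red P) (cmap s c) | c <- conds t] = [seq id c | c <- conds t].
  rewrite map_id (map_comp (cmap (red P)) (cmap s)) -!conds_tmap tmap_comp -[in RHS](tmap_id t).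
  by congr conds; apply: eq_tmap => a ad; apply: sK; apply: sub.
by move/eq_in_map => H /H.
Qed.

End LiftPolynomials.

(* A dual basis of the conditions modulo p lifts to a matrix congruent to 1 modulo p;
   its adjugate corrects an arbitrary lift of the curve. *)
Lemma lift_vanishing (f0 : bipoly k) bx by_ (T : tree k) : valid bx by_ T -> vanish T f0 ->
  nondeg bx by_ T f0 ->
  exists (P : place k C p) (s : k -> pl_ring P) (F : bipoly (pl_ring P)),
    [/\ s 0 = 0, {in dirs T, cancel s (red P)}, bimap (red P) F = f0 & vanish (tmap s T) F].
Proof.
(* Distinct conditions make the reduced matrix the identity. *)
move=> vT vf nf; pose cs := undup (conds T).
have /choice [hf hfP] : forall c, exists h, forall c', c' \in conds T -> evc c' h = (c' == c)%:R.
  by move=> c; have [h Hh] := conds_independent vT vf nf (fun c' => (c' == c)%:R); exists h.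
pose xs := bicoefs f0 ++ flatten [seq bicoefs (hf c) | c <- cs] ++ dirs T.
have [P HP] := place_exists hp C0 Cunc xs.
have /choice [s1 s1P] : forall x, exists z, x \in xs -> red P z = x.
  by move=> x; case: (boolP (x \in xs)) => [/HP [z]|_]; [exists z | exists 0].
pose s x := if x == 0 then 0 else s1 x.
have s0 : s 0 = 0 by rewrite /s eqxx.
have sK : {in xs, cancel s (red P)}.
  by move=> x xx; rewrite /s; case: eqP => [->|_]; [rewrite rmorph0 | apply: s1P].
have dT : {subset dirs T <= xs} by move=> a; rewrite !mem_cat => ->; rewrite !orbT.
have lf : bimap (red P) (bimap s f0) = f0.
  by apply: (bimap_lift s0 sK) => x; rewrite mem_cat => ->.
have lh c : c \in cs -> bimap (red P) (bimap s (hf c)) = hf c.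
  move=> cc; apply: (bimap_lift s0 sK) => x xh; rewrite !mem_cat; apply/orP; right.
  by apply/orP; left; apply/flatten_mapP; exists c.
have cK c : c \in conds T -> cmap (red P) (cmap s c) = c by move=> cT; apply: (cmap_lift sK dT cT).
pose c0 : cond k := ([::], (0, 0))%N.
pose cn (a : 'I_(size cs)) := nth c0 cs a.
have cnT a : cn a \in conds T by rewrite -mem_undup; apply: mem_nth.
have cncs a : cn a \in cs by apply: mem_nth.
pose A := \matrix_(a < size cs, b < size cs) evc (cmap s (cn a)) (bimap s (hf (cn b))).
have detA : red P (\det A) = 1.
  rewrite -det_map_mx (_ : map_mx _ _ = 1%:M) ?det1 //; apply/matrixP => a b.
  rewrite !mxE -evc_bimap cK // lh // hfP // nth_uniq ?undup_uniq //.
have /choice [u uP] : forall a, exists z, evc (cmap s (cn a)) (bimap s f0) = p%:R * z.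
  by move=> a; apply: red_ker; rewrite -evc_bimap cK // lf vf.
pose w := \adj A *m \col_a u a.
(* Scaling the lift by the determinant, which reduces to 1, avoids inverting it in the ring. *)
pose F := (\det A)%:P%:P * bimap s f0 -
  p%:R%:P%:P * \sum_b (w b 0)%:P%:P * bimap s (hf (cn b)).
exists P, s, F; split=> //; first by move=> a /dT; apply: sK.
  rewrite rmorphB !rmorphM /= !map_polyC /= !map_polyC /= detA lf mul1r.
  by rewrite rmorph_nat (pcharf0 hp) !polyC0 mul0r subr0.
move=> c; rewrite conds_tmap => /mapP [c1 cT ->].
have ac : (index c1 cs < size cs)%N by rewrite index_mem mem_undup.
have -> : c1 = cn (Ordinal ac) by rewrite /cn nth_index // mem_undup.
set a := Ordinal ac; rewrite evcB !evc_scale uP.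
have -> : evc (cmap s (cn a)) (\sum_b (w b 0)%:P%:P * bimap s (hf (cn b))) = (A *m w) a 0.
  rewrite (raddf_sum (evc (cmap s (cn a)))) mxE; apply: eq_bigr => b _.
  by rewrite /= evc_scale mulrC !mxE.
by rewrite mulmxA mul_mx_adj mul_scalar_mx !mxE mulrCA subrr.
Qed.

Lemma lift_resolved (f0 : bipoly k) (T : tree k) : valid false false T -> vanish T f0 ->
  nondeg false false T f0 ->
  exists (P : place k C p) (F : bipoly (pl_ring P)) (tau : k -> C),
    [/\ bimap (red P) F = f0, reduced (bimap (emb P) F), tau 0 = 0, tau_inj tau T &
        vanish (tmap tau T) (bimap (emb P) F) /\
        nondeg false false (tmap tau T) (bimap (emb P) F)].
Proof.
move=> vT vf nf; have [P [s [F1 [s0 sK eF vF]]]] := lift_vanishing vT vf nf.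
have [N HN] := vanish_ordge (tmap s T); have [h [oh rh red_h]] := reduced_perturbation F1 N.
have eF1 : bimap (red P) (F1 + h) = f0 by rewrite rmorphD /= rh addr0.
have sinj : {in 0 :: dirs T, cancel s (red P)}.
  by move=> a; rewrite inE => /predU1P [->|/sK //]; rewrite s0 rmorph0.
have tinj : tau_inj (emb P \o s) T.
  by move=> a b ha hb /= /(@pl_inj _ _ _ P) e; rewrite -(sinj _ ha) -(sinj _ hb) e.
exists P, (F1 + h), (emb P \o s); split=> //; first by rewrite /= s0 rmorph0.
split.
  rewrite -tmap_comp; apply: vanish_bimap; apply: vanishD => //; exact: HN.
by apply: (nondeg_lift (@pl_inj _ _ _ P) s0 tinj sK); rewrite eF1.
Qed.

(** Used for a curve that misses the origin: there is no cluster, and only reducedness has to be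
    secured. *)
Lemma lift_unit (f0 : bipoly k) : exists (P : place k C p) (F : bipoly (pl_ring P)),
  bimap (red P) F = f0 /\ reduced (bimap (emb P) F).
Proof.
have [P HP] := place_exists hp C0 Cunc (bicoefs f0).
have /choice [s1 s1P] : forall x, exists z, x \in bicoefs f0 -> red P z = x.
  by move=> x; case: (boolP (x \in bicoefs f0)) => [/HP [z]|_]; [exists z | exists 0].
pose s x := if x == 0 then 0 else s1 x.
have s0 : s 0 = 0 by rewrite /s eqxx.
have sK : {in bicoefs f0, cancel s (red P)}.
  by move=> x xx; rewrite /s; case: eqP => [->|_]; [rewrite rmorph0 | apply: s1P].
have [h [_ rh redh]] := reduced_perturbation (bimap s f0) 0.
exists P, (bimap s f0 + h); split=> //.
by rewrite rmorphD /= rh addr0 (bimap_lift s0 sK).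
Qed.

End Lift.

(** * Geometry of the reduced total transforms *)

Section Locate.
Variable A : eqType.
Implicit Types (d : option A) (t : tree A) (ch : seq (option A * tree A)).

Fixpoint lookup d ch : option (tree A) :=
  if ch is dt :: ch' then (if dt.1 == d then Some dt.2 else lookup d ch') else None.

Lemma lookup_mem d ch t : lookup d ch = Some t -> (d, t) \in ch.
Proof.
elim: ch => //= -[d' t'] ch IH /=; case: eqP => [-> [->]|_ /IH]; first by rewrite mem_head.
by rewrite inE orbC => ->.
Qed.

Lemma lookup_none d ch : (lookup d ch == None) = (d \notin [seq dt.1 | dt <- ch]).
Proof.
elim: ch => //= -[d' t'] ch IH /=; rewrite inE negb_or.
have -> : (d == d') = (d' == d) by exact: eq_sym.
by case: (eqVneq d' d).
Qed.

Lemma mem_lookup ch dt : uniq [seq x.1 | x <- ch] -> dt \in ch -> lookup dt.1 ch = Some dt.2.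
Proof.
elim: ch => //= -[d' t'] ch IH /= /andP [nd u]; rewrite inE => /predU1P [->|dtch] /=; first by rewrite eqxx.
case: eqP => [e|_]; last exact: IH.
by case/negP: nd; rewrite e; apply: map_f.
Qed.

End Locate.

(* The exceptional curves through a point and the part of the tree over it;
   [None] in the last component is a point off the strict transform. *)
Fixpoint locate (K : nzRingType) (bx by_ : bool) (t : tree K) (q : near_point K) :
    option (bool * bool * option (tree K)) :=
  match q, t with
  | [::], _ => Some (bx, by_, Some t)
  | d :: q', Leaf => None
  | d :: q', Node m ch =>
    match lookup d ch with
    | Some t' => locate (upx bx d) (upy by_ d) t' q'
    | None => if q' is [::] then Some (upx bx d, upy by_ d, None) else None
    end
  end.

Definition tree_mult (A : Type) (ot : option (tree A)) : nat :=
  match ot with Some (Node m _) => m | Some Leaf => 1 | None => 0 end.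

Definition place_mult (A : Type) (st : bool * bool * option (tree A)) : nat :=
  (st.1.1 + st.1.2 + tree_mult st.2)%N.

Section Geometry.
Variable K : fieldType.
Implicit Types (f g h u R : bipoly K) (d : option K) (t : tree K) (q : near_point K).

Definition total2 f q := foldl (fun h d => chartd d h) f q.

(** A leading form is the restriction of a virtual transform to the exceptional curve, and
    restriction is multiplicative. *)
Lemma lformM a b g h : ordge a g -> ordge b h -> lform (a + b) (g * h) = lform a g * lform b h.
Proof.
move=> og oh.
have E n (x : bipoly K) : lform n x = resd (Some 0) (blow (Some 0) n x).
  by rewrite resd_blow /= polyC0 addr0 comp_polyXr.
rewrite !E -resdM; congr (resd _ _); apply: (@mulexc_inj _ (Some 0) (a + b)) => /=.
have P n (x : bipoly K) : ordge n x -> 'X%:P ^+ n * blowS 0 n x = chartS 0 x.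
  by move=> ox; rewrite -rmorphXn /= -blowSP.
by rewrite P; [rewrite exprD chartSM -(P _ _ og) -(P _ _ oh) mulrACA | apply: ordgeM].
Qed.

Lemma hasmultM a b g h : hasmult a g -> hasmult b h -> hasmult (a + b) (g * h).
Proof.
by move=> [og ng] [oh nh]; split; [exact: ordgeM | rewrite lformM // mulf_neq0].
Qed.

Lemma hasmult0 u : u`_0`_0 != 0 -> hasmult 0 u.
Proof. by move=> u0; split=> //; apply/lform_neq0P; exists 0%N. Qed.

Lemma hasmult_unique m n g : hasmult m g -> hasmult n g -> m = n.
Proof.
wlog mn : m n / (m <= n)%N => [H|[_ nm] [on _]].
  by case: (leqP m n) => [|/ltnW] le hm hn; [|apply: esym]; apply: H.
apply/eqP; rewrite eqn_leq mn leqNgt; apply: contra nm => lt.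
by apply/eqP/polyP => j; rewrite coef_lform coef0; case: leqP => // jm; apply: on; rewrite subnK.
Qed.

Lemma coef00_1 : (1 : bipoly K)`_0`_0 = 1.
Proof. by have -> : (1 : bipoly K) = 1%:P%:P; rewrite ?polyC1 // !coefC. Qed.

Lemma coef_x i j : ('X%:P : bipoly K)`_j`_i = ((j == 0) && (i == 1))%:R.
Proof. by rewrite coefC; case: eqP => _ /=; rewrite ?coefX ?coef0. Qed.

Lemma coef_y i j : ('X : bipoly K)`_j`_i = ((j == 1) && (i == 0))%:R.
Proof. by rewrite coefX; case: eqP => _ /=; rewrite ?coef1 ?coef0. Qed.

Lemma hasmult_exc d (b : bool) : hasmult b (excd d ^+ b).
Proof.
case: b; last by rewrite expr0; apply: hasmult0; rewrite coef00_1 oner_neq0.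
split; first exact: ordge_exc.
apply/lform_neq0P; case: d => [a|] /=; [exists 0%N | exists 1%N] => //.
  by rewrite expr1 coef_x oner_neq0.
by rewrite expr1 coef_y oner_neq0.
Qed.

Lemma bip_neq0 g m : hasmult m g -> g != 0.
Proof. by case=> _; apply: contraNneq => ->; apply/eqP/polyP => j; rewrite coef_lform !coef0; case: ifP. Qed.

(* bx and by_ tell whether x = 0 and y = 0 are exceptional; g is the strict transform *)
Definition normal_form R (bx by_ : bool) g := exists2 u : bipoly K, u`_0`_0 != 0 &
  R = u * 'X%:P ^+ bx * 'X ^+ by_ * g.

Lemma normal_form_mult R bx by_ g m : normal_form R bx by_ g -> hasmult m g ->
  hasmult (bx + by_ + m) R.
Proof.
case=> u u0 -> hm; apply: hasmultM => //; rewrite -[(bx + _)%N]/(0 + bx + by_)%N.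
apply: hasmultM; last exact: (hasmult_exc None).
by apply: hasmultM; [exact: hasmult0 | exact: (hasmult_exc (Some 0))].
Qed.

Definition curve_at bx by_ ot g : Prop :=
  if ot is Some t then [/\ valid bx by_ t, vanish t g & nondeg bx by_ t g] else g`_0`_0 != 0.

Lemma curve_at_mult bx by_ ot g : curve_at bx by_ ot g -> hasmult (tree_mult ot) g.
Proof.
case: ot => [[|m ch]|] /=; last exact: hasmult0.
  case=> v vg [hx hy]; split; first by apply/ordge1P/vanish_leaf.
  apply/lform_neq0P; move: v hx hy; case: bx by_ => [] [] // _ hx hy.
    by exists 1%N => //; apply: hx.
  by exists 0%N => //; apply: hy.
by case=> _ /vanish_node [og _] /nondeg_node [n0 _]; split.
Qed.

Lemma radical_step F R (bx by_ : bool) m (ch : seq (option K * tree K)) g d :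
  radical_generator F R -> normal_form R bx by_ g ->
  curve_at bx by_ (Some (Node m ch)) g ->
  exists2 R', radical_generator (chartd d F) R' &
    normal_form R' (upx bx d) (upy by_ d) (blow d m g).
Proof.
move=> rF nf cg; have [v vg ng] := cg.
have /vanish_node [og _] := vg; have /nondeg_node [n0 _] := ng.
have [oR nR] := normal_form_mult nf (curve_at_mult cg); rewrite /= in oR nR.
have [m0 _ _ _] := valid_node v.
case: nf => u u0 eR; set M := (bx + by_ + m)%N in oR nR.
have M0 : M = M.-1.+1 by rewrite prednK // /M addn_gt0 m0 orbT.
have cX x i : chartd d (x ^+ i) = chartd d x ^+ i by exact: rmorphXn.
have nzR : resd d (blow d M.-1.+1 R) != 0 by rewrite resd_blow lformd_neq0 // -M0.
rewrite M0 in oR; exists (excd d * blow d M.-1.+1 R); first exact: radical_blow.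
have e : chartd d R = excd d ^+ M * blow d M R by rewrite M0; apply: blowP.
rewrite -M0; rewrite {1}eR !chartdM !cX (blowP d og) in e.
(* If y = 0 was exceptional and a is nonzero, its transform y + a misses the new point and joins the
   unit. *)
exists (chartd d u * (if d is Some a then ('X + a%:P%:P) ^+ (by_ && (a != 0)) else 1)).
  rewrite -(resd_coef0 d) resdM resd_chartd; case: (d) => [a|]; last by rewrite (rmorph1 (resd None)) mulr1 coefC.
  rewrite coefCM mulf_neq0 // resd_coef0; case: (eqVneq a 0) => [->|a0].
    by rewrite andbF expr0 coef00_1 oner_neq0.
  case: (by_); last by rewrite expr0 coef00_1 oner_neq0.
  by rewrite expr1 !coefD coef_y add0r !coefC.
move: (blow d M R) (blow d m g) (chartd d u) e => R1 g1 c e.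
apply: (@mulexc_inj _ d M); rewrite [LHS]mulrCA -e {e nzR oR nR cX M0}.
case: d => [a|] /=.
  rewrite chartS_XP chartS_Y exprMn /M !exprD.
  case: (by_) => /=; rewrite ?expr0 ?expr1; last first.
    by move: ('X%:P ^+ bx) ('X%:P ^+ m) => s r; ring.
  case: (eqVneq a 0) => [->|_] /=; rewrite ?polyC0 ?addr0 ?expr0 ?expr1;
    by move: ('X%:P ^+ bx) ('X%:P ^+ m) => s r; ring.
rewrite swapX chartS_Y !polyC0 addr0 swapM swapX swapXY_X chartS_XP swapX exprMn /M !exprD.
by case: (by_) => /=; rewrite ?expr0 ?expr1; move: ('X ^+ bx) ('X ^+ m) => s r; ring.
Qed.

Lemma locate_radical q F R (bx by_ : bool) t g st : radical_generator F R ->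
  normal_form R bx by_ g -> curve_at bx by_ (Some t) g -> locate bx by_ t q = Some st ->
  exists R' g', [/\ radical_generator (total2 F q) R', normal_form R' st.1.1 st.1.2 g' &
    curve_at st.1.1 st.1.2 st.2 g'].
Proof.
elim: q F R bx by_ t g => [|d q IH] F R bx by_ t g rF nf cg; first by case=> <-; exists R, g.
case: t cg => [|m ch] cg //=; have [R1 rF1 nf1] := radical_step d rF nf cg.
have [v vg ng] := cg; have /valid_node [m0 uch _ vch] := v.
have /vanish_node [_ vgch] := vg; have /nondeg_node [n0 ngch] := ng.
case e: lookup => [t'|]; first (move=> loc; apply: (IH _ _ _ _ _ _ rF1 nf1 _ loc)).
  have dtch := lookup_mem e.
  by split; [exact: (vch _ dtch) | exact: (vgch _ dtch) | exact: (ngch _ dtch)].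
case: q {IH} => //= -[<-] /=; exists R1, (blow d m g); split=> //=.
by apply: (blow_unit v vg n0); rewrite -lookup_none e.
Qed.

Lemma radical_unique F R R' : R != 0 -> radical_generator F R -> radical_generator F R' ->
  exists2 u : bipoly K, u`_0`_0 != 0 & R' = u * R.
Proof.
move=> R0 rR rR'.
have [a ea] : mdivides R R' by apply/rR/rR'; apply: mdivides_refl.
have [b eb] : mdivides R' R by apply/rR'/rR; apply: mdivides_refl.
exists a => //; have : b * a = 1 by apply: (mulIf R0); rewrite mul1r -mulrA -ea -eb.
move/(congr1 (fun x : bipoly K => x`_0`_0)); rewrite coefM big_ord1 coefM big_ord1 !coefC /=.
by apply: contra_eq_neq => ->; rewrite mulr0 eq_sym oner_neq0.
Qed.

Definition multiplicity2 F q m := exists2 R, radical_generator (total2 F q) R & hasmult m R.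

Lemma locate_mult q F R (bx by_ : bool) t g st m : radical_generator F R ->
  normal_form R bx by_ g -> curve_at bx by_ (Some t) g -> locate bx by_ t q = Some st ->
  multiplicity2 F q m <-> m = place_mult st.
Proof.
move=> rF nf cg loc; have [R' [g' [rR' nf' cg']]] := locate_radical rF nf cg loc.
have hm := normal_form_mult nf' (curve_at_mult cg'); split=> [[R2 r2 h2]|->]; last by exists R'.
have [u u0 e] := radical_unique (bip_neq0 hm) rR' r2.
by apply: hasmult_unique h2 _; rewrite e; apply: (hasmultM (hasmult0 u0)).
Qed.

Definition snc2 R := exists (u v w : bipoly K) (a b : bool),
  [/\ R = u * v ^+ a * w ^+ b, u`_0`_0 != 0, v`_0`_0 = 0, w`_0`_0 = 0
    & v`_0`_1 * w`_1`_0 - v`_1`_0 * w`_0`_1 != 0].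

Lemma locate_snc q F R (bx by_ : bool) t g st : radical_generator F R ->
  normal_form R bx by_ g -> curve_at bx by_ (Some t) g -> locate bx by_ t q = Some st ->
  (if st.2 is Some (Node _ _) then false else true) ->
  exists2 R', radical_generator (total2 F q) R' & snc2 R'.
Proof.
move=> rF nf cg loc ns; have [R' [g' [rR' [u u0 eR'] cg']]] := locate_radical rF nf cg loc.
exists R' => //; case: st {loc} ns eR' cg' => [[b1 b2] [[|m ch]|]] //= _ eR' cg'.
  case: cg' => v /vanish_leaf vg [hx hy].
  case: b1 b2 v hx hy eR' => [] [] // _ hx hy eR'.
    exists u, 'X%:P, g', true, true; split=> //.
    - by rewrite eR' expr0 mulr1 !expr1.
    - by rewrite coef_x.
    by rewrite !coef_x mul0r subr0 mul1r hx.
  exists u, 'X, g', true, true; split=> //.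
  - by rewrite eR' expr0 mulr1 !expr1.
  - by rewrite coef_y.
  by rewrite !coef_y mul0r mul1r sub0r oppr_eq0 hy.
exists (u * g'), 'X%:P, 'X, b1, b2; split.
- by rewrite eR'; ring.
- by rewrite coefM big_ord1 coefM big_ord1 mulf_neq0.
- by rewrite coef_x.
- by rewrite coef_y.
by rewrite !coef_x !coef_y mul1r mul0r subr0 oner_neq0.
Qed.

End Geometry.

(* preorder traversal: every centre comes after the centres it lies over *)
Fixpoint nodes (A : Type) (t : tree A) : seq (seq (option A)) :=
  match t with
  | Leaf => [::]
  | Node _ ch => [::] :: flatten [seq [seq dt.1 :: q | q <- nodes dt.2] | dt <- ch]
  end.

(** * Order of the centres, and points of the intermediate surfaces *)

Section Nodes.
Variable A : eqType.
Implicit Types (t : tree A) (ch : seq (option A * tree A)) (q : seq (option A)).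

Lemma mem_nodes_cons d q m ch : uniq [seq dt.1 | dt <- ch] ->
  (d :: q \in nodes (Node m ch)) = (if lookup d ch is Some t then q \in nodes t else false).
Proof.
move=> uch; rewrite /= inE /=; apply/flatten_mapP/idP => [[dt dtch /mapP [q' q'n [-> ->]]]|].
  by rewrite (mem_lookup uch dtch).
case e: lookup => [t|] // qt; exists (d, t); first exact: lookup_mem.
exact: map_f.
Qed.

(** [r] stands for the centres blown up before those of [c]. *)
Definition preordered r (c : seq (seq (option A))) := forall i j, (i < size c)%N ->
  (j < size (nth [::] c i))%N -> take j (nth [::] c i) \in r ++ take i c.

Lemma preordered_cat r c1 c2 : preordered r c1 -> preordered (r ++ c1) c2 ->
  preordered r (c1 ++ c2).
Proof.
move=> o1 o2 i j; rewrite size_cat nth_cat take_cat; case: (ltnP i (size c1)) => [ic1 _|c1i ic2]; first exact: (o1 i j ic1).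
by rewrite catA; apply: o2; rewrite ltn_subLR.
Qed.

Lemma preordered_sub r r' c : {subset r <= r'} -> preordered r c -> preordered r' c.
Proof.
move=> sub o i j ic js; have := o i j ic js; rewrite !mem_cat => /orP [/sub ->|->] //.
by rewrite orbT.
Qed.

Lemma preordered_nodes t : preordered [::] (nodes t).
Proof.
elim/tree_induct: t => [|m ch IH] //=; rewrite -cat1s; apply: preordered_cat; first by case.
have ch' dt : dt \in ch -> preordered [:: [::]] [seq dt.1 :: q | q <- nodes dt.2].
  move=> dtch i [|j]; rewrite size_map => il; rewrite (nth_map [::]) //= => jl.
  rewrite inE /= -map_take; apply/map_f; exact: (IH _ dtch i j il jl).
suff gen r : {subset [:: [::]] <= r} ->
    preordered r (flatten [seq [seq dt.1 :: q | q <- nodes dt.2] | dt <- ch]) by exact: gen.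
elim: ch ch' r {IH} => [|dt ch IH] ch' r sub //=.
apply: preordered_cat; first exact: (preordered_sub sub (ch' _ (mem_head _ _))).
apply: IH => [dt' dtch'|x xr]; first by apply: ch'; rewrite inE dtch' orbT.
by rewrite mem_cat sub.
Qed.

Lemma nodes_tmap (B : eqType) (s : A -> B) t :
  nodes (tmap s t) = [seq [seq omap s d | d <- q] | q <- nodes t].
Proof.
elim/tree_induct: t => [|m ch IH] //=; congr (_ :: _).
rewrite map_flatten -!map_comp; congr flatten; apply/eq_in_map => dt dtch /=.
by rewrite IH // -!map_comp; apply: eq_map.
Qed.

End Nodes.

Section Points.
Variable K : fieldType.
Implicit Types (d : option K) (t : tree K) (q : near_point K).

Lemma uniq_nodes bx by_ t : valid bx by_ t -> uniq (nodes t).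
Proof.
elim/tree_induct: t bx by_ => [|m ch IH] bx by_ //= v; have [_ uch _ vch] := valid_node v.
apply/andP; split; first by apply/negP => /flatten_mapP [dt _ /mapP [q _]].
have {}IH dt : dt \in ch -> uniq (nodes dt.2) by move=> dtch; apply: IH (vch _ dtch).
elim: ch uch IH {v vch} => //= dt ch IH1 /andP [nd uch] IH.
rewrite cat_uniq map_inj_uniq ?IH ?mem_head //=; last by move=> x y [].
rewrite IH1 // ?andbT; last by move=> dt' dtch'; apply: IH; rewrite inE dtch' orbT.
apply/hasPn => q /flatten_mapP [dt' dtch' /mapP [q' _ ->]]; apply/mapP => -[q1 _ [e _]].
by case/negP: nd; rewrite -e; apply: map_f.
Qed.

Lemma blowup_sequence_nodes bx by_ t : valid bx by_ t -> blowup_sequence (nodes t).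
Proof.
move=> v i il; apply/andP; split.
  have := uniq_nodes v; rewrite -{1}(cat_take_drop i (nodes t)) (drop_nth [::] il).
  by rewrite cat_uniq /= => /and3P [_ /norP []].
by apply/forallP => j; apply: (preordered_nodes il).
Qed.

Lemma locate_node bx by_ t q : valid bx by_ t -> q \in nodes t -> exists b1 b2 m ch,
  locate bx by_ t q = Some (b1, b2, Some (Node m ch)).
Proof.
elim: q bx by_ t => [|d q IH] bx by_ [|m ch] //= v; first by exists bx, by_, m, ch.
have [_ uch _ vch] := valid_node v; rewrite (mem_nodes_cons d q m uch).
by case e: lookup => [t|] //; apply: IH; apply: (vch _ (lookup_mem e)).
Qed.

Lemma locate_rcons bx by_ t q d : valid bx by_ t -> q \in nodes t -> locate bx by_ t (rcons q d).
Proof.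
elim: q bx by_ t => [|d' q IH] bx by_ [|m ch] //= v; first by case: lookup.
have [_ uch _ vch] := valid_node v; rewrite (mem_nodes_cons _ q m uch).
by case e: lookup => [t|] //; apply: IH; apply: (vch _ (lookup_mem e)).
Qed.

Lemma locate_point c bx by_ t q : valid bx by_ t -> {subset c <= nodes t} -> point_of c q ->
  locate bx by_ t q.
Proof.
move=> v sub /andP [_ /forallP H]; case/lastP: q H => [|q d] H; first by case: t v {sub H}.
apply: locate_rcons => //; apply: sub.
have lt : (size q < size (rcons q d))%N by rewrite size_rcons.
by have := H (Ordinal lt); rewrite /= -cats1 take_size_cat.
Qed.

Lemma locate_notin bx by_ t q st : valid bx by_ t -> locate bx by_ t q = Some st ->
  q \notin nodes t -> if st.2 is Some (Node _ _) then false else true.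
Proof.
elim: q bx by_ t => [|d q IH] bx by_ [|m ch] //= v; first by case=> <-.
have [_ uch _ vch] := valid_node v; rewrite (mem_nodes_cons _ q m uch).
case e: lookup => [t|] //; first by apply: IH; apply: (vch _ (lookup_mem e)).
by case: (q) => // -[<-].
Qed.

(** A point off the strict transform has multiplicity above 1 only where two exceptional curves
    meet, and then its last direction is 0 or [None]. *)
Lemma locate_dir_ok l bx by_ t q st : {subset dirs t <= l} -> locate bx by_ t q = Some st ->
  st.2 || (1 < place_mult st)%N -> all (dir_ok (0 :: l)) q.
Proof.
elim: q bx by_ t => [|d q IH] bx by_ [|m ch] //= sub.
case e: lookup => [t|] => [loc hst|]; last first.
  case: (q) => // -[<-] /=; rewrite andbT /place_mult /= addn0.
  by case: d {e} => [a|] //=; case: (by_) => //=; case: eqP => //= ->; rewrite mem_head.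
have dtch := lookup_mem e; rewrite (IH _ _ _ _ loc hst) ?andbT.
  case: d e dtch {loc} => [a|] //= _ dtch; rewrite inE sub ?orbT //.
  exact: dirs_head dtch _.
by move=> a ad; apply: sub; apply: dirs_child dtch ad.
Qed.

End Points.

(** * Correspondence of infinitely near points *)

Section Transfer.
Variables (k C : fieldType) (tau : k -> C).
Hypothesis tau0 : tau 0 = 0.

Lemma lookup_tmap l (ch : seq (option k * tree k)) d : {in l &, injective tau} -> dir_ok l d ->
  (forall dt, dt \in ch -> dir_ok l dt.1) ->
  lookup (omap tau d) [seq (omap tau dt.1, tmap tau dt.2) | dt <- ch] =
  omap (tmap tau) (lookup d ch).
Proof.
move=> ti dok; elim: ch => //= dt ch IH cok.
have -> : (omap tau dt.1 == omap tau d) = (dt.1 == d).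
  by apply/eqP/eqP => [|-> //]; apply: (omap_tau_inj ti) => //; apply: cok; rewrite mem_head.
case: eqP => // _; apply: IH => dt' dtch'; apply: cok; by rewrite inE dtch' orbT.
Qed.

Lemma locate_tmap l bx by_ (t : tree k) q : {in 0 :: l &, injective tau} -> {subset dirs t <= l} ->
  all (dir_ok (0 :: l)) q ->
  locate bx by_ (tmap tau t) [seq omap tau d | d <- q] =
  omap (fun st => (st.1, omap (tmap tau) st.2)) (locate bx by_ t q).
Proof.
move=> ti; elim: q bx by_ t => [|d q IH] bx by_ [|m ch] //= sub /andP [dok qok].
rewrite (lookup_tmap ti dok) => [|dt dtch]; last first.
  case e: dt.1 => [a|] //=; rewrite inE sub ?orbT //; exact: dirs_head dtch e.
rewrite upx_tau (upy_tau tau0 _ ti dok).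
case e: lookup => [t|] /=; last by case: (q).
by apply: IH => // a ad; apply: sub; apply: dirs_child (lookup_mem e) ad.
Qed.

Lemma place_mult_tmap st :
  place_mult (st.1, omap (tmap tau) st.2) = place_mult st.
Proof. by case: st => [[b1 b2] [[|m ch]|]]. Qed.

Lemma map_omap_inj l : {in l &, injective tau} ->
  {in all (dir_ok l) &, injective (map (omap tau))}.
Proof.
move=> ti; elim=> [|d q IH] [|d' q'] //= /andP [dok qok] /andP [dok' qok'] [e1 e2].
by rewrite (omap_tau_inj ti dok dok' e1) (IH _ qok qok' e2).
Qed.

Lemma dirs_tmap (t : tree k) : dirs (tmap tau t) = map tau (dirs t).
Proof.
elim/tree_induct: t => [|m ch IH] //=; rewrite map_cat; congr (_ ++ _).
  by elim: ch {IH} => //= -[[a|] t] ch IH //=; rewrite IH.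
rewrite map_flatten -!map_comp; congr flatten; apply/eq_in_map => dt dtch /=; exact: IH.
Qed.

Lemma dir_ok_map l q : all (dir_ok (0 :: map tau l)) q ->
  exists2 q0, all (dir_ok (0 :: l)) q0 & q = map (omap tau) q0.
Proof.
elim: q => [|d q IH] /=; first by exists [::].
case/andP=> dok /IH [q0 q0ok ->]; case: d dok => [a|] /=; last by exists (None :: q0).
rewrite inE => /predU1P [->|/mapP [b bl ->]]; first by exists (Some 0 :: q0); rewrite /= ?mem_head ?tau0.
by exists (Some b :: q0) => //=; rewrite inE bl orbT.
Qed.

Lemma point_of_map l c q : {in l &, injective tau} -> all (all (dir_ok l)) c ->
  all (dir_ok l) q ->
  point_of [seq map (omap tau) x | x <- c] (map (omap tau) q) = point_of c q.
Proof.
move=> ti /allP cok qok; have M x : all (dir_ok l) x ->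
    (map (omap tau) x \in [seq map (omap tau) x | x <- c]) = (x \in c).
  move=> xok; apply/mapP/idP => [[y yc e]|xc]; last by exists x.
  by rewrite (map_omap_inj ti xok (cok _ yc) e).
have T j : all (dir_ok l) (take j q) by apply/allP => d /mem_take; apply/allP.
rewrite /point_of M //; congr (_ && _); apply/forallP/forallP => H j.
  have jl : (j < size (map (omap tau) q))%N by rewrite size_map.
  by have := H (Ordinal jl); rewrite /= -map_take M.
have jl : (j < size q)%N by rewrite -(size_map (omap tau) q).
by have := H (Ordinal jl); rewrite /= -map_take M.
Qed.

Lemma prefix_map l q r : {in l &, injective tau} -> all (dir_ok l) q -> all (dir_ok l) r ->
  prefix (map (omap tau) q) (map (omap tau) r) = prefix q r.
Proof.
move=> ti qok rok; rewrite !prefixE size_map -map_take; apply/eqP/eqP => [|-> //].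
apply: (map_omap_inj ti) => //; by apply/allP => d /mem_take; apply/allP.
Qed.

(** Points correspond by applying [tau] to directions, restricted to located points with directions
    among 0, [None] and those of the tree. There [tau] is injective, and by [locate_dir_ok] all
    centres and all points of multiplicity above 1 are included. *)
Theorem multiplicity_data f f' (t : tree k) : tau_inj tau t -> valid false false t ->
  reduced f -> vanish t f -> nondeg false false t f ->
  reduced f' -> vanish (tmap tau t) f' -> nondeg false false (tmap tau t) f' ->
  let c := nodes t in let c' := nodes (tmap tau t) in
  size c = size c' /\
  exists corr : near_point k -> near_point C -> Prop,
    [/\ corr [::] [::] /\
          (forall i, (i < size c)%N -> corr (nth [::] c i) (nth [::] c' i)),
        (forall q q' r r', corr q q' -> corr r r' -> prefix q r = prefix q' r'),
        (forall q q' i, corr q q' ->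
          point_of (take i c) q = point_of (take i c') q'),
        (forall q q' m, corr q q' -> multiplicity2 f q m <-> multiplicity2 f' q' m)
      & (forall i q m, point_of (take i c) q -> multiplicity2 f q m ->
          (1 < m)%N -> exists q', corr q q') /\
        (forall i q' m, point_of (take i c') q' -> multiplicity2 f' q' m ->
          (1 < m)%N -> exists q, corr q q')].
Proof.
move=> ti v rf vf nf rf' vf' nf' c c'.
have ec' : c' = [seq map (omap tau) q | q <- c] by exact: nodes_tmap.
have v' : valid false false (tmap tau t) by rewrite (valid_tmap tau0).
have nform (L : fieldType) (g : bipoly L) : normal_form g false false g.
  by exists 1; rewrite ?coef00_1 ?oner_neq0 // !expr0 !mul1r.
have mf q st m : locate false false t q = Some st ->
    multiplicity2 f q m <-> m = place_mult st.
  by apply: (locate_mult (g := f)).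
have mf' q st m : locate false false (tmap tau t) q = Some st ->
    multiplicity2 f' q m <-> m = place_mult st.
  by apply: (locate_mult (g := f')).
have cok : all (all (dir_ok (0 :: dirs t))) c.
  apply/allP => q /(locate_node v) [b1 [b2 [m [ch loc]]]].
  by apply: (locate_dir_ok _ loc).
split; first by rewrite ec' size_map.
exists (fun q q' => [/\ all (dir_ok (0 :: dirs t)) q, locate false false t q &
  q' = map (omap tau) q]); split.
- split=> [|i il]; first by split=> //; case: (t).
  split; first by apply: (allP cok); apply: mem_nth.
    by have [b1 [b2 [m [ch ->]]]] := locate_node v (mem_nth [::] il).
  by rewrite ec' (nth_map [::]).
- by move=> q q' r r' [qok _ ->] [rok _ ->]; rewrite (prefix_map ti).
- move=> q q' i [qok _ ->]; rewrite ec' -map_take (point_of_map ti) //.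
  by apply/allP => x /mem_take; apply/allP.
- move=> q q' m [qok + ->]; case e: locate => [st|] // _.
  rewrite (mf _ _ _ e) (mf' _ (st.1, omap (tmap tau) st.2)) ?place_mult_tmap //.
  by rewrite (locate_tmap _ _ ti _ qok) ?e.
split=> i q m pq mq m1.
  have sub : {subset take i c <= nodes t} by move=> x /mem_take.
  have := locate_point v sub pq; case e: locate => [st|] // _.
  exists (map (omap tau) q); split=> //.
  by apply: (locate_dir_ok _ e) => //; rewrite -((mf _ _ _ e).1 mq) m1 orbT.
have sub : {subset take i c' <= nodes (tmap tau t)} by move=> x /mem_take.
have := locate_point v' sub pq; case e: locate => [st|] // _.
have := locate_dir_ok (fun x h => h) e; rewrite -((mf' _ _ _ e).1 mq) m1 orbT dirs_tmap.
move=> /(_ isT) /dir_ok_map [q0 qok eq]; exists q0; split=> //.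
by move: e; rewrite eq (locate_tmap _ _ ti _ qok) //; case: locate.
Qed.

End Transfer.

(** * Polynomials as {mpoly K[2]} *)

Section Bivariate.
Variable S : comNzRingType.
Implicit Types (g h : {mpoly S[2]}).

Definition mon2 (i j : nat) : 'X_{1..2} := [multinom (if a == ord0 then i else j) | a < 2].

Lemma mon2_eta (m : 'X_{1..2}) : m = mon2 (m 0) (m 1).
Proof.
apply/mnmP => a; rewrite mnmE; case: (eqVneq a 0) => [->|] //.
by case: a => [[|[|]]] //= ai _; congr (m _); apply: val_inj.
Qed.

Lemma mon2_inj i j i' j' : (mon2 i j == mon2 i' j') = (i == i') && (j == j').
Proof.
apply/eqP/andP => [e|[/eqP -> /eqP ->]] //.
by have := congr1 (fun m : 'X_{1..2} => (m 0, m 1)) e; rewrite !mnmE /= => -[-> ->].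
Qed.

Lemma mdeg_mon2 i j : mdeg (mon2 i j) = (i + j)%N.
Proof. by rewrite mdegE big_ord_recl big_ord1 !mnmE. Qed.

Lemma mdeg2 (m : 'X_{1..2}) : mdeg m = (m 0%R + m 1%R)%N.
Proof. by rewrite [in LHS](mon2_eta m) mdeg_mon2. Qed.

Definition to_bipoly g : bipoly S :=
  mmap (polyC \o polyC) (fun a : 'I_2 => if a == ord0 then 'X%:P else 'X) g.

HB.instance Definition _ := GRing.RMorphism.copy to_bipoly
  (mmap (polyC \o polyC) (fun a : 'I_2 => if a == ord0 then 'X%:P else 'X : bipoly S)).

Lemma to_bipolyX a : to_bipoly 'X_a = if a == ord0 then 'X%:P else 'X.
Proof. by rewrite /to_bipoly mmapX mmap1U. Qed.

Lemma to_bipolyC c : to_bipoly c%:MP = c%:P%:P.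
Proof. exact: mmapC. Qed.

Lemma coef_to_bipoly g i j : (to_bipoly g)`_j`_i = g@_(mon2 i j).
Proof.
elim/mpolyind: g => [|c m g _ _ IH]; first by rewrite rmorph0 !coef0 mcoeff0.
rewrite rmorphD /= !coefD IH mcoeffD mcoeffZ mcoeffX {2}(mon2_eta m) mon2_inj; congr (_ + _).
rewrite /to_bipoly mmapZ mmapX /mmap1 big_ord_recl big_ord1 /= !coefCM; congr (_ * _).
rewrite -rmorphXn coefCM coefXn /= (_ : lift ord0 ord0 = 1); last exact: val_inj.
rewrite andbC [m 1 == j]eq_sym; case: (j == m 1); rewrite ?mulr0 ?coef0 //.
by rewrite mulr1 coefXn eq_sym.
Qed.

Lemma to_bipoly_inj : injective to_bipoly.
Proof.
by move=> g h e; apply/mpolyP => m; rewrite (mon2_eta m) -!coef_to_bipoly e.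
Qed.

Lemma to_bipoly_surj (F : bipoly S) : exists g, to_bipoly g = F.
Proof.
elim/poly_ind: F => [|F c [g <-]]; first by exists 0; rewrite rmorph0.
have [h <-] : exists h, to_bipoly h = c%:P.
  elim/poly_ind: c => [|q c [h eh]]; first by exists 0; rewrite rmorph0.
  exists (h * 'X_0 + c%:MP); rewrite rmorphD rmorphM /= eh to_bipolyX to_bipolyC /=.
  by rewrite rmorphD rmorphM.
by exists (g * 'X_1 + h); rewrite rmorphD rmorphM /= to_bipolyX.
Qed.

Lemma mdivides_bipoly g h : mdivides g h <-> mdivides (to_bipoly g) (to_bipoly h).
Proof.
split=> [[a ->]|[a]]; first by exists (to_bipoly a); rewrite rmorphM.
by have [b <-] := to_bipoly_surj a; rewrite -rmorphM => /to_bipoly_inj ->; exists b.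
Qed.

Lemma radical_bipoly g h : radical_generator g h <->
  radical_generator (to_bipoly g) (to_bipoly h).
Proof.
have dX x n : mdivides g (x ^+ n) <-> mdivides (to_bipoly g) (to_bipoly x ^+ n).
  by rewrite mdivides_bipoly rmorphXn.
split=> H x; last by rewrite mdivides_bipoly H; split=> -[n] /dX ?; exists n.
have [y <-] := to_bipoly_surj x; rewrite -mdivides_bipoly H.
by split=> -[n] /dX ?; exists n.
Qed.

End Bivariate.

Lemma to_bipoly_map (S K : comNzRingType) (f : {rmorphism S -> K}) (g : {mpoly S[2]}) :
  to_bipoly (map_mpoly f g) = bimap f (to_bipoly g).
Proof.
by apply/polyP => j; apply/polyP => i; rewrite coef_bimap !coef_to_bipoly mcoeff_map_mpoly.
Qed.

Section Transforms.
Variable K : fieldType.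
Implicit Types (f g h : {mpoly K[2]}) (d : direction K) (q : near_point K).

Lemma to_bipoly_chart d g : to_bipoly (g \mPo chart d) = chartd d (to_bipoly g).
Proof.
elim/mpolyind: g => [|c m g _ _ IH]; first by rewrite comp_mpoly0 !rmorph0.
rewrite comp_mpolyD !rmorphD /= IH; congr (_ + _).
rewrite -!mul_mpolyC (rmorphM (comp_mpoly _)) /= comp_mpolyC !(rmorphM (@to_bipoly K)) /= chartdM to_bipolyC.
have -> : chartd d c%:P%:P = c%:P%:P.
  by case: (d) => [a|] /=; rewrite ?swapXY_polyC ?map_polyC /= chartS_XP ?swapXY_polyC ?map_polyC.
congr (_ * _); rewrite comp_mpolyX [in RHS]mpolyXE_id !big_ord_recl !big_ord0 !mulr1 !rmorphM /= !rmorphXn /=.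
rewrite !to_bipolyX /=.
case: d {IH} => [a|] /=; rewrite !rmorphM /= ?rmorphD /= ?to_bipolyC !to_bipolyX /=.
  by rewrite !chartS_XP chartS_Y.
by rewrite swapX swapXY_X chartS_XP chartS_Y !polyC0 addr0 swapM swapX swapXY_X ['X * _]mulrC.
Qed.

Lemma to_bipoly_total f q : to_bipoly (total_transform f q) = total2 (to_bipoly f) q.
Proof.
by elim: q f => //= d q IH f; rewrite /total_transform /= -/(total_transform _ _) IH to_bipoly_chart.
Qed.

Lemma reduced_total_bipoly f q g : reduced_total_transform f q g <->
  radical_generator (total2 (to_bipoly f) q) (to_bipoly g).
Proof. by rewrite -to_bipoly_total -radical_bipoly. Qed.

Lemma bigmin_seqP (T : eqType) (F : T -> nat) x (s : seq T) :
  let m := \big[minn/x]_(a <- s) F a in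
  (forall a, a \in s -> m <= F a)%N /\ (m = x \/ exists2 a, a \in s & m = F a).
Proof.
elim: s => [|a s [IH1 IH2]] /=; first by rewrite big_nil; split=> //; left.
rewrite big_cons; split=> [b|].
  by rewrite inE => /predU1P [->|/IH1 le]; [exact: geq_minl | exact: leq_trans (geq_minr _ _) le].
have [le|le] := leqP (F a) (\big[minn/x]_(j <- s) F j).
  by right; exists a; rewrite ?mem_head.
by case: IH2 => [e|[b bs e]]; [left | right; exists b; rewrite // inE bs orbT].
Qed.

Lemma mult0_bipoly g : g != 0 -> hasmult (mult0 g) (to_bipoly g).
Proof.
move=> g0; have [H1 H2] := bigmin_seqP (@mdeg 2) (msize g) (msupp g); rewrite -/(mult0 g) in H1 H2.
split=> [i j ij|].
  rewrite coef_to_bipoly; apply: memN_msupp_eq0; apply/negP => /H1.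
  by rewrite mdeg_mon2 leqNgt ij.
have [m ms e] : exists2 m, m \in msupp g & mult0 g = mdeg m.
  (* The default [msize g] of the minimum is not attained: the leading monomial has smaller
     degree. *)
  case: H2 => // e; have := H1 _ (mlead_supp g0).
  by rewrite e -mlead_deg // ltnn.
rewrite e; apply/lform_neq0P; exists (m 1%R); first by rewrite mdeg2 leq_addl.
by rewrite coef_to_bipoly mdeg2 addnK -mon2_eta -mcoeff_msupp.
Qed.

Lemma total2_neq0 (F : bipoly K) q : F != 0 -> total2 F q != 0.
Proof.
elim: q F => //= d q IH F F0; apply: IH; rewrite -(rmorph0 (chartd d)).
by apply: contra_neq F0; apply: chartd_inj.
Qed.

Lemma multiplicity_bipoly f q m : f != 0 ->
  multiplicity_at f q m <-> multiplicity2 (to_bipoly f) q m.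
Proof.
move=> f0; split=> [[g /reduced_total_bipoly rg <-]|[F rF hF]].
  exists (to_bipoly g) => //; apply: mult0_bipoly; apply/eqP => e; rewrite e rmorph0 in rg.
  have [a] := radical_dvd rg; rewrite mulr0; apply/eqP/total2_neq0.
  by rewrite -(rmorph0 (@to_bipoly K)); apply: contra_neq f0; apply: to_bipoly_inj.
have [g eg] := to_bipoly_surj F; rewrite -eg in rF hF.
exists g; first exact/reduced_total_bipoly.
apply: (hasmult_unique _ hF); apply: mult0_bipoly.
by apply: contraNneq (bip_neq0 hF) => ->; rewrite rmorph0.
Qed.

Lemma meval_bipoly g : g.@[fun=> 0] = (to_bipoly g)`_0`_0.
Proof.
elim/mpolyind: g => [|c m g _ _ IH]; first by rewrite meval0 (rmorph0 (@to_bipoly K)) !coef0.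
rewrite mevalD IH rmorphD !coefD /=; congr (_ + _).
rewrite coef_to_bipoly mcoeffZ mcoeffX mevalZ mevalX [in RHS](mon2_eta m) mon2_inj; congr (_ * _).
rewrite big_ord_recl big_ord1 (_ : lift ord0 ord0 = 1); last exact: val_inj.
by rewrite !expr0n -natrM mulnb.
Qed.

Lemma mnm1_mon2 (a : 'I_2) : U_(a)%MM = mon2 (a == 0) (a == 1).
Proof.
apply/mnmP => b; rewrite mnm1E mnmE; case: (eqVneq b ord0) => [->|] //.
by case: b => [[|[|]]] //; case: a => [[|[|]]].
Qed.

Lemma snc_bipoly g : snc2 (to_bipoly g) -> snc_at0 g.
Proof.
case=> u [v [w [a [b [eg u0 v0 w0 J]]]]].
have [u' eu] := to_bipoly_surj u; have [v' ev] := to_bipoly_surj v.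
have [w' ew] := to_bipoly_surj w; exists u', v', w', a, b.
split; rewrite ?meval_bipoly ?eu ?ev ?ew //.
  by apply: to_bipoly_inj; rewrite !rmorphM !rmorphXn /= eu ev ew.
by rewrite !mnm1_mon2 -!coef_to_bipoly ev ew.
Qed.

Lemma plane_curveP f : plane_curve f <-> reduced (to_bipoly f) /\
  exists2 m, m \in msupp f & (0 < mdeg m)%N.
Proof.
rewrite /plane_curve radical_bipoly; split=> [[s r]|[r [m ms m0]]]; split=> //.
  have f0 : f != 0 by apply: contraTneq s => ->; rewrite msize0.
  by exists (mlead f); [exact: mlead_supp | rewrite -ltnS mlead_deg].
exact: leq_ltn_trans m0 (msize_mdeg_lt ms).
Qed.

End Transforms.

Lemma finitely_generated_image (S T : comNzRingType) (f : {rmorphism S -> T}) :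
  (forall x, exists y, f y = x) -> finitely_generated_ring S -> finitely_generated_ring T.
Proof.
move=> fS [s gen]; exists [seq f x | x <- s] => Q Q1 QB QM Qs x; have [y <-] := fS x.
apply: (gen (fun y => Q (f y))) => [|a b|a b|a /(map_f f)].
- by rewrite rmorph1.
- by rewrite rmorphB; apply: QB.
- by rewrite rmorphM; apply: QM.
- exact: Qs.
Qed.

Lemma skeleton_span (F : fieldType) (S : comNzRingType) (f : {rmorphism S -> F}) (x : F^o) :
  exists n (a : 'I_n -> F) (s : 'I_n -> S), x = \sum_(i < n) a i *: (f (s i) : F^o).
Proof.
by exists 1%N, (fun=> x), (fun=> 1); rewrite big_ord1 rmorph1 /GRing.scale /= mulr1.
Qed.

(** * Compatible skeletons from a place *)

Section PlaceSkeletons.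
Variables (k : fieldType) (C : closedFieldType) (p : nat) (hp : p \in [pchar k]).
Hypothesis C0 : [pchar C] =i pred0.
Variable P : place k C p.
Let f := pl_red P.

Fact red_image1 : exists z, f z = 1. Proof. by exists 1; rewrite rmorph1. Qed.
Fact red_imageB x y : (exists z, f z = x) -> (exists z, f z = y) -> exists z, f z = x - y.
Proof. by case=> z <- [w <-]; exists (z - w); rewrite rmorphB. Qed.
Fact red_imageM x y : (exists z, f z = x) -> (exists z, f z = y) -> exists z, f z = x * y.
Proof. by case=> z <- [w <-]; exists (z * w); rewrite rmorphM. Qed.

(** The reduction of compatible skeletons must be onto, so the place is corestricted to its image;
    the kernel is unchanged. *)
Definition red_image := Subring red_image1 red_imageB red_imageM.

Definition red_cores z : subring_type red_image :=
  subring_elt (ex_intro (fun w => f w = f z) z erefl : red_image (f z)).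

Fact red_cores_zmod : zmod_morphism red_cores.
Proof. by move=> z w; apply: val_inj; rewrite /= !rmorphB. Qed.
Fact red_cores_monoid : monoid_morphism red_cores.
Proof. by split=> [|z w]; apply: val_inj; rewrite /= ?rmorph1 ?rmorphM. Qed.

HB.instance Definition _ := GRing.isZmodMorphism.Build (pl_ring P) (subring_type red_image)
  red_cores red_cores_zmod.
HB.instance Definition _ := GRing.isMonoidMorphism.Build (pl_ring P) (subring_type red_image)
  red_cores red_cores_monoid.

Lemma red_cores_surj x : exists z, red_cores z = x.
Proof. by have [z e] := subring_valP x; exists z; apply: val_inj. Qed.

Definition red_incl : {rmorphism subring_type red_image -> k} := \val.

Definition special_skeleton : skeleton k^o :=
  @Skeleton k k^o (subring_type red_image) red_incl val_inj
    (finitely_generated_image red_cores_surj (@pl_fg _ _ _ P)) (skeleton_span red_incl).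

Definition generic_skeleton : skeleton C^o :=
  @Skeleton C C^o (pl_ring P) (pl_emb P) (@pl_inj _ _ _ P) (@pl_fg _ _ _ P)
    (skeleton_span (pl_emb P)).

Lemma red_cores_ker z : red_cores z = 0 <-> exists w, z = w *+ p.
Proof.
split=> [/(congr1 val) /= /red_ker [w ->]|[w ->]]; first by exists w; rewrite mulr_natl.
by apply: val_inj; rewrite /= rmorphMn /= -mulr_natl (pcharf0 hp) mul0r.
Qed.

Lemma place_torsion_free (z : pl_ring P) : z *+ p = 0 -> z = 0.
Proof.
move/(congr1 (pl_emb P)); rewrite rmorphMn rmorph0 -mulr_natl => /eqP.
by rewrite mulf_eq0 (negPf (pC_neq0 hp C0)) emb_eq0 => /eqP.
Qed.

Definition place_compatible : compatible p special_skeleton generic_skeleton :=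
  @Compatible p k C k^o C^o special_skeleton generic_skeleton red_cores
    red_cores_surj red_cores_ker place_torsion_free.

Lemma generated_ideal1 (A : comNzRingType) (g : 'I_1 -> A) h :
  generated_ideal g h <-> mdivides (g ord0) h.
Proof.
by split=> [[a ->]|[a ->]]; [exists (a ord0) | exists (fun=> a)]; rewrite big_ord1.
Qed.

Lemma place_lifting_curve (F : {mpoly (pl_ring P)[2]}) :
  lifting_curve p (map_mpoly (pl_red P) F) (map_mpoly (pl_emb P) F).
Proof.
exists special_skeleton, generic_skeleton, place_compatible, 1%N, (fun=> F).
split=> h; rewrite generated_ideal1 //=.
suff -> : map_mpoly red_incl (map_mpoly red_cores F) = map_mpoly (pl_red P) F by [].
by apply/mpolyP => m; rewrite !mcoeff_map_mpoly.
Qed.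

End PlaceSkeletons.

(** * Assembling resolutions and multiplicity data *)

Lemma plane_curve_lift (k C : fieldType) (S : comNzRingType) (f : {rmorphism S -> k})
    (i : {rmorphism S -> C}) (F : {mpoly S[2]}) :
  injective i -> plane_curve (map_mpoly f F) -> reduced (to_bipoly (map_mpoly i F)) ->
  plane_curve (map_mpoly i F).
Proof.
move=> inj /plane_curveP [_ [m ms m0]] r; apply/plane_curveP; split=> //; exists m => //.
move: ms; rewrite !mcoeff_msupp !mcoeff_map_mpoly; apply: contraNneq => e.
have -> : F@_m = 0 by apply: inj; rewrite e rmorph0.
by apply/eqP; exact: rmorph0.
Qed.

Lemma resolution_unit (K : fieldType) (f : {mpoly K[2]}) :
  reduced (to_bipoly f) -> (to_bipoly f)`_0`_0 != 0 -> embedded_resolution f [::].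
Proof.
move=> r f0; split=> // q; case: q => [|d q] /andP [_ /forallP H]; last by have := H ord0.
exists f; first exact/reduced_total_bipoly.
apply: snc_bipoly; exists (to_bipoly f), 'X%:P, 'X, false, false.
by rewrite !expr0 !mulr1 f0 !coef_x !coef_y mul1r mul0r subr0 oner_neq0.
Qed.

Lemma resolution_of_tree (K : fieldType) (f : {mpoly K[2]}) t :
  reduced (to_bipoly f) -> valid false false t -> vanish t (to_bipoly f) ->
  nondeg false false t (to_bipoly f) -> embedded_resolution f (nodes t).
Proof.
move=> r v vf nf; split; first exact: blowup_sequence_nodes v.
move=> q pq; have qn : q \notin nodes t by case/andP: pq.
have := locate_point v (fun x => id) pq; case e: locate => [st|] // _.
have nform : normal_form (to_bipoly f) false false (to_bipoly f).
  by exists 1; rewrite ?coef00_1 ?oner_neq0 // !expr0 !mul1r.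
have [F rF sF] := locate_snc r nform (And3 v vf nf) e (locate_notin v e qn).
have [g eg] := to_bipoly_surj F; exists g; first by apply/reduced_total_bipoly; rewrite eg.
by apply: snc_bipoly; rewrite eg.
Qed.

Lemma same_data_unit (K K' : fieldType) (f : {mpoly K[2]}) (f' : {mpoly K'[2]}) :
  f != 0 -> f' != 0 -> reduced (to_bipoly f) -> reduced (to_bipoly f') ->
  (to_bipoly f)`_0`_0 != 0 -> (to_bipoly f')`_0`_0 != 0 ->
  same_multiplicity_data f [::] f' [::].
Proof.
move=> n0 n0' r r' u u'.
have M (L : fieldType) (g : {mpoly L[2]}) m : g != 0 -> reduced (to_bipoly g) ->
    (to_bipoly g)`_0`_0 != 0 -> multiplicity_at g [::] m <-> m = 0%N.
  move=> g0 rg ug; rewrite multiplicity_bipoly //; split=> [[F rF hF]|->].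
    have [v v0 e] := radical_unique (bip_neq0 (hasmult0 ug)) rg rF.
    by apply: (hasmult_unique hF); rewrite e; apply: (hasmultM (hasmult0 v0) (hasmult0 ug)).
  by exists (to_bipoly g) => //; apply: hasmult0.
have N (L : fieldType) (q : near_point L) : point_of [::] q -> q = [::].
  by case: q => [|d q] // /andP [_ /forallP H]; have := H ord0.
split=> //; exists (fun q q' => q = [::] /\ q' = [::]); split=> //.
- by move=> q q' r1 r1' [-> ->] [-> ->].
- move=> q q' i [-> ->]; rewrite /point_of /=.
  by apply/forallP/forallP => _ [].
- by move=> q q' m [-> ->]; rewrite !M.
by split=> i q m /N -> _ _; exists [::].
Qed.

Lemma same_data_tree (k C : fieldType) (tau : k -> C) (f : {mpoly k[2]}) (f' : {mpoly C[2]}) t :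
  tau 0 = 0 -> tau_inj tau t -> f != 0 -> f' != 0 -> valid false false t ->
  reduced (to_bipoly f) -> vanish t (to_bipoly f) -> nondeg false false t (to_bipoly f) ->
  reduced (to_bipoly f') -> vanish (tmap tau t) (to_bipoly f') ->
  nondeg false false (tmap tau t) (to_bipoly f') ->
  same_multiplicity_data f (nodes t) f' (nodes (tmap tau t)).
Proof.
move=> tau0 ti n0 n0' v r vf nf r' vf' nf'.
have [sz [corr [H1 H2 H3 H4 [H5 H6]]]] := multiplicity_data tau0 ti v r vf nf r' vf' nf'.
split=> //; exists corr; split=> //.
  by move=> q q' m /H4; rewrite !multiplicity_bipoly.
split=> i q m pq; rewrite multiplicity_bipoly //; first exact: (H5 i q m pq).
exact: (H6 i q m pq).
Qed.

Lemma complex_uncountable (R : realType) (a : nat -> R[i]) : exists t, forall n, t != a n.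
Proof.
have [r rP] := real_avoid (fun n => complex.Re (a n)).
by exists (r%:C)%C => n; apply: contra_neq (rP n) => <-.
Qed.

Lemma plane_curve_neq0 (K : fieldType) (f : {mpoly K[2]}) : plane_curve f -> f != 0.
Proof. by case=> s _; apply: contraTneq s => ->; rewrite msize0. Qed.

Theorem corollary1p5 (k : closedFieldType) (p : nat) (hp : p \in [pchar k])
    (R : realType) (f : {mpoly k[2]}) (hf : plane_curve f) :
  exists f' : {mpoly R[i][2]},
    [/\ plane_curve f', lifting_curve p f f' & complex_model f f'].
Proof.
have [rf _] := (plane_curveP f).1 hf; have f0 := plane_curve_neq0 hf.
have C0 : [pchar R[i]] =i pred0 by exact: Num.Theory.pchar_num.
have Cunc := @complex_uncountable R.
have lift (P : place k R[i] p) (F : bipoly (pl_ring P)) :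
    bimap (pl_red P) F = to_bipoly f -> reduced (bimap (pl_emb P) F) -> exists f',
    [/\ plane_curve f', lifting_curve p f f' & to_bipoly f' = bimap (pl_emb P) F].
  have [F' <-] := to_bipoly_surj F; rewrite -!to_bipoly_map => /to_bipoly_inj e r.
  exists (map_mpoly (pl_emb P) F'); split=> //; last by rewrite -e; apply: place_lifting_curve.
  by rewrite -e in hf; apply: plane_curve_lift hf r; apply: pl_inj.
(* The curve may miss the origin. Then the empty sequence of blow-ups serves both curves, since the
   lift misses the origin too. *)
case: (eqVneq (to_bipoly f)`_0`_0 0) => [z|u]; last first.
  have [P [F [eF rF]]] := lift_unit hp C0 Cunc (to_bipoly f).
  have [f' [pf' lf' ef']] := lift P F eF rF; exists f'; split=> //.
  have u' : (to_bipoly f')`_0`_0 != 0.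
    rewrite ef' coef_bimap emb_eq0; apply: contraNneq u => e.
    by rewrite -eF coef_bimap e rmorph0.
  rewrite -ef' in rF; exists [::], [::]; split; [exact: resolution_unit.. |].
  by apply: same_data_unit => //; apply: plane_curve_neq0.
have b0 : to_bipoly f != 0.
  by rewrite -(rmorph0 (@to_bipoly k)); apply: contra_neq f0; apply: to_bipoly_inj.
have [m hm] := hasmult_exists b0.
have m0 : (0 < m)%N.
  by case: m hm => // -[_ /lform_neq0P [[|j]]]; rewrite ?z ?eqxx.
have [T [v vf nf]] : resolvable false false (to_bipoly f).
  by apply: (resolution hp m0 _ hm); split.
have [P [F [tau [eF rF tau0 ti [vF nF]]]]] := lift_resolved hp C0 Cunc v vf nf.
have [f' [pf' lf' ef']] := lift P F eF rF; exists f'; split=> //.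
rewrite -ef' in rF vF nF; exists (nodes T), (nodes (tmap tau T)); split.
- exact: resolution_of_tree.
- by apply: resolution_of_tree => //; rewrite (valid_tmap tau0).
by apply: same_data_tree => //; apply: plane_curve_neq0.
Qed.
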